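(* Let $g:S^1\to SU(2)$ be a loop of class $W^{1/2,L^2}$ which has a triangular factorization $g=l\,m\,a\,u$, let $g=g_-g_0g_+$ be its Riemann-Hilbert factorization, and let $$g=k_1(\eta)^*\begin{pmatrix}e^{\chi}&0\\0&e^{-\chi}\end{pmatrix}k_2(\zeta)$$ be its root subgroup factorization, with $\eta=(\eta_n)_{n\ge 0}$ and $\zeta=(\zeta_n)_{n\ge1}$. Let $(a,b)$ denote the first row of $k_1(\eta)$ and $(c,d)$ the second row of $k_2(\zeta)$, and let $\alpha_1,\beta_1,\gamma_2,\delta_2$ be the entries of the triangular factorizations of $k_1(\eta)$ and $k_2(\zeta)$ (all notation as in the context). (a) For $k_1(\eta)$, $$\frac{b}{a}=\frac{\beta_1}{\alpha_1}=\frac{l_{21}^*}{l_{11}^*}.$$ This meromorphic function in $\Delta$ has Taylor series at $z=0$ equal to $\sum_{n=0}^\infty\psi_nz^n$, where $\psi_n$ is the sum of the terms $$(-1)^r(-\overline{\eta}_{i_0})\left(\eta_{j_1}(-\overline{\eta}_{i_1})\right)\cdots\left(\eta_{j_r}(-\overline{\eta}_{i_r})\right)$$ over all $r\ge 0$ and all indices $i_0,\dots,i_r,j_1,\dots,j_r\in\{0,1,2,\dots\}$ such that $j_s<i_s$ and $j_s\le i_{s-1}$ for $s=1,\dots,r$, and $\sum_{s=0}^{r}i_s-\sum_{s=1}^{r}j_s=n$. In particular $$\psi_n=(-\overline{\eta}_n)\prod_{s=0}^{n-1}(1+|\eta_s|^2)+\text{a polynomial in }\eta_s,\overline{\eta}_s,\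 s<n.$$ (b) For $k_2(\zeta)$, $$\frac{c}{d}=\frac{\gamma_2}{\delta_2}=\frac{u_{21}}{u_{22}}=\frac{(g_+)_{21}}{(g_+)_{22}}.$$ This meromorphic function in $\Delta$ has Taylor series at $z=0$ equal to $\sum_{n=1}^\infty\xi_nz^n$, where $\xi_n$ is the sum of the terms $$(-1)^r(-\overline{\zeta}_{i_0})\left(\zeta_{j_1}(-\overline{\zeta}_{i_1})\right)\cdots\left(\zeta_{j_r}(-\overline{\zeta}_{i_r})\right)$$ over all $r\ge 0$ and all indices $i_0,\dots,i_r,j_1,\dots,j_r\in\{1,2,3,\dots\}$ such that $j_s<i_s$ and $j_s\le i_{s-1}$ for $s=1,\dots,r$, and $\sum_{s=0}^{r}i_s-\sum_{s=1}^{r}j_s=n$. In particular $$\xi_n=(-\overline{\zeta}_n)\prod_{s=1}^{n-1}(1+|\zeta_s|^2)+\text{a polynomial in }\zeta_s,\overline{\zeta}_s,\ s<n.$$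
   Context: $\Delta=\{|z|<1\}$ and $\Delta^*=\{|z|>1\}\cup\{\infty\}$ are the open unit disks centered at $0$ and $\infty$; $H^0(U)$ denotes holomorphic functions on $U$, and $H^0(U,G)$ holomorphic maps into $G=SL(2,\mathbb C)$. For a scalar function $f$, $f^*(z)=\overline{f(1/\bar z)}$ (so $f\in H^0(\Delta^* )$ gives $f^*\in H^0(\Delta)$); for a matrix-valued function, $f^*(z)$ is the Hermitian adjoint of $f(1/\bar z)$. On $S^1$ these are the ordinary complex conjugate and adjoint. Triangular factorization of $g$: $g(z)=l(z)\,m\,a\,u(z)$ on $S^1$, where $l=(l_{ij})\in H^0(\Delta^*,G)$ with $l(\infty)=\begin{pmatrix}1&0\\ l_{21}(\infty)&1\end{pmatrix}$, $m=\mathrm{diag}(m_0,m_0^{-1})$ with $|m_0|=1$, $a=\mathrm{diag}(a_0,a_0^{-1})$ with $a_0>0$, $u=(u_{ij})\in H^0(\Delta,G)$ with $u(0)=\begin{pmatrix}1&u_{12}(0)\\0&1\end{pmatrix}$, and $l,u$ have appropriate ($L^2$) boundary values on $S^1$. (In the theorem the letter $a$ in $b/a$ denotes the entry of $k_1(\eta)$, not this matrix.) Riemann-Hilbert factorization of $g$: $g=g_-g_0g_+$ with $g_-\in H^0(\Delta^*,G)$, $g_-(\infty)=1$, $g_0\in G$ constant, $g_+\in H^0(\Delta,G)$, $g_+(0)=1$ (again with appropriate boundary values). It exists and is unique whenever $g$ has a triangular factorization. Root subgroup factorization of $g$: $g=k_1(\eta)^*\,\mathrm{diag}(e^{\chi},e^{-\chi})\,k_2(\zeta)$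 on $S^1$, where, with $\mathbf a(t)=(1+|t|^2)^{-1/2}$, $$k_1(\eta)(z)=\lim_{n\to\infty}\mathbf a(\eta_n)\begin{pmatrix}1&-\overline{\eta}_nz^n\\ \eta_nz^{-n}&1\end{pmatrix}\cdots\mathbf a(\eta_0)\begin{pmatrix}1&-\overline{\eta}_0\\ \eta_0&1\end{pmatrix},$$ $$k_2(\zeta)(z)=\lim_{n\to\infty}\mathbf a(\zeta_n)\begin{pmatrix}1&\zeta_nz^{-n}\\ -\overline{\zeta}_nz^{n}&1\end{pmatrix}\cdots\mathbf a(\zeta_1)\begin{pmatrix}1&\zeta_1z^{-1}\\ -\overline{\zeta}_1z&1\end{pmatrix},$$ $\eta_n,\zeta_n\in\mathbb C$, $\chi(z)=\sum_j\chi_jz^j$ is an $i\mathbb R$-valued Fourier series (modulo $2\pi i\mathbb Z$); the sequences $\eta,\zeta$ have decay corresponding to the smoothness of $g$ ($\sum_n n|\eta_n|^2<\infty$ and $\sum_n n|\zeta_n|^2<\infty$ for $g\in W^{1/2,L^2}$; rapidly decreasing if $g$ is $C^\infty$), and limits are taken entrywise in $L^2(S^1)$. It is a known fact (which may be assumed) that a loop $g:S^1\to SU(2)$ having a triangular factorization has a unique root subgroup factorization, and conversely. It is also known (and may be assumed) that $k_1=k_1(\eta)$ and $k_2=k_2(\zeta)$ have triangular factorizations of the special forms $$k_1=\begin{pmatrix}1&0\\ y^*&1\end{pmatrix}\begin{pmatrix}a_1&0\\0&a_1^{-1}\end{pmatrix}\begin{pmatrix}\alpha_1&\beta_1\\ \gamma_1&\delta_1\end{pmatrix},\qquad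 k_2=\begin{pmatrix}1&x^*\\0&1\end{pmatrix}\begin{pmatrix}a_2&0\\0&a_2^{-1}\end{pmatrix}\begin{pmatrix}\alpha_2&\beta_2\\ \gamma_2&\delta_2\end{pmatrix},$$ with $a_1,a_2>0$, $y=\sum_{n\ge0}y_nz^n$ and $x=\sum_{n\ge1}x_nz^n$ holomorphic in $\Delta$, and the last factors in $H^0(\Delta,G)$ and upper triangular unipotent at $z=0$. Thus the first row of $k_1$ is $(a,b)=a_1(\alpha_1,\beta_1)$ and the second row of $k_2$ is $(c,d)=a_2^{-1}(\gamma_2,\delta_2)$; these rows are regarded as holomorphic functions in $\Delta$. Empty products equal $1$. *)

(* Defs.v *)
From mathcomp Require Import all_boot all_order all_algebra.
From mathcomp Require Import all_classical all_reals all_analysis.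
From mathcomp.real_closed Require Import complex.
From mathcomp.multinomials Require mpoly.

Set Implicit Arguments.
Unset Strict Implicit.
Unset Printing Implicit Defensive.

Import Order.TTheory GRing.Theory Num.Theory.
Import numFieldNormedType.Exports.

Local Open Scope classical_set_scope.
Local Open Scope ring_scope.

(* R[i] itself carries no topology; through this alias it gets the generic
   one of a numFieldType, so [derivable] below is complex derivability. *)
Definition Cplx (R : realType) : numClosedFieldType := R[i].

(* The Riemann sphere; [None] is the point at infinity. *)
Definition sphere (R : realType) : Type := option (Cplx R).

Section Defs.
Variable R : realType.
Local Notation C := (Cplx R).
Local Notation S := (sphere R).
Local Notation mu := (@lebesgue_measure R).

Definition ofR (x : R) : C := real_complex R x.

Definition abs2 (z : C) : R := complex.Re z ^+ 2 + complex.Im z ^+ 2.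

Definition cexp (z : C) : C :=
  ofR (expR (complex.Re z)) *
  Complex (cos (complex.Im z)) (sin (complex.Im z)).

Definition mx2 (p q r s : C) : 'M[C]_2 :=
  \matrix_(i, j) (if i == 0 then if j == 0 then p else q
                  else if j == 0 then r else s).

Definition adjoint (A : 'M[C]_2) : 'M[C]_2 := map_mx Num.conj A^T.

Definition is_SU2 (A : 'M[C]_2) : Prop := A \is unitarymx /\ \det A = 1.

(* Holomorphic functions on Delta = {|z| < 1} and on
   Delta^* = {|z| > 1} U {oo}; the latter are read in the global chart
   z |-> 1/z of Delta^*. *)

Definition holo (f : C -> C) : Prop :=
  forall z : C, `|z| < 1 -> derivable f z 1.

Definition sphere_inv (z : C) : S := if z == 0 then None else Some z^-1.

Definition holo_ext (f : S -> C) : Prop := holo (fun z => f (sphere_inv z)).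

Definition holo_G (u : C -> 'M[C]_2) : Prop :=
  (forall i j, holo (fun z => u z i j)) /\
  (forall z : C, `|z| < 1 -> \det (u z) = 1).

Definition holo_ext_G (l : S -> 'M[C]_2) : Prop :=
  (forall i j, holo_ext (fun p => l p i j)) /\
  (forall z : C, `|z| < 1 -> \det (l (sphere_inv z)) = 1).

(* f |-> f^*, f^*(z) = conj (f (1 / conj z)), in both directions between
   functions on Delta^* and functions on Delta. *)

Definition star (f : S -> C) : C -> C := fun z => (f (sphere_inv z^*))^*.

Definition star_ext (f : C -> C) : S -> C :=
  fun p => (f (if p is Some w then (w^*)^-1 else 0))^*.

(* Functions on S^1 are functions on the complex plane of which only the
   values at the points [circ t] are used. *)

Definition circ (t : R) : C := Complex (cos t) (sin t).

Definition circle : set R := `[0, 2 * pi]%classic.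

Definition circle_measurable (f : C -> C) : Prop :=
  measurable_fun circle (fun t => complex.Re (f (circ t))) /\
  measurable_fun circle (fun t => complex.Im (f (circ t))).

Definition L2norm2 (f : C -> C) : \bar R :=
  (\int[mu]_(t in circle) (abs2 (f (circ t)))%:E)%E.

Definition in_L2 (f : C -> C) : Prop :=
  circle_measurable f /\ (L2norm2 f < +oo)%E.

Definition L2_cvg (f : nat -> C -> C) (h : C -> C) : Prop :=
  [/\ forall n, in_L2 (f n), in_L2 h &
      (fun n => L2norm2 (fun z => f n z - h z)) @ \oo --> 0%E].

Definition ae_circle (P : C -> Prop) : Prop :=
  {ae mu, forall t : R, circle t -> P (circ t)}.

Definition fourier (f : C -> C) (n : int) : C :=
  let F t := f (circ t) * circ (- (n%:~R * t)) in
  (ofR (2 * pi))^-1 *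
    Complex (\int[mu]_(t in circle) complex.Re (F t))
            (\int[mu]_(t in circle) complex.Im (F t)).

(* W^{1/2,L^2}(S^1) *)
Definition in_W12 (f : C -> C) : Prop :=
  in_L2 f /\
  (\esum_(n in [set: int]) (`|n|%:~R * abs2 (fourier f n))%:E < +oo)%E.

(* [fb] is the L^2 boundary value of [f]: the dilates z |-> f (r z)
   converge to [fb] in L^2(S^1) as r tends to 1 from inside the domain. *)

Definition boundary_value (f fb : C -> C) : Prop :=
  in_L2 fb /\
  L2norm2 (fun z => f (ofR r * z) - fb z) @[r --> (1 : R)^'-] --> 0%E.

Definition boundary_value_ext (f : S -> C) (fb : C -> C) : Prop :=
  in_L2 fb /\
  L2norm2 (fun z => f (Some (ofR r * z)) - fb z) @[r --> (1 : R)^'+] --> 0%E.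

Definition boundary_value_mx (u ub : C -> 'M[C]_2) : Prop :=
  forall i j, boundary_value (fun z => u z i j) (fun z => ub z i j).

Definition boundary_value_ext_mx (l : S -> 'M[C]_2) (lb : C -> 'M[C]_2) :
    Prop :=
  forall i j, boundary_value_ext (fun p => l p i j) (fun z => lb z i j).

Definition triangular_factorization (g : C -> 'M[C]_2)
    (l : S -> 'M[C]_2) (m0 : C) (a0 : R) (u : C -> 'M[C]_2) : Prop :=
  [/\ holo_ext_G l /\ l None = mx2 1 0 (l None 1 0) 1,
      `|m0| = 1,
      0 < a0,
      holo_G u /\ u 0 = mx2 1 (u 0 0 1) 0 1 &
      exists lb ub,
        [/\ boundary_value_ext_mx l lb, boundary_value_mx u ub &
            ae_circle (fun z => g z =
              lb z *m mx2 m0 0 0 m0^-1 *m mx2 (ofR a0) 0 0 (ofR a0)^-1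
                *m ub z)]].

Definition riemann_hilbert_factorization (g : C -> 'M[C]_2)
    (gm : S -> 'M[C]_2) (g0 : 'M[C]_2) (gp : C -> 'M[C]_2) : Prop :=
  [/\ holo_ext_G gm /\ gm None = 1%:M,
      \det g0 = 1,
      holo_G gp /\ gp 0 = 1%:M &
      exists gmb gpb,
        [/\ boundary_value_ext_mx gm gmb, boundary_value_mx gp gpb &
            ae_circle (fun z => g z = gmb z *m g0 *m gpb z)]].

Definition bold_a (t : C) : R := (Num.sqrt (1 + abs2 t))^-1.

Definition k1_factor (eta : nat -> C) (n : nat) (z : C) : 'M[C]_2 :=
  ofR (bold_a (eta n)) *:
    mx2 1 (- (eta n)^* * z ^+ n) (eta n * z ^- n) 1.

Definition k2_factor (zeta : nat -> C) (n : nat) (z : C) : 'M[C]_2 :=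
  ofR (bold_a (zeta n)) *:
    mx2 1 (zeta n * z ^- n) (- (zeta n)^* * z ^+ n) 1.

Fixpoint k1_partial (eta : nat -> C) (n : nat) (z : C) : 'M[C]_2 :=
  if n is n'.+1 then k1_factor eta n z *m k1_partial eta n' z
  else k1_factor eta 0 z.

(* zeta is indexed by n >= 1: the entry [zeta 0] is never used. *)
Fixpoint k2_partial (zeta : nat -> C) (n : nat) (z : C) : 'M[C]_2 :=
  if n is n'.+1 then k2_factor zeta n z *m k2_partial zeta n' z
  else 1%:M.

Definition is_k1 (eta : nat -> C) (K1 : C -> 'M[C]_2) : Prop :=
  forall i j,
    L2_cvg (fun n z => k1_partial eta n z i j) (fun z => K1 z i j).

Definition is_k2 (zeta : nat -> C) (K2 : C -> 'M[C]_2) : Prop :=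
  forall i j,
    L2_cvg (fun n z => k2_partial zeta n z i j) (fun z => K2 z i j).

(* The decay conditions matching g in W^{1/2,L^2} *)

Definition w12_seq (n0 : nat) (s : nat -> C) : Prop :=
  (\sum_(n0 <= n <oo) (n%:R * abs2 (s n))%:E < +oo)%E.

Definition w12_fourier (chi : int -> C) : Prop :=
  (\esum_(j in [set: int]) (`|j|%:~R * abs2 (chi j))%:E < +oo)%E.

Definition fourier_sum (chi : int -> C) (N : nat) (z : C) : C :=
  chi 0 + \sum_(1 <= k < N.+1) (chi k%:Z * z ^+ k + chi (- k%:Z) * z ^- k).

Definition root_subgroup_factorization (g : C -> 'M[C]_2)
    (eta : nat -> C) (chi : int -> C) (zeta : nat -> C)
    (K1 K2 : C -> 'M[C]_2) : Prop :=
  [/\ w12_seq 0 eta /\ is_k1 eta K1,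
      w12_fourier chi,
      w12_seq 1 zeta /\ is_k2 zeta K2 &
      exists chif : C -> C,
        [/\ L2_cvg (fourier_sum chi) chif,
            forall t, complex.Re (chif (circ t)) = 0 &
            ae_circle (fun z => g z =
              adjoint (K1 z)
                *m mx2 (cexp (chif z)) 0 0 (cexp (- chif z))
                *m K2 z)]].

Definition k1_triangular (K1 : C -> 'M[C]_2) (y : C -> C) (a1 : R)
    (u1 : C -> 'M[C]_2) : Prop :=
  holo y /\
  triangular_factorization K1 (fun p => mx2 1 0 (star_ext y p) 1) 1 a1 u1.

Definition k2_triangular (K2 : C -> 'M[C]_2) (x : C -> C) (a2 : R)
    (u2 : C -> 'M[C]_2) : Prop :=
  [/\ holo x, x 0 = 0 &
      triangular_factorization K2 (fun p => mx2 1 (star_ext x p) 0 1)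
        1 a2 u2].

(* [f] is the function on S^1 [fb], regarded as a holomorphic function in
   Delta. *)
Definition holo_extension (fb f : C -> C) : Prop :=
  holo f /\ boundary_value f fb.

(* f / h defines a meromorphic function in Delta *)
Definition mero_quot (f h : C -> C) : Prop :=
  [/\ holo f, holo h & exists2 z : C, `|z| < 1 & h z != 0].

(* f1 / h1 = f2 / h2 as meromorphic functions in Delta *)
Definition mero_eq (f1 h1 f2 h2 : C -> C) : Prop :=
  [/\ mero_quot f1 h1, mero_quot f2 h2 &
      forall z : C, `|z| < 1 -> h1 z != 0 -> h2 z != 0 ->
        f1 z / h1 z = f2 z / h2 z].

(* f / h has Taylor series \sum_(n >= n0) s n * z ^+ n at z = 0 *)
Definition taylor_quot (f h : C -> C) (n0 : nat) (s : nat -> C) : Prop :=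
  exists2 rho : R, 0 < rho &
    forall z : C, `|z| < ofR rho ->
      h z != 0 /\
      (fun N : nat => \sum_(n0 <= n < N) s n * z ^+ n) @ \oo -->
        f z / h z.

(* A pair of sequences [i] = (i_0, ..., i_r) and [j] = (j_1, ..., j_r) of
   indices >= n0; thus j_s is [nth 0%N j s.-1]. *)
Definition admissible (n0 n : nat) (ij : seq nat * seq nat) : Prop :=
  let: (i, j) := ij in
  [/\ size i = (size j).+1,
      all (leq n0) i && all (leq n0) j,
      forall s, (1 <= s <= size j)%N ->
        (nth 0%N j s.-1 < nth 0%N i s)%N /\
        (nth 0%N j s.-1 <= nth 0%N i s.-1)%N &
      sumn i = (n + sumn j)%N].

Definition index_term (eta : nat -> C) (ij : seq nat * seq nat) : C :=
  let: (i, j) := ij in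
  let r := size j in
  (-1) ^+ r * (- (eta (nth 0%N i 0))^*) *
  \prod_(1 <= s < r.+1)
    (eta (nth 0%N j s.-1) * (- (eta (nth 0%N i s))^*)).

(* psi_n for n0 = 0 and xi_n for n0 = 1 *)
Definition taylor_coef (n0 : nat) (eta : nat -> C) (n : nat) : C :=
  \sum_(ij \in admissible n0 n) index_term eta ij.

(* The values eta_s, conj eta_s for n0 <= s < n *)
Definition lower_vars (n0 n : nat) (eta : nat -> C) :
    'I_((n - n0) + (n - n0)) -> C :=
  fun k => match fintype.split k with
           | inl s => eta (n0 + s)%N
           | inr s => (eta (n0 + s)%N)^*
           end.

(* The polynomial depends on n only, not on the sequence eta. *)
Definition leading_form (n0 n : nat) : Prop :=
  exists p : mpoly.mpoly ((n - n0) + (n - n0)) C,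
  forall eta : nat -> C,
    taylor_coef n0 eta n =
      (- (eta n)^*) * \prod_(n0 <= s < n) (1 + ofR (abs2 (eta s)))
      + mpoly.meval (lower_vars eta) p.

End Defs.

(* Main.v *)
(* On the circle, the factorizations g = l m a u and g = k_1^* diag(e^chi, e^-chi) k_2 give
     u_21 d - u_22 c = m_0 a_0 e^chi conj(b l_11^* - a l_21^* ).
   The left side phi is holomorphic in the disc and vanishes at 0.  Multiply by
   E_N = exp(-S_N), where S_N is the part of positive frequencies of the N-th partial sum chi_N
   of chi; since chi_N is imaginary, E_N e^chi is a constant times conj(E_N) e^(chi - chi_N).
   Without the factor e^(chi - chi_N) the right side would have no Fourier coefficient of index
   n >= 1; with it, these coefficients tend to 0, because the Lebedev-Milin inequality bounds
   E_N in L^4(S^1) while chi_N tends to chi in L^2.  As E_N(0) = 1, all Taylor coefficients of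
   phi vanish one after the other, so that u_21 / u_22 = c / d and then b / a = l_21^* / l_11^*.
   The quotient for g_+ follows in the same way, without e^chi.

   For the Taylor series, let h_m be z^(-m) times the quotient of the first row of the product of
   the factors of index >= m.  Splitting off the factor of index m gives
     h_m (1 + eta_m z h_(m+1)) = z h_(m+1) - conj(eta_m),
   which is also the recursion obtained for the sums over index sequences >= m by cutting a
   sequence at its last j_s equal to m. *)

Require Import Defs.
From mathcomp Require Import all_boot all_order all_algebra.
From mathcomp Require Import all_classical all_reals all_analysis.
From mathcomp.real_closed Require Import complex.
From mathcomp.multinomials Require mpoly.
From mathcomp Require Import measurable_realfun.
From mathcomp Require Import ring lra zify.

Set Implicit Arguments.
Unset Strict Implicit.
Unset Printing Implicit Defensive.

Import Order.TTheory GRing.Theory Num.Theory.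
Import numFieldNormedType.Exports.

(** The obstacle is regularity. [chi] is only of class W^(1/2), so the exponential of its analytic
    part may be unbounded, and multiplying an L^2 boundary value by it may leave L^2. Truncation
    makes the multiplier the exponential of a polynomial, continuous up to the circle; the price is
    a phase error of modulus one that is close to 1 only in mean square. Cauchy-Schwarz balances the
    two: |e^(i rho) - 1|^4 <= 16 rho^2, so the L^2 smallness of [rho] pairs with the bound for [E],
    which depends on chi only through the sum of j |chi_j|^2 and hence is uniform in N. The rest of
    the right side stays in L^2 because the entries of [K1] are bounded by 1, [K1] being unitary
    almost everywhere on the circle. Holomorphic means complex derivable here, so the Taylor theory
    starts from Goursat's theorem for rectangles; the exponential wraps a rectangle onto an annulus,
    which makes circle means independent of the radius. Taylor coefficients are Cauchy integrals;
    these are continuous for L^2 convergence of boundary values, and so the identities for finite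
    products carry over to k_1 and k_2. *)

Section ComplexBasics.
Local Open Scope classical_set_scope.
Local Open Scope ring_scope.
Variable R : realType.
Local Notation C := (Cplx R).
Local Notation normc := (@Normc.normc R).
Implicit Types (z w : C) (a b : R).

Lemma normcE z : `|z| = ofR (normc z).
Proof. by []. Qed.

Lemma abs2E z : abs2 z = normc z ^+ 2.
Proof.
case: z => a b; rewrite /abs2 /= sqr_sqrtr //.
by rewrite addr_ge0 ?sqr_ge0.
Qed.

Lemma normc_ge0 z : 0 <= normc z.
Proof. by case: z => a b; rewrite sqrtr_ge0. Qed.

Lemma normcM z w : normc (z * w) = normc z * normc w.
Proof. exact: Normc.normcM. Qed.

Lemma normcD z w : normc (z + w) <= normc z + normc w.
Proof. exact: le_normcD. Qed.

Lemma normcN z : normc (- z) = normc z.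
Proof. exact: normcN. Qed.

Lemma normcB z w : normc (z - w) <= normc z + normc w.
Proof. by rewrite -(normcN w) normcD. Qed.

Lemma normcBC z w : normc (z - w) = normc (w - z).
Proof. by rewrite -normcN opprB. Qed.

Lemma normc0 : normc (0 : C) = 0.
Proof. exact: Normc.normc0. Qed.

Lemma normc1 : normc (1 : C) = 1.
Proof. exact: Normc.normc1. Qed.

Lemma normc_eq0 z : (normc z == 0) = (z == 0).
Proof.
apply/idP/idP => [/eqP/Normc.eq0_normc ->//|/eqP ->]; by rewrite normc0.
Qed.

Lemma normc_gt0 z : (0 < normc z) = (z != 0).
Proof. by rewrite lt_def normc_ge0 andbT normc_eq0. Qed.

Lemma normcV z : normc z^-1 = (normc z)^-1.
Proof. exact: Normc.normcV. Qed.

Lemma normcX z n : normc (z ^+ n) = normc z ^+ n.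
Proof.
elim: n => [|n IH]; first by rewrite !expr0 normc1.
by rewrite !exprS normcM IH.
Qed.

Lemma normc_ofR a : normc (ofR a) = `|a|.
Proof. by rewrite /= expr0n addr0 sqrtr_sqr. Qed.

Lemma normc_conj z : normc z^* = normc z.
Proof. by case: z => a b /=; rewrite sqrrN. Qed.

Lemma normc_sum (I : Type) (s : seq I) (P : pred I) (F : I -> C) :
  normc (\sum_(i <- s | P i) F i) <= \sum_(i <- s | P i) normc (F i).
Proof.
elim/big_ind2 : _ => [|x1 x2 y1 y2 h1 h2|//]; first by rewrite normc0.
by apply: le_trans (normcD _ _) _; apply: lerD.
Qed.

Lemma ler_Re z : `|complex.Re z| <= normc z.
Proof.
case: z => a b /=; rewrite -sqrtr_sqr ler_sqrt ?addr_ge0 ?sqr_ge0//.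
by rewrite lerDl sqr_ge0.
Qed.

Lemma ler_Im z : `|complex.Im z| <= normc z.
Proof.
case: z => a b /=; rewrite -sqrtr_sqr ler_sqrt ?addr_ge0 ?sqr_ge0//.
by rewrite lerDr sqr_ge0.
Qed.

Lemma normc_le a b : normc (Complex a b : C) <= `|a| + `|b|.
Proof.
have -> : (Complex a b : C) = Complex a 0 + Complex 0 b.
  by apply/eqP; rewrite eq_complex /= addr0 add0r !eqxx.
apply: le_trans (normcD _ _) _ => /=.
by rewrite !expr0n /= addr0 add0r !sqrtr_sqr.
Qed.

Lemma complex_eq z w :
  complex.Re z = complex.Re w -> complex.Im z = complex.Im w -> z = w.
Proof. by case: z w => a b [c d] /= -> ->. Qed.

Lemma ReD z w : complex.Re (z + w) = complex.Re z + complex.Re w.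
Proof. by case: z w => a b [c d]. Qed.
Lemma ImD z w : complex.Im (z + w) = complex.Im z + complex.Im w.
Proof. by case: z w => a b [c d]. Qed.
Lemma ReN z : complex.Re (- z) = - complex.Re z.
Proof. by case: z => a b. Qed.
Lemma ImN z : complex.Im (- z) = - complex.Im z.
Proof. by case: z => a b. Qed.
Lemma ReM z w : complex.Re (z * w) =
  complex.Re z * complex.Re w - complex.Im z * complex.Im w.
Proof. by case: z w => a b [c d]. Qed.
Lemma ImM z w : complex.Im (z * w) =
  complex.Re z * complex.Im w + complex.Im z * complex.Re w.
Proof. by case: z w => a b [c d]. Qed.
Lemma Re_conj z : complex.Re z^* = complex.Re z.
Proof. by case: z => a b. Qed.
Lemma Im_conj z : complex.Im z^* = - complex.Im z.
Proof. by case: z => a b. Qed.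

Lemma ofRM a b : ofR (a * b) = ofR a * ofR b.
Proof. exact: rmorphM. Qed.
Lemma ofRD a b : ofR (a + b) = ofR a + ofR b.
Proof. exact: rmorphD. Qed.
Lemma ofRN a : ofR (- a) = - ofR a.
Proof. exact: rmorphN. Qed.
Lemma ofR0 : ofR 0 = 0 :> C. Proof. by []. Qed.
Lemma ofR1 : ofR 1 = 1 :> C. Proof. by []. Qed.
Lemma ofRV a : ofR a^-1 = (ofR a)^-1.
Proof. exact: fmorphV. Qed.
Lemma ofRX a n : ofR (a ^+ n) = ofR a ^+ n.
Proof. exact: rmorphXn. Qed.
Lemma ofR_eq0 a : (ofR a == 0) = (a == 0).
Proof. exact: fmorph_eq0. Qed.
Lemma conj_ofR a : (ofR a)^* = ofR a.
Proof. by apply: complex_eq; rewrite ?Re_conj ?Im_conj //= oppr0. Qed.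
Lemma ofR_nat n : ofR (n%:R : R) = n%:R.
Proof. exact: rmorph_nat. Qed.

Lemma mul_conjE z : z * z^* = ofR (abs2 z).
Proof. by apply: complex_eq; case: z => a b; rewrite /abs2 /=; ring. Qed.

Lemma lt_normc_ofR z a : (`|z| < ofR a) = (normc z < a).
Proof. by rewrite normcE ltcR. Qed.

Lemma lt_normc1 z : (`|z| < 1) = (normc z < 1).
Proof. exact: (lt_normc_ofR z 1). Qed.

(** * Convergence in the complex plane, and points of the unit circle *)

Lemma ccvgP (T : Type) (F : set_system T) (FF : Filter F) (f : T -> C) (l : C) :
  f x @[x --> F] --> l <->
  forall e : R, 0 < e -> \forall x \near F, normc (l - f x) < e.
Proof.
split=> [/cvgrPdist_lt h e e0|h].
  have := h (ofR e); rewrite ltcR => /(_ e0).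
  by apply: filterS => x; rewrite lt_normc_ofR.
apply/cvgrPdist_lt => e.
(* A number that is positive for the order of [C] is real, so [e] can be replaced by its real
   part. *)
rewrite ltcE => /andP[/eqP ime ree].
have -> : e = ofR (complex.Re e) by apply: complex_eq.
by apply: filterS (h _ ree) => x; rewrite lt_normc_ofR.
Qed.

Lemma cvg_ReIm (T : Type) (F : set_system T) (FF : Filter F) (f : T -> C) (l : C) :
  f x @[x --> F] --> l <->
  (complex.Re (f x) @[x --> F] --> complex.Re l) /\
  (complex.Im (f x) @[x --> F] --> complex.Im l).
Proof.
split=> [/ccvgP h|[/cvgrPdist_lt hr /cvgrPdist_lt hi]].
  split; apply/cvgrPdist_lt => e e0; apply: filterS (h _ e0) => x; apply: le_lt_trans.
    by rewrite -ReN -ReD ler_Re.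
  by rewrite -ImN -ImD ler_Im.
apply/ccvgP => e e0; have e20 : 0 < e / 2 by rewrite divr_gt0.
apply: filterS2 (hr _ e20) (hi _ e20) => x h1 h2.
rewrite [X in normc X](_ : _ =
  Complex (complex.Re l - complex.Re (f x)) (complex.Im l - complex.Im (f x))); last first.
  by apply: complex_eq; rewrite /= ?ReD ?ReN ?ImD ?ImN.
apply: le_lt_trans (normc_le _ _) _.
by rewrite [ltRHS](splitr e) ltrD.
Qed.

Lemma cvg_normc (T : Type) (F : set_system T) (FF : Filter F) (f : T -> C) (l : C) :
  f x @[x --> F] --> l -> normc (f x) @[x --> F] --> normc l.
Proof.
move=> /ccvgP h; apply/cvgrPdist_lt => e e0; apply: filterS (h _ e0) => x.
apply: le_lt_trans; rewrite ler_norml lerBlDr; apply/andP; split; last first.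
  by rewrite -[X in normc X <= _](subrK (f x)) normcD.
rewrite lerNl opprB lerBlDr -[X in normc X <= _](subrK l).
by apply: le_trans (normcD _ _) _; rewrite normcBC.
Qed.

Lemma cvg_ofR (T : Type) (F : set_system T) (FF : Filter F) (f : T -> R) (l : R) :
  f x @[x --> F] --> l -> (ofR (f x) : C) @[x --> F] --> (ofR l : C).
Proof. by move=> h; apply/cvg_ReIm; split => //=; exact: cvg_cst. Qed.

Lemma circ_continuous : continuous (@circ R).
Proof.
move=> t; apply/cvg_ReIm; split => /=.
  exact: continuous_cos.
exact: continuous_sin.
Qed.

Lemma normc_circ a : normc (circ a) = 1.
Proof. by rewrite /= cos2Dsin2 sqrtr1. Qed.

Lemma circD a b : circ (a + b) = circ a * circ b.
Proof.
by apply: complex_eq; rewrite /= ?cosD ?sinD//; rewrite addrC [X in X + _]mulrC [X in _ + X]mulrC addrC mulrC [X in _ + X]mulrC.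
Qed.

Lemma circ0 : circ 0 = 1 :> C.
Proof. by apply: complex_eq; rewrite /= ?cos0 ?sin0. Qed.

Lemma circN a : circ (- a) = (circ a)^*.
Proof. by apply: complex_eq; rewrite /= ?cosN ?sinN. Qed.

Lemma circ_neq0 a : circ a != 0.
Proof. by rewrite -normc_gt0 normc_circ. Qed.

Lemma circV a : circ (- a) = (circ a)^-1.
Proof.
by apply: (mulfI (circ_neq0 a)); rewrite -circD subrr circ0 divff ?circ_neq0.
Qed.

Lemma circX a n : circ a ^+ n = circ (n%:R * a).
Proof.
elim: n => [|n IH]; first by rewrite expr0 mul0r circ0.
by rewrite exprS IH -circD mulrSr mulrDl mul1r addrC.
Qed.

Lemma circ2pi : circ (2 * pi) = 1 :> C.
Proof. by apply: complex_eq; rewrite /= mulr_natl ?cos2pi ?sin2pi. Qed.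

End ComplexBasics.

Arguments Normc.normc {R} x : simpl never.

(** * Integrals of complex functions over a real interval *)

Section ComplexIntegral.
Local Open Scope classical_set_scope.
Local Open Scope ring_scope.
Variable R : realType.
Local Notation C := (Cplx R).
Local Notation normc := (@Normc.normc R).
Local Notation mu := (@lebesgue_measure R).
Implicit Types (z w c : C) (a b : R) (F G : R -> C).

Definition cint a b F : C :=
  Complex (\int[mu]_(t in `[a, b]) complex.Re (F t))
          (\int[mu]_(t in `[a, b]) complex.Im (F t)).

Definition cintegrable a b F : Prop :=
  mu.-integrable `[a, b] (EFin \o (fun t => complex.Re (F t))) /\
  mu.-integrable `[a, b] (EFin \o (fun t => complex.Im (F t))).

Definition cts_on a b F : Prop :=
  forall t, a <= t <= b -> {for t, continuous F}.

Lemma continuous_integrable a b (f : R -> R) :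
  (forall t, a <= t <= b -> {for t, continuous f}) ->
  mu.-integrable `[a, b] (EFin \o f).
Proof.
move=> h; apply: continuous_compact_integrable; first exact: segment_compact.
apply: continuous_in_subspaceT => t; rewrite inE /= in_itv /= => /h; exact.
Qed.

Lemma cts_integrable a b F : cts_on a b F -> cintegrable a b F.
Proof.
move=> h; split; apply: continuous_integrable => t /h /cvg_ReIm[h1 h2].
  exact: h1.
exact: h2.
Qed.

Lemma eq_cint a b F G : (forall t, a <= t <= b -> F t = G t) ->
  cint a b F = cint a b G.
Proof.
by move=> h; congr Complex; apply: eq_Rintegral => t;
  rewrite inE /= in_itv /= => /h ->.
Qed.

Let mI a b : measurable (`[a, b] : set (measurableTypeR R)).
Proof. exact: measurable_itv. Qed.

Lemma cintegrableD a b F G : cintegrable a b F -> cintegrable a b G ->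
  cintegrable a b (fun t => F t + G t).
Proof.
move=> [f1 f2] [g1 g2]; split.
  by apply: eq_integrable (integrableD (mI a b) f1 g1) => // t _ /=; rewrite ReD EFinD.
by apply: eq_integrable (integrableD (mI a b) f2 g2) => // t _ /=; rewrite ImD EFinD.
Qed.

Lemma cintegrableN a b F : cintegrable a b F -> cintegrable a b (fun t => - F t).
Proof.
move=> [f1 f2]; split.
  by apply: eq_integrable (integrableN f1) => // t _ /=; rewrite ReN EFinN.
by apply: eq_integrable (integrableN f2) => // t _ /=; rewrite ImN EFinN.
Qed.

Lemma cintegrableZ a b c F : cintegrable a b F ->
  cintegrable a b (fun t => c * F t).
Proof.
case: c => x y [f1 f2]; split.
  apply: eq_integrable (integrableB (mI a b) (integrableZl (mI a b) x f1)
    (integrableZl (mI a b) y f2)) => // t _ /=.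
  by rewrite ReM.
apply: eq_integrable (integrableD (mI a b) (integrableZl (mI a b) x f2)
    (integrableZl (mI a b) y f1)) => // t _ /=.
by rewrite ImM.
Qed.

Lemma cintegrable_conj a b F : cintegrable a b F ->
  cintegrable a b (fun t => (F t)^*).
Proof.
move=> [f1 f2]; split.
  by apply: eq_integrable f1 => // t _ /=; rewrite Re_conj.
by apply: eq_integrable (integrableN f2) => // t _ /=; rewrite Im_conj EFinN.
Qed.

Lemma cintD a b F G : cintegrable a b F -> cintegrable a b G ->
  cint a b (fun t => F t + G t) = cint a b F + cint a b G.
Proof.
move=> [f1 f2] [g1 g2]; apply: complex_eq; rewrite /= -RintegralD//;
  apply: eq_Rintegral => t _; by rewrite (ReD, ImD).
Qed.

Lemma cintN a b F : cintegrable a b F ->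
  cint a b (fun t => - F t) = - cint a b F.
Proof.
move=> [f1 f2]; apply: complex_eq; rewrite /= -mulN1r -RintegralZl//;
  apply: eq_Rintegral => t _; by rewrite (ReN, ImN) mulN1r.
Qed.

Lemma cintB a b F G : cintegrable a b F -> cintegrable a b G ->
  cint a b (fun t => F t - G t) = cint a b F - cint a b G.
Proof. by move=> f g; rewrite cintD ?cintN//; exact: cintegrableN. Qed.

Lemma cintZ a b c F : cintegrable a b F ->
  cint a b (fun t => c * F t) = c * cint a b F.
Proof.
case: c => x y [f1 f2]; apply: complex_eq; rewrite /= -!RintegralZl//.
  rewrite -RintegralB//.
  - by apply: eq_Rintegral => t _; rewrite ReM.
  - by apply: eq_integrable (integrableZl (mI a b) x f1).
  - by apply: eq_integrable (integrableZl (mI a b) y f2).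
rewrite -RintegralD//.
- by apply: eq_Rintegral => t _; rewrite ImM.
- by apply: eq_integrable (integrableZl (mI a b) x f2).
- by apply: eq_integrable (integrableZl (mI a b) y f1).
Qed.

Lemma cint_conj a b F : cintegrable a b F ->
  cint a b (fun t => (F t)^*) = (cint a b F)^*.
Proof.
move=> [f1 f2]; apply: complex_eq; rewrite ?Re_conj ?Im_conj /=.
  by apply: eq_Rintegral => t _; rewrite Re_conj.
rewrite -mulN1r -RintegralZl//.
by apply: eq_Rintegral => t _; rewrite Im_conj mulN1r.
Qed.

Lemma cintegrable_cst a b c : cintegrable a b (fun=> c).
Proof. by apply: cts_integrable => t _; exact: cvg_cst. Qed.

Lemma cintegrable_sum (I : Type) (s : seq I) (P : pred I) a b (F : I -> R -> C) :
  (forall i, cintegrable a b (F i)) ->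
  cintegrable a b (fun t => \sum_(i <- s | P i) F i t).
Proof.
move=> h; elim: s => [|i s IH].
  suff -> : (fun t => \sum_(i <- [::] | P i) F i t) = (fun=> 0 : C).
    exact: (cintegrable_cst a b 0).
  by apply/funext => t; rewrite big_nil.
suff -> : (fun t => \sum_(j <- i :: s | P j) F j t) =
  (fun t => (if P i then F i t else 0) + \sum_(j <- s | P j) F j t).
  apply: cintegrableD => //; by case: (P i); [exact: h|exact: cintegrable_cst].
by apply/funext => t; rewrite big_cons; case: ifP => //; rewrite add0r.
Qed.

Lemma cint_cst a b c : a <= b -> cint a b (fun=> c) = c * ofR (b - a).
Proof.
move=> ab; case: c => x y.
have m : fine (mu `[a, b]) = b - a.
  by rewrite lebesgue_measure_itv /= lte_fin; case: ltP => //= ba; lra.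
by apply: complex_eq; rewrite /= Rintegral_cst// m ?mulr0 ?subr0 ?add0r.
Qed.

Lemma cint_sum (I : Type) (s : seq I) (P : pred I) a b (F : I -> R -> C) : a <= b ->
  (forall i, cintegrable a b (F i)) ->
  cint a b (fun t => \sum_(i <- s | P i) F i t) = \sum_(i <- s | P i) cint a b (F i).
Proof.
move=> ab h; elim: s => [|i s IH].
  rewrite big_nil -[RHS](mul0r (ofR (b - a))) -cint_cst//.
  by apply: eq_cint => t _; rewrite big_nil.
rewrite big_cons -IH; case: ifP => Pi; last first.
  by apply: eq_cint => t _; rewrite big_cons Pi.
rewrite -cintD//; last exact: cintegrable_sum.
by apply: eq_cint => t _; rewrite big_cons Pi.
Qed.

Lemma cint_normc_le a b F (g : R -> R) : cintegrable a b F ->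
  mu.-integrable `[a, b] (EFin \o g) ->
  (forall t, a <= t <= b -> normc (F t) <= g t) ->
  normc (cint a b F) <= \int[mu]_(t in `[a, b]) g t.
Proof.
move=> iF ig h; set I := cint a b F.
have [->|I0] := eqVneq I 0.
  rewrite normc0; apply: Rintegral_ge0 => t /=; rewrite in_itv /= => /h.
  by apply: le_trans; exact: normc_ge0.
(* rotate so that the integral becomes its own modulus *)
pose c : C := I^* / ofR (normc I).
have nI : normc I != 0 by rewrite normc_eq0.
have c1 : normc c = 1.
  by rewrite normcM normcV normc_ofR normc_conj ger0_norm ?normc_ge0 ?divff.
have -> : normc I = complex.Re (cint a b (fun t => c * F t)).
  rewrite cintZ// -/I /c mulrAC [_^* * _]mulrC mul_conjE abs2E expr2 ofRM.
  by rewrite mulfK ?ofR_eq0.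
apply: le_Rintegral => //; first by case: (cintegrableZ c iF).
move=> t /=; rewrite in_itv /= => /h; apply: le_trans.
by apply: le_trans (ler_norm _) _; rewrite (le_trans (ler_Re _))// normcM c1 mul1r.
Qed.

Lemma cint_normc_cst a b F (M : R) : a <= b -> cintegrable a b F ->
  (forall t, a <= t <= b -> normc (F t) <= M) ->
  normc (cint a b F) <= M * (b - a).
Proof.
move=> ab iF h; apply: le_trans (cint_normc_le iF _ h) _.
  by apply: continuous_integrable => t _; exact: cvg_cst.
have m : fine (mu `[a, b]) = b - a.
  by rewrite lebesgue_measure_itv /= lte_fin; case: ltP => //= ba; lra.
by rewrite Rintegral_cst// m.
Qed.

Lemma cint_split a m b F : a <= m <= b -> cintegrable a b F ->
  cint a b F = cint a m F + cint m b F.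
Proof.
move=> /andP[am mb] [f1 f2].
have split (f : R -> R) : mu.-integrable `[a, b] (EFin \o f) ->
  \int[mu]_(t in `[a, b]) f t =
  \int[mu]_(t in `[a, m]) f t + \int[mu]_(t in `[m, b]) f t.
  move=> fi; rewrite -[LHS](subrK (\int[mu]_(t in `[a, m]) f t)) addrC; congr (_ + _).
  rewrite Rintegral_itvB ?bnd_simp// Rintegral_itv_obnd_cbnd//.
  by apply: integrableS fi => //; apply: subset_itvr; rewrite bnd_simp.
by apply: complex_eq; rewrite /= split.
Qed.

End ComplexIntegral.

(** * Goursat's theorem for rectangles *)

Section Goursat.
Local Open Scope classical_set_scope.
Local Open Scope ring_scope.
Variable R : realType.
Local Notation C := (Cplx R).
Local Notation normc := (@Normc.normc R).
Local Notation "''i'" := (Complex 0 1 : C).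
Implicit Types (z w c : C) (a b s t : R) (F G : C -> C).

Lemma near_normcP z (P : C -> Prop) :
  (\forall w \near z, P w) <->
  exists2 d : R, 0 < d & forall w, normc (w - z) < d -> P w.
Proof.
split=> [/nbhs_normP[e /= e0 h]|[d d0 h]].
  move: e0; rewrite ltcE /= => /andP[/eqP ime ree].
  exists (complex.Re e) => // w wz; apply: h => /=.
  have -> : e = ofR (complex.Re e) by apply: complex_eq.
  by rewrite lt_normc_ofR normcBC.
apply/nbhs_normP; exists (ofR d) => /=; first by rewrite ltcR.
by move=> w /=; rewrite lt_normc_ofR normcBC => /h.
Qed.

(** Clearing the denominator of the difference quotient includes the point w = z, so that the
    estimate can be integrated over contours and composed with functions that take the value F z
    again. *)
Lemma is_deriveP_eps F z D : is_derive z 1 F D <-> forall e : R, 0 < e ->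
  exists2 d : R, 0 < d & forall w, normc (w - z) < d ->
    normc (F w - F z - D * (w - z)) <= e * normc (w - z).
Proof.
split=> [[/ccvgP h eD] e e0|h].
  have [d d0 hd] := (near_normcP _ _).1 (h _ e0).
  exists d => // w wz; have [->|wnz] := eqVneq w z.
    by rewrite !subrr mulr0 subr0 normc0 mulr0.
  have wz0 : w - z != 0 by rewrite subr_eq0.
  have /= := hd (w - z); rewrite subr0 => /(_ wz wz0) /ltW.
  have -> : (w - z) *: 1 + z = w by rewrite /GRing.scale /= mulr1 subrK.
  rewrite -/('D_1 F z) eD.
  have -> : F w - F z - D * (w - z) = - (w - z) * (D - (w - z)^-1 * (F w - F z)).
    by field.
  by rewrite normcM normcN mulrC; apply: ler_wpM2r; exact: normc_ge0.
suff hD : (fun k : C => k^-1 *: ((F \o shift z) (k *: 1) - F z)) @ 0^' --> D.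
  by apply: DeriveDef; [apply/cvg_ex; exists D|apply: cvg_lim].
apply/ccvgP => e e0.
have e20 : 0 < e / 2 by rewrite divr_gt0.
have [d d0 hd] := h _ e20.
apply/near_normcP; exists d => // k; rewrite subr0 => kd k0.
have := hd (k + z); rewrite addrK => /(_ kd).
have e1 : k *: 1 + z = k + z by rewrite /GRing.scale /= mulr1.
move=> h1; rewrite /= e1.
have -> : D - k^-1 *: (F (k + z) - F z) = - k^-1 * (F (k + z) - F z - D * k).
  by rewrite /GRing.scale /=; field.
rewrite normcM normcN normcV mulrC ltr_pdivrMr ?normc_gt0//.
by apply: (le_lt_trans h1); rewrite ltr_pM2r ?normc_gt0// ltr_pdivrMr// ltr_pMr// ltr1n.
Qed.

Lemma derivableP_eps F z : derivable F z 1 <-> exists D : C, forall e : R, 0 < e ->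
  exists2 d : R, 0 < d & forall w, normc (w - z) < d ->
    normc (F w - F z - D * (w - z)) <= e * normc (w - z).
Proof.
split=> [/derivableP/is_deriveP_eps h|[D /is_deriveP_eps[]//]].
by exists ('D_1 F z).
Qed.

Lemma continuous_hline t s : {for s, continuous (fun s => Complex s t : C)}.
Proof. by apply/cvg_ReIm; split => /=; [exact: cvg_id|exact: cvg_cst]. Qed.

Lemma continuous_vline s t : {for t, continuous (fun t => Complex s t : C)}.
Proof. by apply/cvg_ReIm; split => /=; [exact: cvg_cst|exact: cvg_id]. Qed.

(** The contour integral of [F] over the boundary of the rectangle, counterclockwise; the factor i
    comes from dz on the vertical sides. *)
Definition rint F s0 s1 t0 t1 : C :=
  cint s0 s1 (fun s => F (Complex s t0)) +
  'i * cint t0 t1 (fun t => F (Complex s1 t)) -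
  cint s0 s1 (fun s => F (Complex s t1)) -
  'i * cint t0 t1 (fun t => F (Complex s0 t)).

Definition cts_rect F s0 s1 t0 t1 : Prop := forall s t,
  s0 <= s <= s1 -> t0 <= t <= t1 -> {for (Complex s t : C), continuous F}.

Lemma cts_hline F s0 s1 t0 t1 t : cts_rect F s0 s1 t0 t1 -> t0 <= t <= t1 ->
  cintegrable s0 s1 (fun s => F (Complex s t)).
Proof.
move=> h ht; apply: cts_integrable => s hs.
apply: (@continuous_comp _ _ _ (fun s => Complex s t : C) F).
  exact: continuous_hline.
exact: h.
Qed.

Lemma cts_vline F s0 s1 t0 t1 s : cts_rect F s0 s1 t0 t1 -> s0 <= s <= s1 ->
  cintegrable t0 t1 (fun t => F (Complex s t)).
Proof.
move=> h hs; apply: cts_integrable => t ht.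
apply: (@continuous_comp _ _ _ (fun t => Complex s t : C) F).
  exact: continuous_vline.
exact: h.
Qed.

Lemma rint_split_s F s0 m s1 t0 t1 : s0 <= m <= s1 -> t0 <= t1 ->
  cts_rect F s0 s1 t0 t1 ->
  rint F s0 s1 t0 t1 = rint F s0 m t0 t1 + rint F m s1 t0 t1.
Proof.
move=> hm ht hF; rewrite /rint.
rewrite (cint_split hm (cts_hline hF (t := t0) _)) ?lexx//.
by rewrite (cint_split hm (cts_hline hF (t := t1) _)) ?lexx ?ht//; ring.
Qed.

Lemma rint_split_t F s0 s1 t0 m t1 : s0 <= s1 -> t0 <= m <= t1 ->
  cts_rect F s0 s1 t0 t1 ->
  rint F s0 s1 t0 t1 = rint F s0 s1 t0 m + rint F s0 s1 m t1.
Proof.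
move=> hs hm hF; rewrite /rint.
rewrite (cint_split hm (cts_vline hF (s := s0) _)) ?lexx//.
by rewrite (cint_split hm (cts_vline hF (s := s1) _)) ?lexx ?hs//; ring.
Qed.

Lemma rintB F G s0 s1 t0 t1 : s0 <= s1 -> t0 <= t1 ->
  cts_rect F s0 s1 t0 t1 -> cts_rect G s0 s1 t0 t1 ->
  rint (fun w => F w - G w) s0 s1 t0 t1 =
  rint F s0 s1 t0 t1 - rint G s0 s1 t0 t1.
Proof.
move=> hs ht hF hG; rewrite /rint.
have t0' : t0 <= t0 <= t1 by rewrite lexx.
have t1' : t0 <= t1 <= t1 by rewrite lexx ht.
have s0' : s0 <= s0 <= s1 by rewrite lexx.
have s1' : s0 <= s1 <= s1 by rewrite lexx hs.
rewrite (cintB (cts_hline hF t0') (cts_hline hG t0')).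
rewrite (cintB (cts_hline hF t1') (cts_hline hG t1')).
rewrite (cintB (cts_vline hF s0') (cts_vline hG s0')).
by rewrite (cintB (cts_vline hF s1') (cts_vline hG s1')); ring.
Qed.

Lemma cts_affine c D z w : {for w, continuous (fun w => c + D * (w - z) : C)}.
Proof.
apply: continuousD; first exact: cst_continuous.
apply: continuousM; first exact: cst_continuous.
by apply: continuousB; [move=> ?; exact: cvg_id|exact: cst_continuous].
Qed.

(** The values at opposite points of two parallel sides differ by a constant, so the four integrals
    reduce to two integrals of constants, which cancel. *)
Lemma rint_affine c D z s0 s1 t0 t1 : s0 <= s1 -> t0 <= t1 ->
  rint (fun w => c + D * (w - z)) s0 s1 t0 t1 = 0.
Proof.
move=> hs ht.
have hA : cts_rect (fun w => c + D * (w - z)) s0 s1 t0 t1.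
  by move=> s t _ _; exact: cts_affine.
have t0' : t0 <= t0 <= t1 by rewrite lexx.
have t1' : t0 <= t1 <= t1 by rewrite lexx ht.
have s0' : s0 <= s0 <= s1 by rewrite lexx.
have s1' : s0 <= s1 <= s1 by rewrite lexx hs.
rewrite /rint.
have aff X Y : c + D * X - (c + D * Y) = D * (X - Y) by ring.
transitivity (cint s0 s1 (fun=> D * Complex 0 (t0 - t1)) +
  'i * cint t0 t1 (fun=> D * ofR (s1 - s0))).
  rewrite [cint s0 s1 (fun=> D * _)](_ : _ =
    cint s0 s1 (fun s => c + D * ((Complex s t0 : C) - z)) -
    cint s0 s1 (fun s => c + D * ((Complex s t1 : C) - z))); last first.
    rewrite -(cintB (cts_hline hA t0') (cts_hline hA t1')).
    apply: eq_cint => s _; cbv beta; rewrite aff; congr (_ * _).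
    by apply: complex_eq; rewrite !(ReD, ReN, ImD, ImN) /=; ring.
  rewrite [cint t0 t1 (fun=> D * _)](_ : _ =
    cint t0 t1 (fun t => c + D * ((Complex s1 t : C) - z)) -
    cint t0 t1 (fun t => c + D * ((Complex s0 t : C) - z))); last first.
    rewrite -(cintB (cts_vline hA s1') (cts_vline hA s0')).
    apply: eq_cint => s _; cbv beta; rewrite aff; congr (_ * _).
    by apply: complex_eq; rewrite !(ReD, ReN, ImD, ImN) /=; ring.
  by ring.
transitivity (D * ((Complex 0 (t0 - t1) : C) * ofR (s1 - s0) +
    'i * (ofR (s1 - s0) * ofR (t1 - t0)))); first by rewrite !cint_cst//; ring.
rewrite [X in D * X](_ : _ = 0) ?mulr0//.
by apply: complex_eq; rewrite !(ReD, ReM, ImD, ImM) /=; ring.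
Qed.

Lemma rint_normc_le F s0 s1 t0 t1 (M : R) : s0 <= s1 -> t0 <= t1 ->
  cts_rect F s0 s1 t0 t1 ->
  (forall s t, s0 <= s <= s1 -> t0 <= t <= t1 -> normc (F (Complex s t)) <= M) ->
  normc (rint F s0 s1 t0 t1) <= 2 * M * ((s1 - s0) + (t1 - t0)).
Proof.
move=> hs ht hF hM.
have t0' : t0 <= t0 <= t1 by rewrite lexx.
have t1' : t0 <= t1 <= t1 by rewrite lexx ht.
have s0' : s0 <= s0 <= s1 by rewrite lexx.
have s1' : s0 <= s1 <= s1 by rewrite lexx hs.
have n1 : normc 'i = 1 by rewrite /Normc.normc expr0n expr1n add0r sqrtr1.
apply: le_trans (normcB _ _) _.
apply: le_trans (lerD (normcB _ _) (lexx _)) _.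
apply: le_trans (lerD (lerD (normcD _ _) (lexx _)) (lexx _)) _.
rewrite !normcM n1 !mul1r.
have h1 := cint_normc_cst hs (cts_hline hF t0') (fun s hs => hM _ _ hs t0').
have h2 := cint_normc_cst hs (cts_hline hF t1') (fun s hs => hM _ _ hs t1').
have h3 := cint_normc_cst ht (cts_vline hF s0') (fun s hs => hM _ _ s0' hs).
have h4 := cint_normc_cst ht (cts_vline hF s1') (fun s hs => hM _ _ s1' hs).
lra.
Qed.

Lemma nested_intervals (p q : nat -> R) :
  (forall n, p n <= p n.+1 /\ q n.+1 <= q n /\ p n <= q n) ->
  exists x, forall n, p n <= x <= q n.
Proof.
move=> h.
have hp : {homo p : m n / (m <= n)%N >-> m <= n}.
  by apply: homo_leq => [x|x y z|n]; [exact: lexx|exact: le_trans|case: (h n)].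
have hq : {homo q : m n / (m <= n)%N >-> n <= m}.
  apply: (@homo_leq _ q (fun x y => y <= x)) => [x|x y z|n].
  - exact: lexx.
  - by move=> xy yz; exact: le_trans yz xy.
  - by case: (h n) => _ [].
have pq m n : p m <= q n.
  have [mn|nm] := leqP m n.
    by apply: le_trans (hp _ _ mn) _; case: (h n) => _ [].
  by apply: le_trans (hq _ _ (ltnW nm)); case: (h m) => _ [].
have hs : has_sup (range p).
  by split; [exists (p 0%N), 0%N|exists (q 0%N) => _ [n _ <-]].
exists (sup (range p)) => n; apply/andP; split.
  by apply: sup_upper_bound => //; exists n.
by apply: sup_le_ub; [exists (p 0%N), 0%N|move=> _ [m _ <-]].
Qed.

Section Bisection.
Variables (F : C -> C) (e : R).

(** Boundary integrals and areas both add up, so one of two halves inherits this lower bound.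
    Halving one direction at a time leaves only two halves to compare. *)
Let bad (Q : (R * R) * (R * R)) := e * ((Q.1.2 - Q.1.1) * (Q.2.2 - Q.2.1)) <=
  normc (rint F Q.1.1 Q.1.2 Q.2.1 Q.2.2).

Let mid (I : R * R) := (I.1 + I.2) / 2.
Let lhalf (I : R * R) := (I.1, mid I).
Let rhalf (I : R * R) := (mid I, I.2).
Let halve_s Q := if bad (lhalf Q.1, Q.2) then (lhalf Q.1, Q.2) else (rhalf Q.1, Q.2).
Let halve_t Q := if bad (Q.1, lhalf Q.2) then (Q.1, lhalf Q.2) else (Q.1, rhalf Q.2).
Let step Q := halve_t (halve_s Q).

Let good Q := [/\ Q.1.1 <= Q.1.2, Q.2.1 <= Q.2.2,
  cts_rect F Q.1.1 Q.1.2 Q.2.1 Q.2.2 & bad Q].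

Let half_spec (I J : R * R) := [/\ I.1 <= J.1, J.2 <= I.2 & J.2 - J.1 = (I.2 - I.1) / 2].

Let lhalfP I : I.1 <= I.2 -> half_spec I (lhalf I).
Proof. by move=> h; rewrite /half_spec /lhalf /mid /=; split; lra. Qed.

Let rhalfP I : I.1 <= I.2 -> half_spec I (rhalf I).
Proof. by move=> h; rewrite /half_spec /rhalf /mid /=; split; lra. Qed.

Let halve_sP Q : good Q -> [/\ good (halve_s Q), half_spec Q.1 (halve_s Q).1 &
  (halve_s Q).2 = Q.2].
Proof.
case: Q => -[s0 s1] [t0 t1] [/= hs ht hF hb].
have lP := lhalfP (I := (s0, s1)) hs; have rP := rhalfP (I := (s0, s1)) hs.
rewrite /halve_s /=; case: ifP => hl.
  split => //; split => //=.
  - by rewrite /mid /=; lra.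
  - move=> s t /andP[h1 h2] h3; apply: hF => //; rewrite h1 (le_trans h2)// /mid /=; lra.
split => //; split => //=.
- by rewrite /mid /=; lra.
- move=> s t /andP[h1 h2] h3; apply: hF => //; rewrite h2 andbT (le_trans _ h1)// /mid /=; lra.
move/negbT: hl hb; rewrite /bad /= -ltNge.
have hm : s0 <= mid (s0, s1) <= s1 by apply/andP; rewrite /mid /=; split; lra.
rewrite (rint_split_s hm ht hF).
have := normcD (rint F s0 (mid (s0, s1)) t0 t1) (rint F (mid (s0, s1)) s1 t0 t1).
by rewrite /mid /=; nra.
Qed.

Let halve_tP Q : good Q -> [/\ good (halve_t Q), half_spec Q.2 (halve_t Q).2 &
  (halve_t Q).1 = Q.1].
Proof.
case: Q => -[s0 s1] [t0 t1] [/= hs ht hF hb].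
have lP := lhalfP (I := (t0, t1)) ht; have rP := rhalfP (I := (t0, t1)) ht.
rewrite /halve_t /=; case: ifP => hl.
  split => //; split => //=.
  - by rewrite /mid /=; lra.
  - move=> s t h3 /andP[h1 h2]; apply: hF => //; rewrite h1 (le_trans h2)// /mid /=; lra.
split => //; split => //=.
- by rewrite /mid /=; lra.
- move=> s t h3 /andP[h1 h2]; apply: hF => //; rewrite h2 andbT (le_trans _ h1)// /mid /=; lra.
move/negbT: hl hb; rewrite /bad /= -ltNge.
have hm : t0 <= mid (t0, t1) <= t1 by apply/andP; rewrite /mid /=; split; lra.
rewrite (rint_split_t hs hm hF).
have := normcD (rint F s0 s1 t0 (mid (t0, t1))) (rint F s0 s1 (mid (t0, t1)) t1).
by rewrite /mid /=; nra.
Qed.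

Lemma bisection s0 s1 t0 t1 : s0 <= s1 -> t0 <= t1 -> cts_rect F s0 s1 t0 t1 ->
  e * ((s1 - s0) * (t1 - t0)) <= normc (rint F s0 s1 t0 t1) ->
  exists s t, [/\ s0 <= s <= s1, t0 <= t <= t1 & forall n : nat, exists p0 p1 q0 q1,
    [/\ p0 <= s <= p1, q0 <= t <= q1, cts_rect F p0 p1 q0 q1,
     p1 - p0 = (s1 - s0) / 2 ^+ n /\ q1 - q0 = (t1 - t0) / 2 ^+ n &
     e * ((p1 - p0) * (q1 - q0)) <= normc (rint F p0 p1 q0 q1)]].
Proof.
move=> hs ht hF hb.
pose Q n := iter n step ((s0, s1), (t0, t1)).
have Q0 : good (Q 0%N) by split.
have QS n : good (Q n) -> [/\ good (Q n.+1), half_spec (Q n).1 (Q n.+1).1 &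
    half_spec (Q n).2 (Q n.+1).2].
  by move=> /halve_sP[/halve_tP[g1 h1 e1] h2 e2]; split => //;
    rewrite /Q iterS -/(Q n) /step ?e1 // -e2.
have Qg n : good (Q n) by elim: n => // n /QS[].
have [s hs'] := @nested_intervals (fun n => (Q n).1.1) (fun n => (Q n).1.2)
  (fun n => let: And3 _ (And3 a b _) _ := QS n (Qg n) in
            let: And4 c _ _ _ := Qg n in conj a (conj b c)).
have [t ht'] := @nested_intervals (fun n => (Q n).2.1) (fun n => (Q n).2.2)
  (fun n => let: And3 _ _ (And3 a b _) := QS n (Qg n) in
            let: And4 _ c _ _ := Qg n in conj a (conj b c)).
exists s, t; split; [exact: (hs' 0%N)|exact: (ht' 0%N)|] => n.
exists (Q n).1.1, (Q n).1.2, (Q n).2.1, (Q n).2.2.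
have [_ _ cQ bQ] := Qg n.
split => //; elim: n {cQ bQ} => [|n [IH1 IH2]]; first by rewrite /= expr0 !divr1.
have [_ [_ _ ->] [_ _ ->]] := QS n (Qg n).
by rewrite IH1 IH2 exprSr invfM !mulrA.
Qed.

End Bisection.

(** A nonzero integral would give, by bisection, small rectangles around a point z whose boundary
    integrals are at least [e] times their area. Subtracting the affine part of [F] at z does not
    change these integrals, while derivability makes the remainder o(diameter) on a contour of
    length O(diameter). *)
Theorem goursat F s0 s1 t0 t1 : s0 <= s1 -> t0 <= t1 ->
  (forall s t, s0 <= s <= s1 -> t0 <= t <= t1 -> derivable F (Complex s t) 1) ->
  rint F s0 s1 t0 t1 = 0.
Proof.
move=> hs ht hF.
have cF : cts_rect F s0 s1 t0 t1.
  by move=> s t h1 h2; apply/differentiable_continuous/derivable1_diffP/hF.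
(* Degenerate rectangles are treated apart because [e] is the integral divided by the area. *)
have [hs'|] := ltP s0 s1; last first.
  move=> s10; have -> : s1 = s0 by apply/eqP; rewrite eq_le s10.
  suff hz f : cint s0 s0 f = 0 by rewrite /rint !hz subr0 add0r subrr.
  by apply: complex_eq; rewrite /= set_itv1 Rintegral_set1.
have [ht'|] := ltP t0 t1; last first.
  move=> t10; have -> : t1 = t0 by apply/eqP; rewrite eq_le t10.
  suff hz f : cint t0 t0 f = 0 by rewrite /rint !hz mulr0 addr0 subr0 subrr.
  by apply: complex_eq; rewrite /= set_itv1 Rintegral_set1.
apply/eqP/negPn/negP => nz.
pose S := s1 - s0; pose T := t1 - t0.
have S0 : 0 < S by rewrite subr_gt0.
have T0 : 0 < T by rewrite subr_gt0.
have ST0 : 0 < S * T by exact: mulr_gt0.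
pose e := normc (rint F s0 s1 t0 t1) / (S * T).
have e0 : 0 < e by rewrite divr_gt0// normc_gt0.
have [|s [t [hss htt hn]]] := @bisection F e _ _ _ _ hs ht cF.
  by rewrite -/S -/T /e divfK// gt_eqF.
have [D hD] := (derivableP_eps _ _).1 (hF _ _ hss htt).
(* With this constant A and X = 2^-n, the length estimate 2 A (S + T)^2 X^2 is exactly half of the
   lower bound e S T X^2. *)
have h0 : 0 < e * (S * T) / (4 * (S + T) ^+ 2).
  apply: divr_gt0; first exact: mulr_gt0.
  by apply: mulr_gt0 => //; apply: exprn_gt0; exact: addr_gt0.
have [d d0 {}hD] := hD _ h0.
have [n hn2] : exists n : nat, (S + T) / 2 ^+ n < d.
  have : (fun n : nat => (S + T) / 2 ^+ n) @ \oo --> 0.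
    under eq_cvg do rewrite -exprVn.
    by apply: cvg_geometric; rewrite ger0_norm ?invr_ge0// invf_lt1// ltr1n.
  move/cvgrPdist_lt => /(_ _ d0) [N _ /(_ N (leqnn N))] /=.
  rewrite sub0r normrN ger0_norm; first by exists N.
  by rewrite divr_ge0 ?exprn_ge0// ltW// addr_gt0.
have [p0 [p1 [q0 [q1 [hp hq cQ [ep eq] hb]]]]] := hn n.
set z : C := Complex s t in hD.
have hp' : p0 <= p1 by case/andP: hp; exact: le_trans.
have hq' : q0 <= q1 by case/andP: hq; exact: le_trans.
have cA : cts_rect (fun w => F z + D * (w - z)) p0 p1 q0 q1.
  by move=> ? ? _ _; exact: cts_affine.
have cE : cts_rect (fun w => F w - (F z + D * (w - z))) p0 p1 q0 q1.
  by move=> x y hx hy; apply: continuousB; [exact: cQ|exact: cA].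
move: hb; rewrite -[rint F _ _ _ _]subr0 -(rint_affine (F z) D z hp' hq').
rewrite -rintB//.
set A := e * (S * T) / (4 * (S + T) ^+ 2) in h0 hD.
have dist x y : p0 <= x <= p1 -> q0 <= y <= q1 ->
    normc ((Complex x y : C) - z) <= (S + T) / 2 ^+ n.
  move=> /andP[x1 x2] /andP[y1 y2]; move/andP: hp => [hp1 hp2]; move/andP: hq => [hq1 hq2].
  apply: le_trans (normc_le _ _) _; rewrite mulrDl; apply: lerD.
    by rewrite -ep ler_norml; apply/andP; split; lra.
  by rewrite -eq ler_norml; apply/andP; split; lra.
have := @rint_normc_le _ p0 p1 q0 q1 (A * ((S + T) / 2 ^+ n)) hp' hq' cE.
have hM x y : p0 <= x <= p1 -> q0 <= y <= q1 ->
    normc (F (Complex x y) - (F z + D * ((Complex x y : C) - z))) <=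
    A * ((S + T) / 2 ^+ n).
  move=> hx hy; rewrite opprD addrA; apply: le_trans (hD _ _) _.
    exact: le_lt_trans (dist _ _ hx hy) hn2.
  by rewrite ler_wpM2l ?dist// ltW.
move=> /(_ hM) h1 h2; have := le_trans h2 h1.
rewrite ep eq -/S -/T.
have X0 : 0 < ((2 ^+ n)^-1 : R) by rewrite invr_gt0 exprn_gt0.
set X := (2 ^+ n)^-1 in X0 *.
have -> : e * (S * X * (T * X)) = (e * (S * T)) * X ^+ 2 by ring.
have -> : 2 * (A * ((S + T) * X)) * (S * X + T * X) =
  (e * (S * T)) * X ^+ 2 * 2^-1.
  by rewrite /A; field; rewrite gt_eqF// addr_gt0.
have : 0 < e * (S * T) * X ^+ 2.
  by apply: mulr_gt0; [exact: mulr_gt0|exact: exprn_gt0].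
lra.
Qed.

End Goursat.

(** * The complex exponential and means over circles *)

Section CircleMeans.
Local Open Scope classical_set_scope.
Local Open Scope ring_scope.
Variable R : realType.
Local Notation C := (Cplx R).
Local Notation normc := (@Normc.normc R).
Local Notation "''i'" := (Complex 0 1 : C).
Implicit Types (z w c : C) (a b r s t : R) (f F G H : C -> C).

Lemma cexpD z w : cexp (z + w) = cexp z * cexp w.
Proof.
case: z w => a b [c d]; rewrite /cexp /= expRD ofRM mulrACA; congr (_ * _).
exact: circD.
Qed.

Lemma cexp0 : cexp 0 = 1 :> C.
Proof. by rewrite /cexp /= expR0 mul1r; exact: circ0. Qed.

Lemma cexpE z : cexp z = ofR (expR (complex.Re z)) * circ (complex.Im z).
Proof. by []. Qed.

Lemma normc_cexp z : normc (cexp z) = expR (complex.Re z).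
Proof. by rewrite cexpE normcM normc_circ mulr1 normc_ofR ger0_norm ?expR_ge0. Qed.

Lemma cexp_neq0 z : cexp z != 0.
Proof. by rewrite -normc_gt0 normc_cexp expR_gt0. Qed.

Lemma is_derive_eps (f : R -> R) (x D : R) : is_derive x 1 f D ->
  forall e : R, 0 < e -> exists2 d : R, 0 < d &
    forall y, `|y - x| < d -> `|f y - f x - D * (y - x)| <= e * `|y - x|.
Proof.
move=> [fx <-] e e0.
have /cvgrPdist_lt /(_ e e0) := fx.
move=> /nbhs_normP[d /= d0 hd]; exists d => // y yx.
have [->|xy] := eqVneq y x; first by rewrite !subrr mulr0 subr0 normr0 mulr0.
have yx0 : y - x != 0 by rewrite subr_eq0.
have := hd (y - x); rewrite /= sub0r normrN => /(_ yx yx0) /ltW.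
rewrite -/('D_1 f x).
have -> : (y - x) *: 1 + x = y by rewrite /GRing.scale /= mulr1 subrK.
have -> : f y - f x - 'D_1 f x * (y - x) =
    - (y - x) * ('D_1 f x - (y - x)^-1 * (f y - f x)) by field.
by rewrite normrM normrN mulrC; apply: ler_wpM2r; exact: normr_ge0.
Qed.

Lemma cexp_eps0 (e : R) : 0 < e -> exists2 d : R, 0 < d &
  forall w, normc w < d -> normc (cexp w - 1 - w) <= e * normc w.
Proof.
(* The errors add up to 8 e' |w|: six from cos and sin multiplied by [expR x] <= 3, one from the
   real exponential, one from the mixed term. *)
move=> e0; pose e' := e / 8; have e'0 : 0 < e' by rewrite divr_gt0.
have [d1 d10 h1] := is_derive_eps (is_derive_expR (0 : R)) e'0.
have [d2 d20 h2] := is_derive_eps (is_derive_cos (0 : R)) e'0.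
have [d3 d30 h3] := is_derive_eps (is_derive_sin (0 : R)) e'0.
have m0 : 0 < Num.min 2 e' by rewrite lt_min e'0 ltr0n.
have := @continuous_expR R 0; move/cvgrPdist_lt => /(_ _ m0)/nbhs_normP[d4 /= d40 h4].
exists (Num.min (Num.min d1 d2) (Num.min d3 d4)).
  by rewrite !lt_min d10 d20 d30 d40.
move=> w; rewrite !lt_min => /andP[/andP[w1 w2] /andP[w3 w4]].
case: w w1 w2 w3 w4 => x y w1 w2 w3 w4.
have nx := ler_Re (Complex x y : C); have ny := ler_Im (Complex x y : C).
rewrite /= in nx ny.
set N := Normc.normc _ in nx ny w1 w2 w3 w4 *.
have {}h1 := h1 x; rewrite subr0 expR0 mul1r in h1; have {}h1 := h1 (le_lt_trans nx w1).
have {}h2 := h2 y; rewrite subr0 cos0 sin0 oppr0 mul0r subr0 in h2; have {}h2 := h2 (le_lt_trans ny w2).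
have {}h3 := h3 y; rewrite !subr0 cos0 sin0 mul1r subr0 in h3; have {}h3 := h3 (le_lt_trans ny w3).
have {}h4 := h4 x; rewrite /= sub0r normrN expR0 lt_min in h4.
have /andP[h5 h6] := h4 (le_lt_trans nx w4).
have -> : cexp (Complex x y) - 1 - Complex x y =
    ofR (expR x - 1 - x) + ofR (expR x) * (Complex (cos y - 1) (sin y - y)) +
    ofR (expR x - 1) * Complex 0 y :> C.
  by apply: complex_eq; rewrite !(ReD, ReN, ReM, ImD, ImN, ImM) /=; ring.
have ex3 : `|expR x| <= 3.
  by rewrite ger0_norm ?expR_ge0//; move: h5; rewrite ltr_norml => /andP[]; lra.
apply: le_trans (normcD _ _) _; apply: le_trans (lerD (normcD _ _) (lexx _)) _.
rewrite !normcM !normc_ofR.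
have n2 := normc_le (cos y - 1) (sin y - y).
have n3 := normc_le 0 y; rewrite normr0 add0r in n3.
have p1 : `|expR x| * normc (Complex (cos y - 1) (sin y - y) : C) <= 3 * (2 * (e' * N)).
  apply: ler_pM => //; first exact: normc_ge0.
  apply: le_trans n2 _.
  have : e' * `|y| <= e' * N by rewrite ler_wpM2l// ltW.
  lra.
have p2 : `|expR x - 1| * normc (Complex 0 y : C) <= e' * N.
  apply: ler_pM => //; [exact: normc_ge0|rewrite distrC ltW//|exact: le_trans n3 _].
have p3 : `|expR x - 1 - x| <= e' * N.
  by apply: le_trans h1 _; rewrite ler_wpM2l// ltW.
have -> : e = 8 * e' by rewrite /e'; lra.
lra.
Qed.

Lemma is_derive_comp F G z (a b : C) : is_derive (F z) 1 G a -> is_derive z 1 F b ->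
  is_derive z 1 (fun w => G (F w)) (a * b).
Proof.
move=> /is_deriveP_eps hG /is_deriveP_eps hF; apply/is_deriveP_eps => e e0.
have na := normc_ge0 a; have nb := normc_ge0 b.
pose e1 := e / (2 * (normc b + 1)); pose e2 := Num.min 1 (e / (2 * (normc a + 1))).
have e10 : 0 < e1 by rewrite divr_gt0// mulr_gt0// ltr_wpDl.
have e20 : 0 < e2 by rewrite lt_min ltr01 divr_gt0// mulr_gt0// ltr_wpDl.
have [d1 d10 h1] := hG _ e10; have [d2 d20 h2] := hF _ e20.
have b10 : 0 < normc b + 1 by rewrite ltr_wpDl.
exists (Num.min d2 (d1 / (normc b + 1))); first by rewrite lt_min d20 divr_gt0.
move=> w; rewrite lt_min ltr_pdivlMr// => /andP[wd2 wd1].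
have {}h2 := h2 _ wd2; set N := normc (w - z) in h2 wd1 *.
have N0 : 0 <= N := normc_ge0 _.
have Fwz : normc (F w - F z) <= N * (normc b + 1).
  rewrite (_ : N * _ = normc b * N + N); last by ring.
  rewrite -[F w - F z](subrK (b * (w - z))) addrC.
  apply: le_trans (normcD _ _) _; rewrite normcM lerD//.
  by apply: le_trans h2 _; rewrite ler_piMl// /e2 ge_min lexx.
have {}h1 := h1 _ (le_lt_trans Fwz wd1).
have -> : G (F w) - G (F z) - a * b * (w - z) = (G (F w) - G (F z) - a * (F w - F z))
   + a * (F w - F z - b * (w - z)) by ring.
apply: le_trans (normcD _ _) _; rewrite normcM [e in leRHS]splitr mulrDl; apply: lerD.
  apply: le_trans h1 _; apply: le_trans (ler_wpM2l (ltW e10) Fwz) _.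
  by rewrite /e1 le_eqVlt; apply/orP; left; apply/eqP; field; rewrite gt_eqF.
apply: le_trans (ler_wpM2l na h2) _; rewrite mulrA ler_wpM2r//.
have a10 : 0 < normc a + 1 by rewrite ltr_wpDl.
apply: (@le_trans _ _ ((normc a + 1) * (e / (2 * (normc a + 1))))).
  apply: ler_pM => //; [exact: ltW|by rewrite lerDl|by rewrite /e2 ge_min lexx orbT].
by rewrite le_eqVlt; apply/orP; left; apply/eqP; field; rewrite gt_eqF.
Qed.

Lemma is_derive_cexp z : is_derive z 1 (@cexp R) (cexp z).
Proof.
apply/is_deriveP_eps => e e0.
have c0 : 0 < normc (cexp z) by rewrite normc_gt0 cexp_neq0.
have [d d0 hd] := cexp_eps0 (divr_gt0 e0 c0).
exists d => // w wz.
have -> : cexp w - cexp z - cexp z * (w - z) = cexp z * (cexp (w - z) - 1 - (w - z)).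
  have -> : cexp w = cexp z * cexp (w - z) by rewrite -cexpD subrKC.
  by ring.
rewrite normcM mulrC -ler_pdivlMr// mulrAC; exact: hd.
Qed.

Lemma derivable_comp F G z : derivable G (F z) 1 -> derivable F z 1 ->
  derivable (fun w => G (F w)) z 1.
Proof. by move=> /derivableP dG /derivableP dF; have [] := is_derive_comp dG dF. Qed.

Lemma derivable_cexp F z : derivable F z 1 -> derivable (fun w => cexp (F w)) z 1.
Proof.
move=> /derivableP dF.
by have [] := is_derive_comp (is_derive_cexp (F z)) dF.
Qed.

Lemma derivable_continuous F z : derivable F z 1 -> {for z, continuous F}.
Proof. by move/derivable1_diffP/differentiable_continuous. Qed.

Lemma polar_cexp r t : 0 < r -> cexp (Complex (ln r) t) = ofR r * circ t :> C.
Proof. by move=> r0; rewrite cexpE /= lnK. Qed.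

Let pi20 : 0 <= 2 * pi :> R.
Proof. by rewrite mulr_ge0// pi_ge0. Qed.

(** This is Goursat's theorem for [G] composed with exp on the rectangle [ln r1, ln r2] x [0, 2 pi]:
    the horizontal sides cancel by periodicity, the vertical ones are the two means. *)
Lemma circle_mean_const G r1 r2 : 0 < r1 -> r1 <= r2 ->
  (forall z, r1 <= normc z <= r2 -> derivable G z 1) ->
  cint 0 (2 * pi) (fun t => G (ofR r1 * circ t)) =
  cint 0 (2 * pi) (fun t => G (ofR r2 * circ t)).
Proof.
move=> r10 r12 hG; have r20 : 0 < r2 by exact: lt_le_trans r12.
have ln12 : ln r1 <= ln r2 by rewrite ler_ln.
have := @goursat R (fun w => G (cexp w)) _ _ 0 (2 * pi) ln12 pi20.
have dG s t : ln r1 <= s <= ln r2 -> 0 <= t <= 2 * pi ->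
    derivable (fun w => G (cexp w)) (Complex s t) 1.
  move=> /andP[s1 s2] _.
  have /hG/derivableP dG : r1 <= normc (cexp (Complex s t)) <= r2.
    rewrite normc_cexp /= -[in r1 <= _](lnK r10) -[in _ <= r2](lnK r20).
    by rewrite !ler_expR s1.
  by have [] := is_derive_comp dG (is_derive_cexp (Complex s t)).
move=> /(_ dG); rewrite /rint.
have -> : cint (ln r1) (ln r2) (fun s => G (cexp (Complex s (2 * pi)))) =
    cint (ln r1) (ln r2) (fun s => G (cexp (Complex s 0))).
  by apply: eq_cint => s _; rewrite !cexpE /= circ2pi circ0.
set X := cint _ _ _; set A := cint _ _ _; set B := cint _ _ _.
have -> : X + 'i * A - X - 'i * B = 'i * (A - B) by ring.
have i0 : 'i != 0 by rewrite eq_complex /= oner_eq0 andbF.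
move/eqP; rewrite mulf_eq0 (negbTE i0) subr_eq0 /= => /eqP row_polys.
transitivity B; last (rewrite -row_polys); apply: eq_cint => t _; by rewrite polar_cexp.
Qed.

(** Compactness of the interval of angles makes joint continuity in radius and angle uniform in the
    angle. *)
Lemma circle_unif H r0 (e : R) : 0 < e -> (forall t, {for (ofR r0 * circ t), continuous H}) ->
  exists2 d : R, 0 < d & forall r, `|r - r0| < d -> forall t, 0 <= t <= 2 * pi ->
    normc (H (ofR r * circ t) - H (ofR r0 * circ t)) <= e.
Proof.
move=> e0 hH.
pose P (r t : R) := normc (H (ofR r * circ t) - H (ofR r0 * circ t)) <= e.
have K : compact (`[0, 2 * pi] : set R) by exact: segment_compact.
have nc := (compact_near_coveringP _).1 K R (nbhs r0) P (nbhs_filter _).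
have h : forall x : R, `[0, 2 * pi]%classic x -> \forall x' \near x & i \near r0, P i x'.
  move=> t _.
  have cc : (ofR x.2 * circ x.1 : C) @[x --> (t, r0)] --> ofR r0 * circ t.
    apply: cvgM; first by apply: cvg_ofR; exact: cvg_snd.
    by apply: (cvg_comp _ _ (@cvg_fst _ _ _ _ _)); exact: circ_continuous.
  have cc0 : (ofR r0 * circ x.1 : C) @[x --> (t, r0)] --> ofR r0 * circ t.
    apply: cvgM; first exact: cvg_cst.
    by apply: (cvg_comp _ _ (@cvg_fst _ _ _ _ _)); exact: circ_continuous.
  have c1 := cvg_comp _ _ cc (hH t); have c2 := cvg_comp _ _ cc0 (hH t).
  have e20 : 0 < e / 2 by rewrite divr_gt0.
  have H1 := (ccvgP _ _ _).1 c1 _ e20; have {}H1 := H1 (nbhs_filter _).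
  have H2 := (ccvgP _ _ _).1 c2 _ e20; have {}H2 := H2 (nbhs_filter _).
  have /= := @filterI _ _ (nbhs_filter ((t, r0) : R * R)) _ _ H1 H2.
  apply: (@filterS _ _ (nbhs_filter ((t, r0) : R * R))) => x /= [h2 h1]; rewrite /P.
  set X := H (ofR r0 * circ t) in h1 h2.
  rewrite -[X in normc X](subrKA X) [e]splitr.
  apply: le_trans (normcD _ _) _; apply: lerD; last exact: ltW.
  by rewrite normcBC ltW.
have /nbhs_normP := nc h; move=> [d /= d0 hd]; exists d => // r rd t ht.
have tI : `[0, 2 * pi]%classic t by rewrite /= in_itv.
have rb : `|r0 - r| < d by rewrite distrC.
exact: (hd r rb t tI).
Qed.

Lemma cts_circle H r : (forall t, {for (ofR r * circ t), continuous H}) ->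
  forall a b, cts_on a b (fun t => H (ofR r * circ t)).
Proof.
move=> hH a b t _; apply: (@continuous_comp _ _ _ (fun t => ofR r * circ t) H) => //.
by apply: continuousM; [exact: cst_continuous|exact: circ_continuous].
Qed.

Lemma circle_bounded H r : (forall t, {for (ofR r * circ t), continuous H}) ->
  exists2 M : R, 0 <= M & forall t, 0 <= t <= 2 * pi -> normc (H (ofR r * circ t)) <= M.
Proof.
move=> hH.
have c : {within `[0, 2 * pi], continuous (fun t => normc (H (ofR r * circ t)))}.
  apply: continuous_in_subspaceT => t _.
  by apply: cvg_normc; apply: (@cts_circle H r hH t t); rewrite lexx.
have [m mI hm] := EVT_max pi20 c.
exists (normc (H (ofR r * circ m))); first exact: normc_ge0.
by move=> t ht; apply: hm; rewrite in_itv.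
Qed.

Lemma mean_value H w : (forall z, normc z < 1 -> {for z, continuous H}) ->
  (forall z, normc z < 1 -> z != 0 -> z != w -> derivable H z 1) ->
  forall r, normc w < r -> r < 1 ->
  cint 0 (2 * pi) (fun t => H (ofR r * circ t)) = ofR (2 * pi) * H 0.
Proof.
move=> cH dH r wr r1; set N := fun r => cint 0 (2 * pi) (fun t => H (ofR r * circ t)).
have w0 := normc_ge0 w.
have nrc s t : 0 <= s -> normc (ofR s * circ t) = s.
  by move=> s0; rewrite normcM normc_circ mulr1 normc_ofR ger0_norm.
have Nc s (e : R) : 0 <= s -> s < 1 -> 0 < e ->
    exists2 d, 0 < d & forall s', 0 <= s' -> s' < 1 -> `|s' - s| < d ->
    normc (N s' - N s) <= e * (2 * pi).
  move=> s0 s1 e0; have cHs s' : 0 <= s' -> s' < 1 -> forall t, {for (ofR s' * circ t), continuous H}.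
    by move=> s'0 s'1 t; apply: cH; rewrite nrc.
  have [d d0 hd] := circle_unif e0 (cHs _ s0 s1); exists d => // s' s'0 s'1 /hd h.
  have i1 := cts_integrable (cts_circle (cHs _ s'0 s'1) (a := 0) (b := 2 * pi)).
  have i2 := cts_integrable (cts_circle (cHs _ s0 s1) (a := 0) (b := 2 * pi)).
  rewrite /N -cintB//; rewrite -[leRHS]/(e * (2 * pi)) -{2}[2 * pi]subr0.
  apply: (cint_normc_cst pi20 _ h).
  by apply: cintegrableD => //; exact: cintegrableN.
have Nk s s' : 0 < s -> s <= s' -> s' < 1 -> (s' < normc w \/ normc w < s) -> N s = N s'.
  move=> s0 ss' s'1 h; apply: circle_mean_const => // z /andP[z1 z2]; apply: dH.
  - exact: le_lt_trans z2 s'1.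
  - by rewrite -normc_gt0 (lt_le_trans s0).
  - apply/eqP => zw; move: h z1 z2; rewrite zw; case; lra.
have N0 : N 0 = ofR (2 * pi) * H 0.
  rewrite mulrC -[2 * pi]subr0 -cint_cst//; apply: eq_cint => t _.
  by rewrite mul0r.
rewrite -N0 -/(N r); apply/eqP; rewrite -subr_eq0 -normc_eq0 eq_le normc_ge0 andbT.
apply/ler_addgt0Pr => e e0; rewrite add0r.
pose e' := e / (3 * (2 * pi)); have pi2 : 0 < 2 * pi :> R by rewrite mulr_gt0// pi_gt0.
have e'0 : 0 < e' by rewrite divr_gt0// mulr_gt0.
have ee : e' * (2 * pi) = e / 3.
  by rewrite /e'; move: pi2; set P := 2 * pi => pi2; field; rewrite gt_eqF.
have w1 : normc w < 1 by exact: lt_trans r1.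
have near_w : normc (N r - N (normc w)) <= e / 3.
  have [d d0 hd] := Nc _ e' w0 w1 e'0.
  pose s := Num.min r (normc w + d / 2).
  have sw : normc w < s by rewrite lt_min wr ltrDl divr_gt0.
  have sr : s <= r by rewrite ge_min lexx.
  have s0 : 0 < s by exact: le_lt_trans sw.
  rewrite -(Nk s r) //; last by right.
  rewrite -ee; apply: hd; [exact: ltW|exact: le_lt_trans r1|].
  rewrite ger0_norm ?subr_ge0 ?ltW// ltrBlDl gt_min; apply/orP; right; lra.
have [d d0 hd] := Nc 0 e' (lexx _) ltr01 e'0.
have [w00|w0'] := eqVneq (normc w) 0.
  rewrite -w00 (le_trans near_w)// ler_pdivrMr//; lra.
have {}w0' : 0 < normc w by rewrite lt_def w0' w0.
have [d' d'0 hd'] := Nc _ e' w0 w1 e'0.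
(* [s] lies just below |w| and [s'] close to 0. The means at these two radii agree, and each of the
   three passages r to |w|, |w| to s, s' to 0 costs at most e / 3. *)
pose s := Num.max (normc w / 2) (normc w - d' / 2).
pose s' := Num.min (normc w / 2) (d / 2).
have sw : s < normc w by rewrite gt_max; apply/andP; split; lra.
have s0 : 0 < s by rewrite lt_max divr_gt0.
have s'0 : 0 < s' by rewrite lt_min !divr_gt0.
have s's : s' <= s by rewrite ge_min le_max lexx.
have NN : N s' = N s by apply: Nk => //; [exact: lt_trans w1|left].
have p1 : normc (N s - N (normc w)) <= e / 3.
  rewrite -ee; apply: hd'; [exact: ltW|exact: lt_trans w1|].
  rewrite distrC ger0_norm ?subr_ge0 ?ltW// ltrBlDr -ltrBlDl lt_max; apply/orP; right; lra.
have p2 : normc (N s' - N 0) <= e / 3.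
  rewrite -ee; apply: hd; [exact: ltW| |].
    by apply: le_lt_trans s's _; exact: lt_trans w1.
  rewrite subr0 gtr0_norm// gt_min; apply/orP; right; lra.
have -> : N r - N 0 = (N r - N (normc w)) - (N s - N (normc w)) + (N s' - N 0).
  by rewrite NN; ring.
apply: le_trans (normcD _ _) _; apply: le_trans (lerD (normcB _ _) (lexx _)) _.
lra.
Qed.

End CircleMeans.

(** * Taylor coefficients and Taylor series of holomorphic functions *)

Section Taylor.
Local Open Scope classical_set_scope.
Local Open Scope ring_scope.
Variable R : realType.
Local Notation C := (Cplx R).
Local Notation normc := (@Normc.normc R).
Implicit Types (z w c : C) (a b r s t : R) (f F G H : C -> C) (n k : nat).

Lemma twopi_gt0 : 0 < 2 * pi :> R.
Proof. by rewrite mulr_gt0// pi_gt0. Qed.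

Lemma ofR_2pi_neq0 : ofR (2 * pi) != 0 :> C.
Proof. by rewrite ofR_eq0 gt_eqF// twopi_gt0. Qed.

Lemma holoP f : holo f <-> forall z, normc z < 1 -> derivable f z 1.
Proof. by split=> h z z1; apply: h; move: z1; rewrite lt_normc1. Qed.

Lemma holo_cts f z : holo f -> normc z < 1 -> {for z, continuous f}.
Proof. by move=> /holoP h z1; exact/derivable_continuous/h. Qed.

Lemma normc_rcirc r t : 0 <= r -> normc (ofR r * circ t) = r.
Proof. by move=> r0; rewrite normcM normc_circ mulr1 normc_ofR ger0_norm. Qed.

Lemma holo_cts_circle f r t : holo f -> 0 <= r < 1 ->
  {for (ofR r * circ t : C), continuous f}.
Proof.
by move=> hf /andP[r0 r1]; apply: holo_cts => //; rewrite normc_rcirc.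
Qed.

Lemma circnat_cts n a b : cts_on a b (fun t => circ (n%:R * t) : C).
Proof.
move=> t _; apply: (@continuous_comp _ _ _ (fun t : R => n%:R * t) (@circ R)).
  by apply: continuousM; [exact: cst_continuous|move=> ?; exact: cvg_id].
exact: circ_continuous.
Qed.

Lemma circnatN_cts n a b : cts_on a b (fun t => circ (- (n%:R * t)) : C).
Proof.
move=> t _; apply: (@continuous_comp _ _ _ (fun t : R => - (n%:R * t)) (@circ R)).
  apply: continuousN.
  by apply: continuousM; [exact: cst_continuous|move=> ?; exact: cvg_id].
exact: circ_continuous.
Qed.

Lemma cts_onM a b (F G : R -> C) : cts_on a b F -> cts_on a b G ->
  cts_on a b (fun t => F t * G t).
Proof. by move=> hF hG t ht; apply: continuousM; [exact: hF|exact: hG]. Qed.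

Lemma cts_cst a b c : cts_on a b (fun=> c).
Proof. by move=> t _; exact: cst_continuous. Qed.

Lemma holo_mul f G : holo f -> holo G -> holo (fun z => f z * G z).
Proof. by move=> hf hG z z1; apply: derivableM; [exact: hf|exact: hG]. Qed.

Lemma holo_cst c : holo (fun=> c).
Proof. by move=> z _; exact: derivable_cst. Qed.

Lemma derivable_exprn z n : derivable (fun z => z ^+ n : C) z 1.
Proof. exact: exprn_derivable. Qed.

Lemma holo_Xn n : holo (fun z : C => z ^+ n).
Proof. by move=> z _; exact: derivable_exprn. Qed.

(* The n-th Taylor coefficient at 0, as a Cauchy integral over the circle |z| = 1/2. *)
Definition tc f n : C := (ofR (2 * pi))^-1 *
  (2 ^+ n * cint 0 (2 * pi) (fun t => f (ofR 2^-1 * circ t) * circ (- (n%:R * t)))).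

Lemma cts_fcirc f r n : holo f -> 0 <= r < 1 ->
  cts_on 0 (2 * pi) (fun t => f (ofR r * circ t) * circ (- (n%:R * t))).
Proof.
move=> hf r01; apply: cts_onM; last exact: circnatN_cts.
by apply: cts_circle => t; exact: holo_cts_circle.
Qed.

(** Both sides are circle means of f(z) z^(-n), which is holomorphic away from 0. *)
Lemma fourier_scale f r1 r2 n : holo f -> 0 < r1 -> r1 <= r2 -> r2 < 1 ->
  (ofR r1)^-1 ^+ n * cint 0 (2 * pi) (fun t => f (ofR r1 * circ t) * circ (- (n%:R * t))) =
  (ofR r2)^-1 ^+ n * cint 0 (2 * pi) (fun t => f (ofR r2 * circ t) * circ (- (n%:R * t))).
Proof.
move=> hf r10 r12 r21; have r20 : 0 < r2 by exact: lt_le_trans r12.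
rewrite -!cintZ; first last.
- by apply: cts_integrable; apply: cts_fcirc => //; rewrite ltW//= (le_lt_trans r12).
- by apply: cts_integrable; apply: cts_fcirc => //; rewrite ltW.
have E r : 0 < r -> (fun t => (ofR r)^-1 ^+ n * (f (ofR r * circ t) * circ (- (n%:R * t)))) =
    (fun t => (fun z => f z * z^-1 ^+ n) (ofR r * circ t)).
  move=> r0; apply/funext => t /=; rewrite circV -circX invfM exprMn -exprVn; ring.
rewrite (E _ r10) (E _ r20).
apply: (@circle_mean_const R (fun z => f z * z^-1 ^+ n)) => // z /andP[z1 z2].
have z0 : z != 0 by rewrite -normc_gt0 (lt_le_trans r10).
have d1 := (holoP f).1 hf z (le_lt_trans z2 r21).
have d2 := @derivableV C C (@id C) z 1 z0 (@derivable_id C C z 1).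
have d3 := derivable_comp (@derivable_exprn z^-1 n) d2.
exact: (derivableM d1 d3).
Qed.

Lemma tc_int f r n : holo f -> 0 < r < 1 ->
  cint 0 (2 * pi) (fun t => f (ofR r * circ t) * circ (- (n%:R * t))) =
  ofR (2 * pi) * (ofR r ^+ n * tc f n).
Proof.
move=> hf /andP[r0 r1]; set I := cint _ _ _.
have r0' : ofR r ^+ n != 0 :> C by rewrite expf_neq0// ofR_eq0 gt_eqF.
suff -> : I = ofR r ^+ n * (2 ^+ n *
    cint 0 (2 * pi) (fun t => f (ofR 2^-1 * circ t) * circ (- (n%:R * t)))).
  rewrite [RHS]mulrCA; congr (_ * _); rewrite /tc mulrA divff ?mul1r//.
  exact: ofR_2pi_neq0.
have -> : 2 = (ofR 2^-1)^-1 :> C by rewrite ofRV invrK; exact/esym/(ofR_nat R 2).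
apply: (mulfI (invr_neq0 r0')); rewrite mulKf// -exprVn /I.
have h0 : 0 < 2^-1 :> R by rewrite invr_gt0.
have h1 : 2^-1 < 1 :> R by rewrite invf_lt1// ltr1n.
have [rh|hr] := leP r 2^-1; first exact: fourier_scale.
by apply/esym; apply: fourier_scale => //; exact: ltW.
Qed.

Lemma tc_int_neg f r n : holo f -> 0 < r < 1 -> (0 < n)%N ->
  cint 0 (2 * pi) (fun t => f (ofR r * circ t) * circ (n%:R * t)) = 0.
Proof.
move=> hf /andP[r0 r1] n0.
have hH := holo_mul hf (@holo_Xn n).
have := @mean_value R (fun z => f z * z ^+ n) 0 _ _ r.
rewrite normc0 expr0n gtn_eqF// !mulr0 => H.
have r0' : ofR r ^+ n != 0 :> C by rewrite expf_neq0// ofR_eq0 gt_eqF.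
apply: (mulfI r0'); rewrite mulr0 -[RHS]H//; first last.
- by move=> z z1 _ _; exact: ((holoP _).1 hH z z1).
- by move=> z z1; exact: holo_cts.
rewrite -cintZ; first by apply: eq_cint => t _; rewrite exprMn circX; ring.
apply: cts_integrable; apply: cts_onM; last exact: circnat_cts.
by apply: cts_circle => t; apply: holo_cts_circle => //; rewrite ltW.
Qed.

Lemma cint_circ n : (0 < n)%N -> cint 0 (2 * pi) (fun t => circ (n%:R * t)) = 0 :> C.
Proof.
move=> n0; rewrite -(tc_int_neg (@holo_cst 1) (r := 2^-1) _ n0).
  by apply: eq_cint => t _; rewrite mul1r.
by rewrite invr_gt0 invf_lt1// ltr1n ltr0n.
Qed.

Lemma cint_circN n : (0 < n)%N -> cint 0 (2 * pi) (fun t => circ (- (n%:R * t))) = 0 :> C.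
Proof.
move=> n0; under [X in cint _ _ X]funext do rewrite circN.
by rewrite cint_conj ?cint_circ ?conjC0//; exact/cts_integrable/circnat_cts.
Qed.

Lemma cint_orth k n : cint 0 (2 * pi) (fun t => circ (k%:R * t) * circ (- (n%:R * t))) =
  ofR (2 * pi) * (k == n)%:R :> C.
Proof.
have [kn|nk|->] := ltngtP k n; rewrite ?mulr1 ?mulr0.
- rewrite -[RHS](@cint_circN (n - k)) ?subn_gt0//; apply: eq_cint => t _.
  by rewrite -circD natrB 1?ltnW//; congr circ; ring.
- rewrite -[RHS](@cint_circ (k - n)) ?subn_gt0//; apply: eq_cint => t _.
  by rewrite -circD natrB 1?ltnW//; congr circ; ring.
transitivity (cint 0 (2 * pi) (fun=> 1 : C)).
  by apply: eq_cint => t _; rewrite -circD subrr circ0.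
by rewrite cint_cst ?subr0 ?mul1r// ltW// twopi_gt0.
Qed.

Lemma cint_poly (p : {poly C}) r n :
  cint 0 (2 * pi) (fun t => p.[ofR r * circ t] * circ (- (n%:R * t))) =
  ofR (2 * pi) * (ofR r ^+ n * p`_n).
Proof.
have E k : cintegrable 0 (2 * pi) (fun t => (circ (k%:R * t) * circ (- (n%:R * t)) : C)).
  by apply: cts_integrable; apply: cts_onM; [exact: circnat_cts|exact: circnatN_cts].
transitivity (\sum_(k < size p) cint 0 (2 * pi) (fun t =>
    (p`_k * ofR r ^+ k) * (circ (k%:R * t) * circ (- (n%:R * t))))).
  rewrite -cint_sum ?ltW ?twopi_gt0//; last by move=> k; apply: cintegrableZ.
  apply: eq_cint => t _; rewrite horner_coef mulr_suml; apply: eq_bigr => k _.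
  by rewrite exprMn circX; ring.
under eq_bigr do rewrite cintZ// cint_orth.
have [ns|sn] := ltnP n (size p).
  rewrite (bigD1 (Ordinal ns))//= eqxx mulr1 big1 ?addr0; first ring.
  by move=> k; rewrite -val_eqE /= => /negbTE ->; rewrite !mulr0.
rewrite nth_default// !mulr0 big1// => k _.
have /negbTE -> : nat_of_ord k != n by rewrite neq_ltn (leq_trans (ltn_ord k) sn).
by rewrite !mulr0.
Qed.

Section Remainder.
Variables (f : C -> C) (w : C) (r : R).
Hypotheses (hf : holo f) (wr : normc w < r) (r1 : r < 1).

Let r0 : 0 < r. Proof. exact: le_lt_trans (normc_ge0 w) wr. Qed.
Let r01 : 0 <= r < 1. Proof. by rewrite ltW. Qed.
Let w1 : normc w < 1. Proof. exact: lt_trans wr r1. Qed.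

(* difference quotient of f at w, multiplied by z: its mean over |z| = r is its
   value 0 at the origin, which is Cauchy's formula for f w *)
Let H z := z * (if z == w then 'D_1 f w else (f z - f w) / (z - w)).
Let ker t : C := ofR r * circ t / (ofR r * circ t - w).

Let zw t : ofR r * circ t - w != 0.
Proof.
rewrite subr_eq0; apply/eqP => e; move: wr; rewrite -e normc_rcirc; [by rewrite ltxx|exact: ltW].
Qed.

Let H_der z : normc z < 1 -> z != w -> derivable H z 1.
Proof.
move=> z1 zw'.
have d1 : derivable (fun z => (f z - f w) / (z - w)) z 1.
  have zw0 : z - w != 0 by rewrite subr_eq0.
  have dB : derivable (fun z : C => z - w) z 1.
    exact: derivableB (@derivable_id C C z 1) (@derivable_cst C C C w z 1).
  have dV := @derivableV C C (fun z => z - w) z 1 zw0 dB.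
  have dF : derivable (fun z => f z - f w) z 1.
    by apply: derivableB (@derivable_cst C C C (f w) z 1); exact: (holoP f).1.
  exact: (derivableM dF dV).
have d2 : derivable (fun z => if z == w then 'D_1 f w else (f z - f w) / (z - w)) z 1.
  apply: (near_eq_derivable _ d1).
  have d0 : 0 < normc (z - w) by rewrite normc_gt0 subr_eq0.
  apply/near_normcP; exists (normc (z - w)) => // v; case: eqP => // ->.
  by rewrite normcBC ltxx.
exact: (derivableM (@derivable_id C C z 1) d2).
Qed.

Let H_cts z : normc z < 1 -> {for z, continuous H}.
Proof.
move=> z1; have [->|] := eqVneq z w; last first.
  by move=> zw'; exact: derivable_continuous (H_der z1 zw').
suff cq : (if z == w then 'D_1 f w else (f z - f w) / (z - w)) @[z --> w] --> 'D_1 f w.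
  apply: continuousM; first by move=> ?; exact: cvg_id.
  by rewrite /prop_for /continuous_at /= eqxx.
apply: (proj2 (@ccvgP R C (nbhs w) (nbhs_filter w) _ _)) => e e0.
have /derivableP/is_deriveP_eps := (holoP f).1 hf w w1.
have e20 : 0 < e / 2 by rewrite divr_gt0.
move=> /(_ _ e20)[d d0 hd]; apply/near_normcP; exists d => // v vd.
case: eqP => [_|/eqP vw]; first by rewrite subrr normc0.
have vw0 : v - w != 0 by rewrite subr_eq0.
have {}hd := hd _ vd.
have -> : 'D_1 f w - (f v - f w) / (v - w) =
  - (v - w)^-1 * (f v - f w - 'D_1 f w * (v - w)) by field.
rewrite normcM normcN normcV mulrC ltr_pdivrMr ?normc_gt0//.
by apply: (le_lt_trans hd); rewrite ltr_pM2r ?normc_gt0// ltr_pdivrMr// ltr_pMr// ltr1n.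
Qed.

Let ker_cts : cts_on 0 (2 * pi) ker.
Proof.
have c t : {for t, continuous (fun t => ofR r * circ t : C)}.
  by apply: continuousM; [exact: cst_continuous|exact: circ_continuous].
move=> t _; apply: continuousM; first exact: c.
have cB := continuousB (c t) (@cst_continuous R C w t).
exact: (@cvgV C R (nbhs t) _ (fun t => ofR r * circ t - w) _ (zw t) cB).
Qed.

Let fc_cts : cts_on 0 (2 * pi) (fun t => f (ofR r * circ t)).
Proof. by apply: cts_circle => t; exact: holo_cts_circle. Qed.

Let cauchy : cint 0 (2 * pi) (fun t => f (ofR r * circ t) * ker t) =
  f w * cint 0 (2 * pi) ker.
Proof.
have dH z : normc z < 1 -> z != 0 -> z != w -> derivable H z 1.
  by move=> z1 _; exact: H_der.
have := mean_value (@H_cts) dH wr r1.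
rewrite {2}/H mul0r mulr0 => h0.
rewrite -cintZ; last exact: cts_integrable.
apply/eqP; rewrite -subr_eq0 -cintB; first last.
- exact: (cts_integrable (cts_onM (@cts_cst 0 (2 * pi) (f w)) ker_cts)).
- exact: (cts_integrable (cts_onM fc_cts ker_cts)).
rewrite -h0; apply/eqP/eq_cint => t _; rewrite /H ifN; last by rewrite -subr_eq0.
by rewrite /ker; ring.
Qed.

Let q : C := w / ofR r.

(** The finite geometric sum for 1 / (1 - w / z) with its exact remainder: integration then only
    meets finite sums, and no sum has to be interchanged with an integral. *)
Let ker_geo K t : ker t = \sum_(j < K) q ^+ j * circ (- (j%:R * t)) +
  (q ^+ K * circ (- (K%:R * t))) * ker t.
Proof.
have rn0 : ofR r != 0 :> C by rewrite ofR_eq0 gt_eqF.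
have E j : q ^+ j * circ (- (j%:R * t)) = (w / (ofR r * circ t)) ^+ j.
  by rewrite circV -circX -exprVn -exprMn /q invfM mulrA.
under eq_bigr do rewrite E.
rewrite E; set v := w / _.
have z0 : ofR r * circ t != 0 by rewrite mulf_neq0// circ_neq0.
have kv : ker t * (1 - v) = 1.
  rewrite /ker /v; have := zw t; move: z0; set z := ofR r * circ t => z0 zw0.
  by field; rewrite z0 zw0.
have v1 : 1 - v != 0 by apply: contra_eq_neq kv => ->; rewrite mulr0 eq_sym oner_neq0.
apply: (mulIf v1); rewrite mulrDl -[v ^+ K * _ * _]mulrA kv mulr1.
set S := \sum_(j < K) _.
have -> : S * (1 - v) = - ((v - 1) * S) by ring.
by rewrite /S -subrX1; ring.
Qed.

Let qj j t : q ^+ j * circ (- (j%:R * t)) = w ^+ j * (ofR r ^+ j)^-1 * circ (- (j%:R * t)).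
Proof. by rewrite /q exprMn exprVn. Qed.

Let cint_ker g K : holo g ->
  cint 0 (2 * pi) (fun t => g (ofR r * circ t) * ker t) =
  ofR (2 * pi) * (\sum_(j < K) tc g j * w ^+ j) +
  cint 0 (2 * pi) (fun t => g (ofR r * circ t) * (q ^+ K * circ (- (K%:R * t)) * ker t)).
Proof.
move=> hg; have gc : cts_on 0 (2 * pi) (fun t => g (ofR r * circ t)).
  by apply: cts_circle => t; exact: holo_cts_circle.
have ci j : cintegrable 0 (2 * pi) (fun t => g (ofR r * circ t) * circ (- (j%:R * t))).
  by apply: cts_integrable; exact: cts_fcirc.
have c2 : cintegrable 0 (2 * pi)
    (fun t => g (ofR r * circ t) * (q ^+ K * circ (- (K%:R * t)) * ker t)).
  exact: (cts_integrable (cts_onM gc (cts_onM (cts_onM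
    (@cts_cst 0 (2 * pi) (q ^+ K)) (@circnatN_cts K 0 (2 * pi))) ker_cts))).
have rj j : ofR r ^+ j != 0 :> C by rewrite expf_neq0// ofR_eq0 gt_eqF.
transitivity (cint 0 (2 * pi) (fun t => (\sum_(j < K)
    (w ^+ j * (ofR r ^+ j)^-1) * (g (ofR r * circ t) * circ (- (j%:R * t)))) +
   g (ofR r * circ t) * (q ^+ K * circ (- (K%:R * t)) * ker t))).
  apply: eq_cint => t _; rewrite {1}(ker_geo K t) mulrDr; congr (_ + _).
  by rewrite mulr_sumr; apply: eq_bigr => j _; rewrite qj; ring.
rewrite cintD//; last first.
  by apply: cintegrable_sum => j; apply: cintegrableZ; exact: ci.
congr (_ + _); rewrite cint_sum ?ltW ?twopi_gt0//; last first.
  by move=> j; apply: cintegrableZ; exact: ci.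
rewrite mulr_sumr; apply: eq_bigr => j _.
rewrite cintZ; last exact: ci.
by rewrite tc_int ?r0//; field.
Qed.

Let ker_bound t : normc (ker t) <= r / (r - normc w).
Proof.
have rw : 0 < r - normc w by rewrite subr_gt0.
rewrite /ker normcM normcV (normc_rcirc t (ltW r0)) ler_pM2l//.
rewrite lef_pV2 ?posrE ?normc_gt0 ?zw//.
rewrite -[X in X - _ <= _](normc_rcirc t (ltW r0)) lerBlDr.
by rewrite -[X in normc X <= _](subrK w) normcD.
Qed.

Let rem_bound g K M : (forall t, 0 <= t <= 2 * pi -> normc (g (ofR r * circ t)) <= M) ->
  cts_on 0 (2 * pi) (fun t => g (ofR r * circ t)) ->
  normc (cint 0 (2 * pi) (fun t =>
    g (ofR r * circ t) * (q ^+ K * circ (- (K%:R * t)) * ker t))) <=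
  M * (normc w / r) ^+ K * (r / (r - normc w)) * (2 * pi).
Proof.
move=> gM gc; rewrite -{2}[2 * pi]subr0; apply: cint_normc_cst.
- exact: ltW twopi_gt0.
- exact: (cts_integrable (cts_onM gc (cts_onM (cts_onM
    (@cts_cst 0 (2 * pi) (q ^+ K)) (@circnatN_cts K 0 (2 * pi))) ker_cts))).
have nq : normc (q ^+ K) = (normc w / r) ^+ K.
  by rewrite normcX /q normcM normcV normc_ofR gtr0_norm.
have Q0 : 0 <= (normc w / r) ^+ K by rewrite exprn_ge0// divr_ge0 ?normc_ge0 ?ltW.
move=> t /gM gt; rewrite normcM normcM normcM normc_circ mulr1 nq -[leRHS]mulrA.
apply: ler_pM => //; first exact: normc_ge0.
  by apply: mulr_ge0 => //; exact: normc_ge0.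
by apply: ler_wpM2l => //; exact: ker_bound.
Qed.

(** Cauchy's formula reads: the integral of f times the kernel is f w times the integral of the
    kernel. Both integrals are expanded by [cint_ker], the second one for the constant function 1,
    whose partial Taylor sum is 1 as soon as K > 0. The remainder of this second expansion accounts
    for the term [normc (f w)] in the bound. *)
Lemma taylor_rem M K : (0 < K)%N ->
  (forall t, 0 <= t <= 2 * pi -> normc (f (ofR r * circ t)) <= M) ->
  normc (f w - \sum_(j < K) tc f j * w ^+ j) <=
  (M + normc (f w)) * (normc w / r) ^+ K * (r / (r - normc w)).
Proof.
move=> K0 fM.
have S1 : \sum_(j < K) tc (fun=> 1) j * w ^+ j = 1.
  have t1 j : tc (fun=> 1 : C) j = (j == 0%N)%:R.
    rewrite /tc; have -> : cint 0 (2 * pi) (fun t => 1 * circ (- (j%:R * t))) =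
      cint 0 (2 * pi) (fun t => circ (0%:R * t) * circ (- (j%:R * t))) :> C.
      by apply: eq_cint => t _; rewrite mul0r circ0.
    rewrite cint_orth mulrCA mulKf ?ofR_2pi_neq0// eq_sym.
    by case: j => [|j]; rewrite ?expr0 ?mul1r// mulr0.
  case: K K0 => // K _; rewrite big_ord_recl t1 eqxx expr0 mulr1 big1 ?addr0//.
  by move=> j _; rewrite t1 mul0r.
have := cauchy; rewrite (cint_ker K hf).
set A := \sum_(_ < _) _; set Rf := cint _ _ _.
have -> : cint 0 (2 * pi) ker = cint 0 (2 * pi) (fun t => 1 * ker t).
  by apply: eq_cint => t _; rewrite mul1r.
have := @cint_ker (fun=> 1) K (@holo_cst 1); rewrite /= => ->.
set R1 := cint _ _ _ => E; rewrite S1 in E.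
have hf1 := rem_bound (g := f) K fM fc_cts.
have hf2 := @rem_bound (fun=> 1) K 1 (fun t _ => eq_ind_r (fun x => x <= 1) (lexx 1) (normc1 R)) (@cts_cst 0 (2 * pi) 1).
rewrite -/R1 in hf2; rewrite -/Rf in hf1; rewrite mulr1 in E.
have -> : f w - A = (ofR (2 * pi))^-1 * (Rf - f w * R1).
  have P0 := ofR_2pi_neq0; move: E P0; set P := ofR (2 * pi) => E P0.
  have -> : Rf = P * A + Rf - P * A by rewrite addrAC subrr add0r.
  rewrite E [X in _ * X](_ : _ = P * (f w - A)); last by ring.
  by rewrite mulKf.
rewrite normcM normcV normc_ofR gtr0_norm ?twopi_gt0// ler_pdivrMl ?twopi_gt0//.
apply: le_trans (normcB _ _) _; rewrite normcM.
have h3 := ler_wpM2l (normc_ge0 (f w)) hf2.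
apply: le_trans (lerD hf1 h3) _; rewrite le_eqVlt; apply/orP; left; apply/eqP.
by set P := 2 * pi; ring.
Qed.

End Remainder.

Lemma taylor_cvg f w : holo f -> normc w < 1 ->
  \sum_(0 <= k < n) tc f k * w ^+ k @[n --> \oo] --> f w.
Proof.
move=> hf w1; have w0 := normc_ge0 w.
have [r wr r1] : exists2 r, normc w < r & r < 1 by exists ((normc w + 1) / 2); lra.
have r0 : 0 < r by exact: le_lt_trans wr.
have [M M0 hM] : exists2 M : R, 0 <= M &
    forall t, 0 <= t <= 2 * pi -> normc (f (ofR r * circ t)) <= M.
  by apply: circle_bounded => t; apply: holo_cts_circle => //; rewrite ltW.
pose B := (M + normc (f w)) * (r / (r - normc w)).
have hB n : (0 < n)%N -> normc (f w - \sum_(0 <= k < n) tc f k * w ^+ k) <=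
    B * (normc w / r) ^+ n.
  move=> n0; rewrite big_mkord; apply: le_trans (taylor_rem hf wr r1 n0 hM) _.
  by rewrite /B mulrAC.
apply/ccvgP => e e0.
have : B * (normc w / r) ^+ n @[n --> \oo] --> (0 : R).
  apply: cvg_geometric; rewrite ger0_norm ?divr_ge0 ?(ltW r0)//.
  by rewrite ltr_pdivrMr// mul1r.
move/cvgrPdist_lt => /(_ _ e0); apply: filterS2 (nbhs_infty_gt 0) => n n0.
rewrite sub0r normrN => h; apply: le_lt_trans (hB _ n0) _.
exact: le_lt_trans (ler_norm _) h.
Qed.

Lemma tc_eq0 f : holo f -> (forall n, tc f n = 0) -> forall z, normc z < 1 -> f z = 0.
Proof.
move=> hf f0 z z1; have := taylor_cvg hf z1.
under eq_fun do under eq_bigr do rewrite f0 mul0r.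
under eq_fun do rewrite big1_eq.
by move=> h; have := cvg_unique _ h (cvg_cst 0); apply.
Qed.

Lemma eq_tc f G : holo f -> holo G -> (forall n, tc f n = tc G n) ->
  forall z, normc z < 1 -> f z = G z.
Proof.
move=> hf hG e z z1; have h1 := taylor_cvg hf z1; have h2 := taylor_cvg hG z1.
move: h1; under eq_fun do under eq_bigr do rewrite e.
by move=> h1; exact: (cvg_unique _ h1 h2).
Qed.

Lemma tc0 f : holo f -> tc f 0 = f 0.
Proof.
move=> hf; have n0 : normc (0 : C) < 1 by rewrite normc0.
have h1 := taylor_cvg hf n0.
suff h2 : \sum_(0 <= k < n) tc f k * 0 ^+ k @[n --> \oo] --> tc f 0.
  exact: (cvg_unique _ h2 h1).
apply: cvg_near_cst; apply: filterS (nbhs_infty_gt 0) => n n0'.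
case: n n0' => // n _; rewrite big_nat_recl// expr0 mulr1 big1 ?addr0// => i _.
by rewrite expr0n mulr0.
Qed.

(** The remainder is estimated on a slightly larger circle, which gives one geometric rate for all
    points of the circle of radius r. *)
Lemma taylor_unif f r : holo f -> 0 < r < 1 -> exists B q : R,
  [/\ 0 <= B, 0 <= q < 1 & forall t K, 0 <= t <= 2 * pi -> (0 < K)%N ->
    normc (f (ofR r * circ t) - \sum_(j < K) tc f j * (ofR r * circ t) ^+ j) <= B * q ^+ K].
Proof.
move=> hf /andP[r0 r1].
have [s rs s1] : exists2 s, r < s & s < 1 by exists ((r + 1) / 2); lra.
have s0 : 0 < s by exact: lt_trans rs.
have [M M0 hM] : exists2 M : R, 0 <= M &
    forall t, 0 <= t <= 2 * pi -> normc (f (ofR s * circ t)) <= M.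
  by apply: circle_bounded => t; apply: holo_cts_circle => //; rewrite ltW.
have [N N0 hN] : exists2 M : R, 0 <= M &
    forall t, 0 <= t <= 2 * pi -> normc (f (ofR r * circ t)) <= M.
  by apply: circle_bounded => t; apply: holo_cts_circle => //; rewrite ltW.
have sr : 0 < s - r by rewrite subr_gt0.
exists ((M + N) * (s / (s - r))), (r / s); split.
- by rewrite mulr_ge0 ?addr_ge0// divr_ge0 ?ltW.
- by rewrite divr_ge0 ?ltW//= ltr_pdivrMr// mul1r.
move=> t K ht K0; have nz := normc_rcirc t (ltW r0).
have wr : normc (ofR r * circ t) < s by rewrite nz.
apply: le_trans (taylor_rem hf wr s1 K0 hM) _; rewrite nz mulrAC.
apply: ler_wpM2r; first by rewrite exprn_ge0// divr_ge0 ?ltW.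
by apply: ler_wpM2r; [rewrite divr_ge0 ?ltW|rewrite lerD// hN].
Qed.

Lemma le_geometric0 (x A q : R) n : 0 <= q < 1 ->
  (forall K, (n < K)%N -> x <= A * q ^+ K) -> x <= 0.
Proof.
move=> /andP[q0 q1] h; apply/ler_addgt0Pr => e e0; rewrite add0r.
have : A * q ^+ K @[K --> \oo] --> (0 : R).
  by apply: cvg_geometric; rewrite ger0_norm.
move/cvgrPdist_lt => /(_ _ e0) H.
have [K _ /(_ K (leqnn K)) [h1 h2]] := filterI (nbhs_infty_gt n) H.
apply: le_trans (h _ h1) _; move: h2; rewrite sub0r normrN => h2.
exact: le_trans (ler_norm _) (ltW h2).
Qed.

Lemma tc_int_shift g r j n : holo g -> 0 < r < 1 ->
  cint 0 (2 * pi) (fun t => (ofR r * circ t) ^+ j * (g (ofR r * circ t) * circ (- (n%:R * t)))) =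
  if (j <= n)%N then ofR (2 * pi) * (ofR r ^+ n * tc g (n - j)) else 0.
Proof.
move=> hg r01; have r01' : 0 <= r < 1 by case/andP: r01 => r0 ->; rewrite ltW.
have gc : cts_on 0 (2 * pi) (fun t => g (ofR r * circ t)).
  by apply: cts_circle => t; exact: holo_cts_circle.
have [jn|nj] := leqP j n.
  transitivity (cint 0 (2 * pi)
    (fun t => ofR r ^+ j * (g (ofR r * circ t) * circ (- ((n - j)%:R * t))))).
    apply: eq_cint => t _; rewrite exprMn circX natrB// mulrBl opprB circD; ring.
  rewrite cintZ; last by apply: cts_integrable; exact: cts_fcirc.
  by rewrite tc_int// mulrCA; congr (_ * _); rewrite mulrA -exprD subnKC.
transitivity (cint 0 (2 * pi)
    (fun t => ofR r ^+ j * (g (ofR r * circ t) * circ ((j - n)%:R * t)))).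
  apply: eq_cint => t _; rewrite exprMn circX natrB ?(ltnW nj)// mulrBl circD; ring.
rewrite cintZ; first by rewrite tc_int_neg ?subn_gt0// mulr0.
exact: (cts_integrable (cts_onM gc (@circnat_cts (j - n) 0 (2 * pi)))).
Qed.

(** Replace f by its Taylor polynomial of length K > n: the n-th coefficient of the product with g
    is then exactly the convolution, by [tc_int_shift], and the error is of order q^K for some q <
    1. *)
Lemma tcM f g n : holo f -> holo g ->
  tc (fun z => f z * g z) n = \sum_(k < n.+1) tc f k * tc g (n - k).
Proof.
move=> hf hg; have hfg := holo_mul hf hg.
have [r r01] : exists r : R, 0 < r < 1.
  by exists 2^-1; rewrite invr_gt0 invf_lt1// ltr1n ltr0n.
have r01' : 0 <= r < 1 by case/andP: r01 => r0 ->; rewrite ltW.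
have [B [q [B0 q01 hB]]] := taylor_unif hf r01.
have gct t : {for (ofR r * circ t : C), continuous g} by exact: holo_cts_circle.
have fct t : {for (ofR r * circ t : C), continuous f} by exact: holo_cts_circle.
have gc := cts_circle gct (a := 0) (b := 2 * pi).
have fc := cts_circle fct (a := 0) (b := 2 * pi).
have [M M0 hM] := circle_bounded gct.
have rn : ofR r ^+ n != 0 :> C.
  by rewrite expf_neq0// ofR_eq0 gt_eqF//; case/andP: r01.
apply: (mulfI rn); apply: (mulfI ofR_2pi_neq0); rewrite -tc_int//.
have gnc := cts_onM gc (@circnatN_cts n 0 (2 * pi)).
have gj j : cintegrable 0 (2 * pi) (fun t => (ofR r * circ t) ^+ j *
    (g (ofR r * circ t) * circ (- (n%:R * t)))).
  apply: cts_integrable; apply: (cts_onM _ gnc).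
  by apply: (@cts_circle R (fun z => z ^+ j)) => t; apply: derivable_continuous; exact: derivable_exprn.
have fgi : cintegrable 0 (2 * pi)
   (fun t => f (ofR r * circ t) * (g (ofR r * circ t) * circ (- (n%:R * t)))).
  exact: cts_integrable (cts_onM fc gnc).
apply/eqP; rewrite -subr_eq0 -normc_eq0 eq_le normc_ge0 andbT.
apply: (@le_geometric0 _ (B * M * (2 * pi)) q n q01) => K nK.
have SK : cint 0 (2 * pi) (fun t => \sum_(j < K) tc f j * ((ofR r * circ t) ^+ j *
    (g (ofR r * circ t) * circ (- (n%:R * t))))) =
    ofR (2 * pi) * (ofR r ^+ n * \sum_(k < n.+1) tc f k * tc g (n - k)).
  rewrite cint_sum ?(ltW twopi_gt0)//; last by move=> j; exact: cintegrableZ.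
  under eq_bigr do rewrite cintZ// tc_int_shift//.
  rewrite -(big_mkord xpredT (fun j => tc f j * (if (j <= n)%N
    then ofR (2 * pi) * (ofR r ^+ n * tc g (n - j)) else 0))).
  rewrite (big_cat_nat _ (n := n.+1))//= [X in _ + X]big_nat_cond [X in _ + X]big1 ?addr0; last first.
    by move=> j; rewrite andbT => /andP[nj _]; rewrite leqNgt nj mulr0.
  rewrite big_mkord !mulr_sumr; apply: eq_bigr => j _.
  by rewrite -ltnS ltn_ord; ring.
rewrite -SK -cintB//; first last.
- by apply: cintegrable_sum => j; exact: cintegrableZ.
- apply: eq_ind fgi _ _; apply/funext => t; ring.
have -> : B * M * (2 * pi) * q ^+ K = B * q ^+ K * M * (2 * pi - 0) by rewrite subr0; ring.
apply: cint_normc_cst; first exact: ltW twopi_gt0.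
  apply: cintegrableD; first by apply: eq_ind fgi _ _; apply/funext => t; ring.
  by apply: cintegrableN; apply: cintegrable_sum => j; exact: cintegrableZ.
move=> t ht; have K0 : (0 < K)%N by exact: leq_ltn_trans nK.
rewrite [X in normc X](_ : _ = (f (ofR r * circ t) -
   \sum_(j < K) tc f j * (ofR r * circ t) ^+ j) * (g (ofR r * circ t) * circ (- (n%:R * t)))); last first.
  rewrite mulrBl; congr (_ - _); first by rewrite mulrA.
  by rewrite mulr_suml; apply: eq_bigr => j _; rewrite mulrA.
rewrite !normcM circN normc_conj normc_circ mulr1; apply: ler_pM; rewrite ?normc_ge0//.
  exact: hB.
exact: hM.
Qed.

End Taylor.

(** * Square-integrable functions on the circle *)

Section SquareIntegrable.
Local Open Scope classical_set_scope.
Local Open Scope ring_scope.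
Variable R : realType.
Local Notation C := (Cplx R).
Local Notation normc := (@Normc.normc R).
Local Notation mu := (@lebesgue_measure R).
Local Notation circle := (@circle R).
Implicit Types (z w c : C) (a b r s t : R) (F G H : R -> C) (n k : nat).

Let mC : measurable (circle : set (measurableTypeR R)).
Proof. exact: measurable_itv. Qed.

Definition cmeas F : Prop :=
  measurable_fun circle (fun t => complex.Re (F t)) /\
  measurable_fun circle (fun t => complex.Im (F t)).

Lemma cmeasD F G : cmeas F -> cmeas G -> cmeas (fun t => F t + G t).
Proof.
move=> [f1 f2] [g1 g2]; split.
  by apply: eq_measurable_fun (measurable_funD f1 g1) => t _ /=; rewrite ReD.
by apply: eq_measurable_fun (measurable_funD f2 g2) => t _ /=; rewrite ImD.
Qed.

Lemma cmeasN F : cmeas F -> cmeas (fun t => - F t).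
Proof.
move=> [f1 f2]; split.
  by apply: eq_measurable_fun (measurable_funN f1) => t _ /=; rewrite ReN.
by apply: eq_measurable_fun (measurable_funN f2) => t _ /=; rewrite ImN.
Qed.

Lemma cmeasB F G : cmeas F -> cmeas G -> cmeas (fun t => F t - G t).
Proof. by move=> f g; apply: cmeasD => //; exact: cmeasN. Qed.

Lemma cmeasM F G : cmeas F -> cmeas G -> cmeas (fun t => F t * G t).
Proof.
move=> [f1 f2] [g1 g2]; split.
  apply: eq_measurable_fun (measurable_funB (measurable_funM f1 g1)
    (measurable_funM f2 g2)) => t _ /=; by rewrite ReM.
apply: eq_measurable_fun (measurable_funD (measurable_funM f1 g2)
  (measurable_funM f2 g1)) => t _ /=; by rewrite ImM.
Qed.

Lemma cmeas_conj F : cmeas F -> cmeas (fun t => (F t)^*).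
Proof.
move=> [f1 f2]; split.
  by apply: eq_measurable_fun f1 => t _ /=; rewrite Re_conj.
by apply: eq_measurable_fun (measurable_funN f2) => t _ /=; rewrite Im_conj.
Qed.

Lemma cts_cmeas F : cts_on 0 (2 * pi) F -> cmeas F.
Proof.
move=> h; have [/integrableP[/measurable_EFinP f1 _] /integrableP[/measurable_EFinP f2 _]] :=
  cts_integrable h.
by split.
Qed.

Lemma cmeas_abs2 F : cmeas F -> measurable_fun circle (fun t => abs2 (F t)).
Proof.
move=> [f1 f2]; exact: (measurable_funD (measurable_funX 2 f1) (measurable_funX 2 f2)).
Qed.

Lemma cmeas_normc F : cmeas F -> measurable_fun circle (fun t => normc (F t)).
Proof.
move=> /cmeas_abs2 h.
have ms := continuous_measurable_fun (@sqrt_continuous R).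
apply: eq_measurable_fun (measurableT_comp ms h) => t _ /=.
by rewrite abs2E sqrtr_sqr ger0_norm// normc_ge0.
Qed.

Definition L2 F : Prop :=
  cmeas F /\ mu.-integrable circle (EFin \o (fun t => abs2 (F t))).

Definition N2 F : R := \int[mu]_(t in circle) abs2 (F t).

Lemma abs2_ge0 z : 0 <= abs2 z.
Proof. by rewrite abs2E exprn_ge0// normc_ge0. Qed.

Lemma in_L2P (f : C -> C) : in_L2 f -> L2 (fun t => f (circ t)).
Proof.
move=> [m fi]; split => //; apply/integrableP; split.
  apply/measurable_EFinP; exact: (@cmeas_abs2 (fun t => f (circ t))).
apply: le_lt_trans fi; rewrite /L2norm2 le_eqVlt; apply/orP; left; apply/eqP.
apply: eq_integral => t _ /=; by rewrite ger0_norm ?abs2_ge0.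
Qed.

Lemma L2norm2E (f : C -> C) : L2 (fun t => f (circ t)) ->
  L2norm2 f = (N2 (fun t => f (circ t)))%:E.
Proof.
move=> [_ fi]; rewrite /N2 /Rintegral fineK//.
exact: integrable_fin_num.
Qed.

Lemma N2_ge0 F : 0 <= N2 F.
Proof. by apply: Rintegral_ge0 => t _; exact: abs2_ge0. Qed.

Lemma abs2D_le z w : abs2 (z + w) <= 2 * abs2 z + 2 * abs2 w.
Proof.
case: z w => a b [c d]; rewrite /abs2 /=.
have := sqr_ge0 (a - c); have := sqr_ge0 (b - d); nra.
Qed.

Lemma integrable_dom (f g : R -> R) : measurable_fun circle f ->
  mu.-integrable circle (EFin \o g) -> (forall t, circle t -> `|f t| <= g t) ->
  mu.-integrable circle (EFin \o f).
Proof.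
move=> mf gi h; apply: (le_integrable mC _ _ gi); first exact/measurable_EFinP.
move=> t ct /=; rewrite lee_fin; apply: le_trans (h t ct) _; exact: ler_norm.
Qed.

Lemma integrable_lin (f g : R -> R) (x y : R) :
  mu.-integrable circle (EFin \o f) -> mu.-integrable circle (EFin \o g) ->
  mu.-integrable circle (EFin \o (fun t => x * f t + y * g t)).
Proof.
move=> fi gi; exact: (integrableD mC (integrableZl mC x fi) (integrableZl mC y gi)).
Qed.

Lemma Rintegral_lin (f g : R -> R) (x y : R) :
  mu.-integrable circle (EFin \o f) -> mu.-integrable circle (EFin \o g) ->
  \int[mu]_(t in circle) (x * f t + y * g t) =
  x * \int[mu]_(t in circle) f t + y * \int[mu]_(t in circle) g t.
Proof.
move=> fi gi; rewrite RintegralD//; first by rewrite !RintegralZl.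
- exact: (integrableZl mC x fi).
- exact: (integrableZl mC y gi).
Qed.

Lemma L2D F G : L2 F -> L2 G -> L2 (fun t => F t + G t).
Proof.
move=> [f1 f2] [g1 g2]; split; first exact: cmeasD.
apply: (integrable_dom (g := fun t => 2 * abs2 (F t) + 2 * abs2 (G t))).
- exact: (cmeas_abs2 (cmeasD f1 g1)).
- exact: (integrable_lin 2 2 f2 g2).
by move=> t _; rewrite ger0_norm ?abs2_ge0// abs2D_le.
Qed.

Lemma abs2N z : abs2 (- z) = abs2 z.
Proof. by rewrite !abs2E normcN. Qed.

Lemma abs2_conj z : abs2 z^* = abs2 z.
Proof. by rewrite !abs2E normc_conj. Qed.

Lemma abs2M z w : abs2 (z * w) = abs2 z * abs2 w.
Proof. by rewrite !abs2E normcM exprMn. Qed.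

Lemma L2N F : L2 F -> L2 (fun t => - F t).
Proof.
move=> [f1 f2]; split; first exact: cmeasN.
by apply: eq_integrable f2 => // t _ /=; rewrite abs2N.
Qed.

Lemma L2B F G : L2 F -> L2 G -> L2 (fun t => F t - G t).
Proof. by move=> f g; apply: L2D => //; exact: L2N. Qed.

Lemma L2_conj F : L2 F -> L2 (fun t => (F t)^*).
Proof.
move=> [f1 f2]; split; first exact: cmeas_conj.
by apply: eq_integrable f2 => // t _ /=; rewrite abs2_conj.
Qed.

Lemma cts_L2 F : cts_on 0 (2 * pi) F -> L2 F.
Proof.
move=> h; split; first exact: cts_cmeas.
apply: continuous_integrable => t ht.
have /cvg_ReIm[h1 h2] := h t ht.
rewrite /abs2; apply: continuousD; rewrite /continuous_at.
- exact: (cvgM h1 h1).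
- exact: (cvgM h2 h2).
Qed.

(* AM-GM: [|F G| <= (s |F|^2 + |G|^2 / s) / 2] *)
Let amgm s z w : 0 < s -> normc (z * w) <= s / 2 * abs2 z + s^-1 / 2 * abs2 w.
Proof.
move=> s0; rewrite !abs2E normcM.
set x := Normc.normc z; set y := Normc.normc w.
have e : s / 2 * x ^+ 2 + s^-1 / 2 * y ^+ 2 - x * y = s^-1 / 2 * (s * x - y) ^+ 2.
  by field; rewrite gt_eqF.
rewrite -subr_ge0 e; apply: mulr_ge0; last exact: sqr_ge0.
by rewrite divr_ge0 ?invr_ge0 ?(ltW s0).
Qed.

Lemma L2M_normc_integrable F G : L2 F -> L2 G ->
  mu.-integrable circle (EFin \o (fun t => normc (F t * G t))).
Proof.
move=> [f1 f2] [g1 g2].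
apply: (integrable_dom (g := fun t => 1 / 2 * abs2 (F t) + 1^-1 / 2 * abs2 (G t))).
- exact: (cmeas_normc (cmeasM f1 g1)).
- exact: (integrable_lin (1 / 2) (1^-1 / 2) f2 g2).
- by move=> t _; rewrite ger0_norm ?normc_ge0// amgm.
Qed.

Lemma L2M_integrable F G : L2 F -> L2 G -> cintegrable 0 (2 * pi) (fun t => F t * G t).
Proof.
move=> hF hG; have i := L2M_normc_integrable hF hG.
case: hF hG => [f1 f2] [g1 g2]; have [m1 m2] := cmeasM f1 g1.
split; [apply: (integrable_dom m1 i)|apply: (integrable_dom m2 i)] => t _.
  exact: ler_Re.
exact: ler_Im.
Qed.

(** The weighted AM-GM inequality integrates to 2 I <= s N2 F + N2 G / s for all s > 0, and s = I /
    N2 F is the choice that gives the claim. If N2 F = 0 and I > 0, the value s = (N2 G + 1) / I is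
    contradictory. *)
Lemma cauchy_schwarz F G : L2 F -> L2 G ->
  (\int[mu]_(t in circle) normc (F t * G t)) ^+ 2 <= N2 F * N2 G.
Proof.
move=> hF hG; have i := L2M_normc_integrable hF hG.
set I := \int[mu]_(t in _) _.
have I0 : 0 <= I by apply: Rintegral_ge0 => t _; exact: normc_ge0.
have key s : 0 < s -> 2 * I <= s * N2 F + s^-1 * N2 G.
  move=> s0; rewrite mulrC -ler_pdivlMr//.
  have -> : (s * N2 F + s^-1 * N2 G) / 2 = s / 2 * N2 F + s^-1 / 2 * N2 G by field; rewrite gt_eqF.
  rewrite -Rintegral_lin; [|by case: hF|by case: hG].
  apply: le_Rintegral => //; first exact: (integrable_lin _ _ hF.2 hG.2).
  by move=> t _; exact: amgm.
have [->|I00] := eqVneq I 0; first by rewrite expr0n mulr_ge0// N2_ge0.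
have {I00}I0 : 0 < I by rewrite lt_def I00.
have A0 := N2_ge0 F; have B0 := N2_ge0 G.
have [A00|A00] := eqVneq (N2 F) 0.
  have s0 : 0 < (N2 G + 1) / I by rewrite divr_gt0// ltr_wpDl.
  have := key _ s0; rewrite A00 mulr0 add0r invf_div mulrAC ler_pdivlMr ?ltr_wpDl//.
  nra.
have {A00}A0 : 0 < N2 F by rewrite lt_def A00.
have := key _ (divr_gt0 I0 A0); rewrite divfK ?gt_eqF// invf_div => h.
have {}h : I <= N2 F / I * N2 G by lra.
by move: h; rewrite mulrAC ler_pdivlMr// -expr2.
Qed.

Lemma cint_normc_L2 F G : L2 F -> L2 G ->
  normc (cint 0 (2 * pi) (fun t => F t * G t)) ^+ 2 <= N2 F * N2 G.
Proof.
move=> hF hG; apply: le_trans (cauchy_schwarz hF hG).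
rewrite ler_pXn2r ?nnegrE ?normc_ge0//; last first.
  by apply: Rintegral_ge0 => t _; exact: normc_ge0.
apply: cint_normc_le => //; first exact: L2M_integrable.
exact: L2M_normc_integrable.
Qed.

Definition L2c (f : nat -> R -> C) (h : R -> C) : Prop :=
  [/\ forall n, L2 (f n), L2 h & N2 (fun t => f n t - h t) @[n --> \oo] --> 0].

Lemma L2_cvgP (f : nat -> C -> C) (h : C -> C) : L2_cvg f h ->
  L2c (fun n t => f n (circ t)) (fun t => h (circ t)).
Proof.
move=> [f1 h1 c]; have f2 n := in_L2P (f1 n); have h2 := in_L2P h1.
split => //; move: c.
have E n : L2norm2 (fun z => f n z - h z) = (N2 (fun t => f n (circ t) - h (circ t)))%:E.
  exact: (@L2norm2E (fun z => f n z - h z) (L2B (f2 n) h2)).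
by under eq_fun do rewrite E; move/fine_cvg.
Qed.

Lemma L2c_cst F : L2 F -> L2c (fun=> F) F.
Proof.
move=> hF; split => //; rewrite (_ : (fun _ => _) = fun=> 0); first exact: cvg_cst.
apply/funext => n; rewrite /N2 (_ : (fun t => _) = fun=> 0).
  by rewrite Rintegral_cst// mul0r.
by apply/funext => t; rewrite subrr abs2E normc0 expr0n.
Qed.

Lemma L2c_conj f h : L2c f h -> L2c (fun n t => (f n t)^*) (fun t => (h t)^*).
Proof.
move=> [f1 h1 c]; split; [by move=> n; exact: L2_conj|exact: L2_conj|].
suff E n : N2 (fun t => (f n t)^* - (h t)^*) = N2 (fun t => f n t - h t).
  by under eq_fun do rewrite E.
by apply: eq_Rintegral => t _; rewrite -rmorphB abs2_conj.
Qed.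

(** Cauchy-Schwarz applies to each term of f g - h k = (f - h) (g - k) + (f - h) k + h (g - k). *)
Lemma L1_cvg f g h (k : R -> C) : L2c f h -> L2c g k ->
  \int[mu]_(t in circle) normc (f n t * g n t - h t * k t) @[n --> \oo] --> 0.
Proof.
move=> [f1 h1 c1] [g1 k1 c2].
pose A n := N2 (fun t => f n t - h t); pose B n := N2 (fun t => g n t - k t).
have sA : Num.sqrt (A n) @[n --> \oo] --> 0.
  by rewrite -(@sqrtr0 R); apply: (cvg_comp _ _ c1); exact: sqrt_continuous.
have sB : Num.sqrt (B n) @[n --> \oo] --> 0.
  by rewrite -(@sqrtr0 R); apply: (cvg_comp _ _ c2); exact: sqrt_continuous.
have U : Num.sqrt (A n) * Num.sqrt (B n) + Num.sqrt (A n) * Num.sqrt (N2 k) +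
    Num.sqrt (N2 h) * Num.sqrt (B n) @[n --> \oo] --> 0.
  rewrite -[X in _ --> X](_ : 0 * 0 + 0 * Num.sqrt (N2 k) + Num.sqrt (N2 h) * 0 = 0).
    apply: cvgD; first apply: cvgD; apply: cvgM => //; exact: cvg_cst.
  by rewrite !mul0r mulr0 !addr0.
apply: (@squeeze_cvgr _ _ _ _ (fun=> 0) (fun n => Num.sqrt (A n) * Num.sqrt (B n) +
   Num.sqrt (A n) * Num.sqrt (N2 k) + Num.sqrt (N2 h) * Num.sqrt (B n))) => //; last exact: cvg_cst.
apply: nearW => n; rewrite Rintegral_ge0 => [|t _]; last exact: normc_ge0.
have fh := L2B (f1 n) h1; have gk := L2B (g1 n) k1.
have CS F G : L2 F -> L2 G ->
    \int[mu]_(t in circle) normc (F t * G t) <= Num.sqrt (N2 F) * Num.sqrt (N2 G).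
  move=> hF hG; rewrite -sqrtrM ?N2_ge0// -[leLHS]ger0_norm.
    by rewrite -sqrtr_sqr ler_sqrt ?cauchy_schwarz// mulr_ge0 ?N2_ge0.
  by apply: Rintegral_ge0 => t _; exact: normc_ge0.
apply: le_trans (lerD (lerD (CS _ _ fh gk) (CS _ _ fh k1)) (CS _ _ h1 gk)).
have i1 := L2M_normc_integrable fh gk; have i2 := L2M_normc_integrable fh k1.
have i3 := L2M_normc_integrable h1 gk.
rewrite -RintegralD//= -RintegralD//=; last exact: (integrableD mC i1 i2).
apply: le_Rintegral => //.
- have [m1 _] := f1 n; have [m2 _] := g1 n; case: h1 k1 => [m3 _] [m4 _].
  apply: (integrable_dom _ (integrableD mC (integrableD mC i1 i2) i3)).
    exact: (cmeas_normc (cmeasB (cmeasM m1 m2) (cmeasM m3 m4))).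
  move=> t _ /=; rewrite ger0_norm ?normc_ge0//.
  rewrite [X in normc X](_ : _ = (f n t - h t) * (g n t - k t) + (f n t - h t) * k t +
     h t * (g n t - k t)); last by ring.
  by apply: le_trans (normcD _ _) _; rewrite lerD// normcD.
- exact: (integrableD mC (integrableD mC i1 i2) i3).
move=> t _ /=.
rewrite [X in normc X](_ : _ = (f n t - h t) * (g n t - k t) + (f n t - h t) * k t +
     h t * (g n t - k t)); last by ring.
by apply: le_trans (normcD _ _) _; rewrite lerD// normcD.
Qed.

End SquareIntegrable.

(** * Boundary values of holomorphic functions and their Fourier coefficients *)

Section HardyFunctions.
Local Open Scope classical_set_scope.
Local Open Scope ring_scope.
Variable R : realType.
Local Notation C := (Cplx R).
Local Notation normc := (@Normc.normc R).
Local Notation mu := (@lebesgue_measure R).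
Local Notation circle := (@circle R).
Implicit Types (z w c : C) (a b r s t : R) (F G H K : R -> C) (n k : nat).

Let mC : measurable (circle : set (measurableTypeR R)).
Proof. exact: measurable_itv. Qed.

Let ae_filter : Filter (almost_everywhere mu).
Proof. exact: ae_filter_ringOfSetsType. Qed.

Definition aec (P : R -> Prop) : Prop := {ae mu, forall t, circle t -> P t}.

Lemma aec_imp (P Q : R -> Prop) : (forall t, P t -> Q t) -> aec P -> aec Q.
Proof. by rewrite /aec => h; apply: (@filterS _ _ ae_filter) => t Pt ct; apply: h; exact: Pt. Qed.

Lemma aec_and (P Q : R -> Prop) : aec P -> aec Q -> aec (fun t => P t /\ Q t).
Proof. by rewrite /aec => p q; apply: (@filterS2 _ _ ae_filter) p q => t p q ct; split; [exact: p|exact: q]. Qed.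

Lemma aec_all (P : R -> Prop) : (forall t, P t) -> aec P.
Proof. by move=> h; apply: aeW => t _; exact: h. Qed.

Lemma cint_cvg f F g G : L2c f F -> L2c g G ->
  cint 0 (2 * pi) (fun t => f n t * g n t) @[n --> \oo] -->
  cint 0 (2 * pi) (fun t => F t * G t).
Proof.
move=> hf hg; have /cvgrPdist_lt h := L1_cvg hf hg.
case: hf hg => [f1 f2 _] [g1 g2 _].
apply/ccvgP => e e0; apply: filterS (h _ e0) => n.
rewrite sub0r normrN; apply: le_lt_trans; apply: le_trans (ler_norm _).
have i1 := L2M_integrable (f1 n) (g1 n); have i2 := L2M_integrable f2 g2.
rewrite normcBC -cintB//; apply: cint_normc_le => //; first exact: cintegrableD i1 (cintegrableN i2).
have [m1 m2] := ((f1 n).1, (g1 n).1); have [m3 m4] := (f2.1, g2.1).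
have j1 := L2M_normc_integrable (f1 n) (g1 n); have j2 := L2M_normc_integrable f2 g2.
apply: (integrable_dom _ (integrableD mC j1 j2)).
  exact: (cmeas_normc (cmeasB (cmeasM m1 m2) (cmeasM m3 m4))).
by move=> t _ /=; rewrite ger0_norm ?normc_ge0// normcB.
Qed.

Lemma aec_normc0 F : cmeas F ->
  mu.-integrable circle (EFin \o (fun t => normc (F t))) ->
  \int[mu]_(t in circle) normc (F t) = 0 -> aec (fun t => F t = 0).
Proof.
move=> mF iF h.
have : (\int[mu]_(t in circle) `|(EFin \o (fun t => normc (F t))) t|)%E = 0%E.
  transitivity (\int[mu]_(t in circle) (EFin \o (fun t => normc (F t))) t)%E.
    by apply: eq_integral => t _ /=; rewrite ger0_norm// normc_ge0.
  have := integrable_fin_num mC iF; move: h; rewrite /Rintegral.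
  by move=> h /fineK <-; rewrite h.
move/(ae_eq_integral_abs _ mC).
have mm : measurable_fun circle (EFin \o (fun t => normc (F t))).
  by apply/measurable_EFinP; exact: cmeas_normc.
move=> /(_ mm); rewrite /aec; apply: (@filterS _ _ ae_filter) => t ht /ht [] /eqP.
by rewrite normc_eq0 => /eqP.
Qed.

Lemma aec_abs20 F : L2 F -> N2 F = 0 -> aec (fun t => F t = 0).
Proof.
move=> hF h; have hc : L2 (fun t => (F t)^*) by exact: L2_conj.
suff : aec (fun t => F t * (F t)^* = 0).
  by apply: aec_imp => t /eqP; rewrite mulf_eq0 conjC_eq0 orbb => /eqP.
apply: aec_normc0; first exact: (cmeasM hF.1 hc.1).
  exact: L2M_normc_integrable.
have := cauchy_schwarz hF hc; rewrite h mul0r => h2.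
by apply/eqP; rewrite -sqrf_eq0 eq_le h2 sqr_ge0.
Qed.

Lemma aec_L2c_cst F G : L2c (fun=> F) G -> aec (fun t => F t = G t).
Proof.
move=> [F1 G1 c]; have z : N2 (fun t => F t - G t) = 0.
  exact: (cvg_unique _ (cvg_cst _) c).
have := aec_abs20 (L2B (F1 0%N) G1) z.
by apply: aec_imp => t /eqP; rewrite subr_eq0 => /eqP.
Qed.

(* products of L^2-convergent sequences converge in L^1, so a quadratic
   identity satisfied by the sequence passes to the limit *)
Lemma aec_quadratic f g p q F G P Q c : L2c f F -> L2c g G -> L2c p P -> L2c q Q ->
  (forall n t, f n t * g n t - p n t * q n t = c) ->
  aec (fun t => F t * G t - P t * Q t = c).
Proof.
move=> hf hg hp hq e.
have c1 := L1_cvg hf hg; have c2 := L1_cvg hp hq.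
case: (hf) (hg) (hp) (hq) => [f1 f2 _] [g1 g2 _] [p1 p2 _] [q1 q2 _].
pose D t := F t * G t - P t * Q t - c.
have mD : cmeas D.
  apply: cmeasB; first exact: (cmeasB (cmeasM f2.1 g2.1) (cmeasM p2.1 q2.1)).
  exact: (cts_cmeas (@cts_cst R 0 (2 * pi) c)).
have i1 n : mu.-integrable circle (EFin \o (fun t => normc (f n t * g n t - F t * G t))).
  apply: (integrable_dom _ (integrableD mC (L2M_normc_integrable (f1 n) (g1 n)) (L2M_normc_integrable f2 g2))).
    exact: (cmeas_normc (cmeasB (cmeasM (f1 n).1 (g1 n).1) (cmeasM f2.1 g2.1))).
  by move=> t _ /=; rewrite ger0_norm ?normc_ge0// normcB.
have i2 n : mu.-integrable circle (EFin \o (fun t => normc (p n t * q n t - P t * Q t))).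
  apply: (integrable_dom _ (integrableD mC (L2M_normc_integrable (p1 n) (q1 n)) (L2M_normc_integrable p2 q2))).
    exact: (cmeas_normc (cmeasB (cmeasM (p1 n).1 (q1 n).1) (cmeasM p2.1 q2.1))).
  by move=> t _ /=; rewrite ger0_norm ?normc_ge0// normcB.
have le n t : normc (D t) <= normc (f n t * g n t - F t * G t) + normc (p n t * q n t - P t * Q t).
  rewrite -normcN [X in normc X](_ : _ = (f n t * g n t - F t * G t) - (p n t * q n t - P t * Q t)).
    exact: normcB.
  by rewrite /D -(e n t); ring.
have iD : mu.-integrable circle (EFin \o (fun t => normc (D t))).
  apply: (integrable_dom _ (integrableD mC (i1 0%N) (i2 0%N))); first exact: cmeas_normc.
  by move=> t _ /=; rewrite ger0_norm ?normc_ge0// le.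
suff : \int[mu]_(t in circle) normc (D t) = 0.
  by move/(aec_normc0 mD iD); apply: aec_imp => t /eqP; rewrite subr_eq0 => /eqP.
apply/eqP; rewrite eq_le; apply/andP; split; last first.
  by apply: Rintegral_ge0 => t _; exact: normc_ge0.
have c12 : \int[mu]_(t in circle) normc (f n t * g n t - F t * G t) +
    \int[mu]_(t in circle) normc (p n t * q n t - P t * Q t) @[n --> \oo] --> (0 : R).
  by rewrite -[X in _ --> X](addr0 0); exact: cvgD c1 c2.
apply: (@cvgr_to_ge nat \oo _ R _ _ _ c12); apply: nearW => n.
rewrite -RintegralD//; apply: le_Rintegral => //.
exact: (integrableD mC (i1 n) (i2 n)).
Qed.

Lemma eq_cint_aec F G : cmeas F -> cmeas G -> aec (fun t => F t = G t) ->
  cint 0 (2 * pi) F = cint 0 (2 * pi) G.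
Proof.
move=> [f1 f2] [g1 g2] h; congr Complex; rewrite /Rintegral; congr fine.
  apply: ae_eq_integral => //; [exact/measurable_EFinP|exact/measurable_EFinP|].
  by apply: (@filterS _ _ ae_filter) h => t h /h ->.
apply: ae_eq_integral => //; [exact/measurable_EFinP|exact/measurable_EFinP|].
by apply: (@filterS _ _ ae_filter) h => t h /h ->.
Qed.

Lemma L2_bounded_mul (p F : R -> C) (B : R) : cmeas p ->
  (forall t, circle t -> normc (p t) <= B) -> L2 F ->
  L2 (fun t => p t * F t) /\ N2 (fun t => p t * F t) <= B ^+ 2 * N2 F.
Proof.
move=> mp hp [mF iF].
have le t : circle t -> abs2 (p t * F t) <= B ^+ 2 * abs2 (F t).
  move=> ct; rewrite abs2M; apply: ler_wpM2r; first exact: abs2_ge0.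
  rewrite abs2E ler_pXn2r ?nnegrE ?normc_ge0 ?hp//.
  by apply: le_trans (hp t ct); exact: normc_ge0.
have i1 := integrableZl mC (B ^+ 2) iF.
have i2 : mu.-integrable circle (EFin \o (fun t => abs2 (p t * F t))).
  apply: (integrable_dom (cmeas_abs2 (cmeasM mp mF)) i1) => t ct.
  by rewrite ger0_norm ?abs2_ge0// le.
split; first by split => //; exact: cmeasM.
by rewrite /N2 -RintegralZl//; apply: le_Rintegral.
Qed.

Lemma N2D_le F G : L2 F -> L2 G -> N2 (fun t => F t + G t) <= 2 * N2 F + 2 * N2 G.
Proof.
move=> hF hG; rewrite /N2 -(Rintegral_lin 2 2 hF.2 hG.2); apply: le_Rintegral => //.
- exact: (L2D hF hG).2.
- exact: (integrable_lin 2 2 hF.2 hG.2).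
by move=> t _; exact: abs2D_le.
Qed.

(** In p f - q F = p (f - F) + (p - q) F the first term is small in L^2 because p is bounded, the
    second because p - q is uniformly small. *)
Lemma L2c_mul (p : nat -> R -> C) (q : R -> C) (B : R) f F :
  (forall n, cmeas (p n)) -> cmeas q -> (forall n, L2 (fun t => p n t * f n t)) ->
  (forall t, circle t -> normc (q t) <= B) ->
  (forall e : R, 0 < e -> \forall n \near \oo, forall t, circle t -> normc (p n t - q t) <= e) ->
  L2c f F -> L2c (fun n t => p n t * f n t) (fun t => q t * F t).
Proof.
move=> mp mq L qB pq [f1 F1 c].
have Lq := (L2_bounded_mul mq qB F1).1.
split => //; pose K := N2 F; have K0 : 0 <= K := N2_ge0 F.
have K1 : 0 < K + 1 by rewrite ltr_wpDl.
have B1 : 0 < (B + 1) ^+ 2 + 1 by rewrite ltr_wpDl// sqr_ge0.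
apply/cvgrPdist_le => e e0.
(* d <= 1 serves twice: it bounds [p n] by B + 1, and it gives d^2 <= d. *)
pose d := Num.min 1 (e / (4 * (K + 1))).
have d0 : 0 < d by rewrite lt_min ltr01 divr_gt0// mulr_gt0.
have e1 : 0 < e / (4 * ((B + 1) ^+ 2 + 1)) by rewrite divr_gt0// mulr_gt0.
move/cvgrPdist_le: c => /(_ _ e1); apply: filterS2 (pq _ d0) => n hd.
rewrite !sub0r !normrN !ger0_norm ?N2_ge0// => ha.
have pB t : circle t -> normc (p n t) <= B + 1.
  move=> ct; rewrite -[p n t](subrK (q t)) addrC; apply: le_trans (normcD _ _) _.
  by rewrite lerD ?qB// (le_trans (hd t ct))// ge_min lexx.
have [l1 n1] := L2_bounded_mul (mp n) pB (L2B (f1 n) F1).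
have [l2 n2] := L2_bounded_mul (cmeasB (mp n) mq) hd F1.
have -> : N2 (fun t => p n t * f n t - q t * F t) =
   N2 (fun t => p n t * (f n t - F t) + (p n t - q t) * F t).
  by apply: eq_Rintegral => t _; congr abs2; ring.
apply: le_trans (N2D_le l1 l2) _; rewrite [leRHS]splitr; apply: lerD.
  apply: le_trans (ler_wpM2l _ n1) _ => //.
  have h : (B + 1) ^+ 2 * N2 (fun t => f n t - F t) <=
      ((B + 1) ^+ 2 + 1) * (e / (4 * ((B + 1) ^+ 2 + 1))).
    by apply: ler_pM; rewrite ?sqr_ge0 ?N2_ge0// lerDl.
  apply: le_trans (ler_wpM2l _ h) _ => //.
  rewrite le_eqVlt; apply/orP; left; apply/eqP; move: B1; set X := _ + 1 => X1.
  by field; rewrite gt_eqF.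
apply: le_trans (ler_wpM2l _ n2) _ => //; rewrite -/K.
have h : d ^+ 2 * K <= e / (4 * (K + 1)) * (K + 1).
  apply: ler_pM; rewrite ?sqr_ge0 ?lerDl//.
  have d1 : d <= 1 by rewrite /d ge_min lexx.
  have d2 : d <= e / (4 * (K + 1)) by rewrite /d ge_min lexx orbT.
  by apply: le_trans d2; rewrite expr2 ler_piMl// ltW.
apply: le_trans (ler_wpM2l _ h) _ => //.
rewrite le_eqVlt; apply/orP; left; apply/eqP; move: K1; set X := _ + 1 => X1.
by field; rewrite gt_eqF.
Qed.

(** Radial limits are taken along one sequence of radii; [n.+2] makes it start at 1/2, so that all
    radii are positive. *)
Definition rn n : R := 1 - n.+2%:R^-1.

Lemma rn01 n : 0 < rn n < 1.
Proof.
have h : 0 < n.+2%:R^-1 :> R by rewrite invr_gt0.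
have h2 : n.+2%:R^-1 < 1 :> R by rewrite invf_lt1// ltr1n.
by rewrite /rn subr_gt0 h2 /= ltrBlDr ltrDl.
Qed.

Lemma rn_cvg : rn n @[n --> \oo] --> (1 : R).
Proof.
rewrite -[X in _ --> X]subr0; apply: cvgB; first exact: cvg_cst.
have := @cvg_harmonic R; rewrite -cvg_shiftS; exact.
Qed.

(* [F] is the L^2 boundary value of the holomorphic function [f]. *)
Definition Hardy (f : C -> C) (F : R -> C) : Prop :=
  holo f /\ L2c (fun n t => f (ofR (rn n) * circ t)) F.

Lemma holo_L2 f r : holo f -> 0 <= r < 1 -> L2 (fun t => f (ofR r * circ t)).
Proof.
by move=> hf r01; apply: cts_L2; apply: cts_circle => t; exact: holo_cts_circle.
Qed.

Lemma L2norm2_cvg (f : nat -> C -> C) (h : C -> C) :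
  (forall n, L2 (fun t => f n (circ t))) -> L2 (fun t => h (circ t)) ->
  L2norm2 (fun z => f n z - h z) @[n --> \oo] --> 0%E ->
  L2c (fun n t => f n (circ t)) (fun t => h (circ t)).
Proof.
move=> f1 h1 c; split => //; move: c.
have E n : L2norm2 (fun z => f n z - h z) = (N2 (fun t => f n (circ t) - h (circ t)))%:E.
  exact: (@L2norm2E R (fun z => f n z - h z) (L2B (f1 n) h1)).
by under eq_fun do rewrite E; move/fine_cvg.
Qed.

Lemma circle_I t : circle t <-> 0 <= t <= 2 * pi.
Proof. by rewrite /Defs.circle /= in_itv. Qed.

Lemma boundary_Hardy (f fb : C -> C) : holo f -> boundary_value f fb ->
  Hardy f (fun t => fb (circ t)).
Proof.
move=> hf [/in_L2P fbL c]; split => //.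
apply: (@L2norm2_cvg (fun n z => f (ofR (rn n) * z)) fb) => //.
  by move=> n; apply: holo_L2 => //; case/andP: (rn01 n) => r0 ->; rewrite ltW.
suff hl : rn n @[n --> \oo] --> (1 : R)^'- by exact: (cvg_comp _ _ hl c).
move=> A [e /= e0 he]; move/cvgrPdist_lt: rn_cvg => /(_ e e0).
by apply: filterS => n hn; apply: he => //=; case/andP: (rn01 n).
Qed.

Lemma star_circ (f : sphere R -> C) r t : 0 < r ->
  star f (ofR r * circ t) = (f (Some (ofR r^-1 * circ t)))^*.
Proof.
move=> r0; rewrite /star /sphere_inv conjC_eq0 mulf_eq0 ofR_eq0 gt_eqF// (negbTE (circ_neq0 t)) /=.
by rewrite rmorphM /= conj_ofR -circN circV invfM invrK ofRV.
Qed.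

(** The reflection z -> 1 / conj z carries the interior radius [rn n] to the exterior radius 1 /
    [rn n], so every exterior boundary value is the conjugate of an interior one. *)
Lemma boundary_ext_Hardy (f : sphere R -> C) (fb : C -> C) : holo (star f) ->
  boundary_value_ext f fb -> Hardy (star f) (fun t => (fb (circ t))^*).
Proof.
move=> hf [/in_L2P fbL c]; split => //.
have rn0 n : 0 < rn n by case/andP: (rn01 n).
have L n : L2 (fun t => f (Some (ofR (rn n)^-1 * circ t))).
  have : L2 (fun t => (star f (ofR (rn n) * circ t))^*).
    by apply: L2_conj; apply: holo_L2 => //; case/andP: (rn01 n) => r0 ->; rewrite ltW.
  by congr L2; apply/funext => t; rewrite star_circ// conjCK.
suff : L2c (fun n t => f (Some (ofR (rn n)^-1 * circ t))) (fun t => fb (circ t)).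
  move/L2c_conj; congr L2c; apply/funext => n; apply/funext => t.
  by rewrite star_circ.
apply: (@L2norm2_cvg (fun n z => f (Some (ofR (rn n)^-1 * z))) fb) => //.
suff hl : (rn n)^-1 @[n --> \oo] --> (1 : R)^'+ by exact: (cvg_comp _ _ hl c).
have rV : (rn n)^-1 @[n --> \oo] --> (1 : R).
  by rewrite -[X in _ --> X]invr1; apply: cvgV; [exact: oner_neq0|exact: rn_cvg].
move=> A [e /= e0 he]; move/cvgrPdist_lt: rV => /(_ e e0).
by apply: filterS => n hn; apply: he => //=; rewrite invf_gt1//; case/andP: (rn01 n).
Qed.

Lemma star_holo (f : sphere R -> C) : holo_ext f -> holo (star f).
Proof.
move=> hf; apply/holoP => z z1.
have z1' : normc z^* < 1 by rewrite normc_conj.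
have [D hD] := (derivableP_eps _ _).1 ((holoP _).1 hf _ z1').
apply/derivableP_eps; exists D^* => e e0.
have [d d0 hd] := hD _ e0; exists d => // w wz.
have := hd w^*; rewrite -rmorphB normc_conj => /(_ wz).
by rewrite -[in X in X -> _]normc_conj !rmorphB rmorphM /= rmorphB /= !conjCK.
Qed.

Lemma Hardy_cst c : Hardy (fun=> c) (fun=> c).
Proof.
split; first exact: holo_cst.
by apply: L2c_cst; apply: cts_L2; exact: cts_cst.
Qed.

Lemma L2c_mul1 (q : R -> C) f F : cmeas q -> (forall t, normc (q t) = 1) ->
  L2c f F -> L2c (fun k t => q t * f k t) (fun t => q t * F t).
Proof.
move=> mq q1 hf; have qB t : circle t -> normc (q t) <= 1 by rewrite q1.
apply: (@L2c_mul (fun=> q) q 1) => //.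
  by move=> n; case: hf => f1 _ _; have [] := L2_bounded_mul mq qB (f1 n).
by move=> e e0; apply: nearW => n t _; rewrite subrr normc0 ltW.
Qed.

Lemma L2c_circ f F n : L2c f F ->
  L2c (fun k t => circ (- (n%:R * t)) * f k t) (fun t => circ (- (n%:R * t)) * F t).
Proof.
apply: L2c_mul1; last by move=> t; exact: normc_circ.
by apply: cts_cmeas; exact: circnatN_cts.
Qed.

Lemma L2c_circp f F n : L2c f F ->
  L2c (fun k t => circ (n%:R * t) * f k t) (fun t => circ (n%:R * t) * F t).
Proof.
apply: L2c_mul1; last by move=> t; exact: normc_circ.
by apply: cts_cmeas; exact: circnat_cts.
Qed.

(** The product F G is only in L^1. On smaller circles the formula holds up to a factor r^n, and the
    products there converge in L^1 as r tends to 1. *)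
Lemma Hardy_mul_coef f g F G n : Hardy f F -> Hardy g G ->
  cint 0 (2 * pi) (fun t => F t * G t * circ (- (n%:R * t))) =
  ofR (2 * pi) * tc (fun z => f z * g z) n.
Proof.
move=> [hf cf] [hg cg]; have hfg := holo_mul hf hg.
have := cint_cvg (L2c_circ n cf) cg.
set u := (X in X @ _ --> _).
have -> : u = fun k => ofR (2 * pi) * (ofR (rn k ^+ n) * tc (fun z => f z * g z) n).
  apply/funext => k; rewrite /u ofRX -tc_int ?rn01//.
  by apply: eq_cint => t _; ring.
have r1 : (ofR (rn k ^+ n) : C) @[k --> \oo] --> (ofR 1 : C).
  apply: cvg_ofR; rewrite -[X in _ --> X](expr1n _ n).
  exact: (cvg_comp _ _ rn_cvg (@exprn_continuous R n 1)).
have c2 : ofR (2 * pi) * (ofR (rn k ^+ n) * tc (fun z => f z * g z) n) @[k --> \oo] -->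
   ofR (2 * pi) * (1 * tc (fun z => f z * g z) n).
  apply: cvgM; first exact: cvg_cst.
  by apply: cvgM; [exact: r1|exact: cvg_cst].
rewrite mul1r in c2; move=> c1; rewrite -(cvg_unique _ c1 c2)//.
by apply: eq_cint => t _; ring.
Qed.

Lemma Hardy_mul_coef_neg f g F G n : Hardy f F -> Hardy g G -> (0 < n)%N ->
  cint 0 (2 * pi) (fun t => F t * G t * circ (n%:R * t)) = 0.
Proof.
move=> [hf cf] [hg cg] n0; have hfg := holo_mul hf hg.
have := cint_cvg (L2c_circp n cf) cg.
set u := (X in X @ _ --> _).
have -> : u = fun=> 0.
  apply/funext => k; rewrite /u -(tc_int_neg hfg (rn01 k) n0).
  by apply: eq_cint => t _; ring.
move=> c1; rewrite -(cvg_unique _ c1 (cvg_cst _))//.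
by apply: eq_cint => t _; ring.
Qed.

Lemma Hardy_coef f F n : Hardy f F ->
  cint 0 (2 * pi) (fun t => F t * circ (- (n%:R * t))) = ofR (2 * pi) * tc f n.
Proof.
move=> hf; have := Hardy_mul_coef n hf (Hardy_cst 1).
have -> : (fun z => f z * 1) = f by apply/funext => z; rewrite mulr1.
by move=> <-; apply: eq_cint => t _; rewrite mulr1.
Qed.

Lemma Hardy_eq f g F G : Hardy f F -> Hardy g G -> aec (fun t => F t = G t) ->
  forall z, normc z < 1 -> f z = g z.
Proof.
move=> hf hg e; apply: (eq_tc hf.1 hg.1) => n; apply: (mulfI (@ofR_2pi_neq0 R)).
rewrite -(Hardy_coef n hf) -(Hardy_coef n hg).
have cc := cts_cmeas (@circnatN_cts R n 0 (2 * pi)).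
apply: eq_cint_aec; last by apply: aec_imp e => t ->.
  by apply: cmeasM cc; case: hf => _ [_ [m _] _].
by apply: cmeasM cc; case: hg => _ [_ [m _] _].
Qed.

(** Continuity of p at the points of the circle makes its radial convergence uniform, so that
    [L2c_mul] applies. The multipliers used later are exponentials of polynomials. *)
Lemma Hardy_cts_mul p f F : holo p ->
  (forall t, {for circ t, continuous p}) -> Hardy f F ->
  Hardy (fun z => p z * f z) (fun t => p (circ t) * F t).
Proof.
move=> hp cp [hf cf]; split; first exact: holo_mul.
have cp1 t : {for ofR 1 * circ t, continuous p} by rewrite mul1r.
have [B B0 hB] := circle_bounded cp1.
have rn01' n : 0 <= rn n < 1 by case/andP: (rn01 n) => h ->; rewrite ltW.
have uni (e : R) : 0 < e -> \forall n \near \oo, forall t, circle t ->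
    normc (p (ofR (rn n) * circ t) - p (circ t)) <= e.
  move=> e0; have [d d0 hd] := circle_unif e0 cp1.
  have := rn_cvg; move/cvgrPdist_lt => /(_ _ d0); apply: filterS => n hn t /circle_I ht.
  by have := hd _ _ t ht; rewrite mul1r; apply; rewrite distrC.
have cc (g : C -> C) r : (forall t, {for (ofR r * circ t : C), continuous g}) ->
    cmeas (fun t => g (ofR r * circ t)).
  by move=> cg; apply: cts_cmeas; exact: cts_circle.
apply: (@L2c_mul _ (fun t => p (circ t)) B) => //.
- by move=> n; apply: cc => t; exact: holo_cts_circle.
- by have := cc _ _ cp1; congr cmeas; apply/funext => t; rewrite mul1r.
- by move=> n; exact: (holo_L2 (holo_mul hp hf) (rn01' n)).
- by move=> t /circle_I ht; have := hB t ht; rewrite mul1r.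
Qed.

End HardyFunctions.

(** * Combinatorics of the admissible index sequences *)

Section IndexSequences.
Local Open Scope classical_set_scope.
Local Open Scope ring_scope.

(* [(i_0, [:: (j_1, i_1); ...; (j_r, i_r)])] encodes the pair of sequences
   (i_0, ..., i_r), (j_1, ..., j_r), and turns admissibility into a path *)
Local Notation code := (nat * seq (nat * nat))%type.

Definition decode (x : code) : seq nat * seq nat := (x.1 :: unzip2 x.2, unzip1 x.2).

Definition link (p q : nat * nat) : bool := (q.1 < q.2)%N && (q.1 <= p.2)%N.

(** The 0 in the initial pair is a dummy, as [link] only reads the second component of its first
    argument. The lower bounds on i_1, ..., i_r follow from j_s < i_s. *)
Definition adm m n (x : code) : bool :=
  [&& path link (0%N, x.1) x.2, (m <= x.1)%N, all (fun p => m <= p.1)%N x.2 &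
   (x.1 + sumn (unzip2 x.2) == n + sumn (unzip1 x.2))%N].

Lemma decode_inj : injective decode.
Proof.
move=> [a s] [b t] [/= -> e2 e1]; congr (_, _).
by rewrite -(zip_unzip s) -(zip_unzip t) e1 e2.
Qed.

Lemma path_link_nth a (s : seq (nat * nat)) b : path link (b, a) s <->
  forall k, (1 <= k <= size s)%N ->
   (nth 0 (unzip1 s) k.-1 < nth 0 (a :: unzip2 s) k)%N /\
   (nth 0 (unzip1 s) k.-1 <= nth 0 (a :: unzip2 s) k.-1)%N.
Proof.
elim: s a b => [|[j i] s IH] a b /=; first by split=> // _ [].
split=> [/andP[/andP[/= h1 h2] /IH h] [|[|k]]//|h].
  by move=> hk; apply: (h k.+1).
apply/andP; split; first by have [h1 h2] := h 1%N isT; rewrite /link /= h1.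
by apply/IH => -[//|k] hk; exact: (h k.+2).
Qed.

Lemma path_link_ge m a b (s : seq (nat * nat)) : path link (b, a) s ->
  all (fun p => m <= p.1)%N s -> all (leq m) (unzip2 s).
Proof.
elim: s a b => //= -[j i] s IH a b /andP[/andP[/= h1 _] h] /andP[h2 h3].
by rewrite (IH _ _ h h3) andbT (leq_trans h2)// ltnW.
Qed.

Lemma admissible_decode m n x : admissible m n (decode x) <-> adm m n x.
Proof.
case: x => a s; rewrite /admissible /decode /adm /=; split.
  move=> [_ /andP[/andP[h1 h2] h3] h4 h5]; rewrite size_map in h4.
  rewrite (path_link_nth a s 0%N).2// h1 -h5 eqxx andbT /=.
  by move: h3; rewrite all_map.
move=> /and4P[h1 h2 h3 /eqP h4]; rewrite !size_map; split => //.
  rewrite h2 /= (path_link_ge h1 h3) /=; by rewrite all_map.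
exact/(path_link_nth a s 0%N).
Qed.

Lemma admissible_code m n ij : admissible m n ij -> exists x, ij = decode x.
Proof.
case: ij => -[|a i] j [] //= [sz] _ _ _; exists (a, zip j i).
by rewrite /decode /= -/unzip1 -/unzip2 unzip1_zip ?sz// unzip2_zip ?sz.
Qed.

(** Each pair contributes i_s - j_s >= 1 to the weight. This bounds both i_0 and the length r by the
    weight, and makes truncated subtractions of weights exact. *)
Lemma path_link_sum a b (s : seq (nat * nat)) : path link (b, a) s ->
  (sumn (unzip1 s) + size s <= sumn (unzip2 s))%N.
Proof.
elim: s a b => //= -[j i] s IH a b /andP[/andP[/= h1 _] /IH]; lia.
Qed.

Definition glue m (x y : code) : code := (x.1, x.2 ++ (m, y.1) :: y.2).

(** All j in the second piece exceed m, so the inserted pair is the last one with j = m and the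
    place of the cut can be read off. *)
Lemma glue_inj m n1 n2 x y x' y' : adm m.+1 n1 y -> adm m.+1 n2 y' ->
  glue m x y = glue m x' y' -> x = x' /\ y = y'.
Proof.
case: x y x' y' => a s [b t] [a' s'] [b' t'] /and4P[_ _ /= ht _] /and4P[_ _ /= ht' _].
rewrite /glue /= => -[<- e].
suff [-> -> ->] : [/\ s = s', b = b' & t = t'] by [].
have nom c u v : all (fun p => m.+1 <= p.1)%N (u ++ (m, c) :: v) = false.
  by rewrite all_cat /= ltnn andbF.
elim: s s' e => [|p s IH] [|p' s'] /=.
- by move=> [-> ->].
- by move=> [_ e]; move: ht; rewrite e nom.
- by move=> [_ e]; move: ht'; rewrite -e nom.
- by move=> [-> /IH[-> -> ->]].
Qed.

Lemma path_link_irr a b c (s : seq (nat * nat)) : path link (b, a) s = path link (c, a) s.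
Proof. by case: s. Qed.

Lemma last_link_ge m a b (s : seq (nat * nat)) : (m <= a)%N -> path link (b, a) s ->
  all (fun p => m <= p.1)%N s -> (m <= (last (b, a) s).2)%N.
Proof.
elim: s a b => //= -[j i] s IH a b ma /andP[/andP[/= h1 _] h] /andP[h2 h3].
by apply: IH h h3; rewrite (leq_trans h2)// ltnW.
Qed.

Lemma adm_glue m n1 n2 x y : adm m n1 x -> adm m.+1 n2 y ->
  forall n, (n + m = n1 + n2)%N -> adm m n (glue m x y).
Proof.
case: x y => a s [b t] /and4P[/= p1 ma al1 /eqP e1] /and4P[/= p2 mb al2 /eqP e2] n en.
apply/and4P; split => //=.
- rewrite cat_path p1 /= (path_link_irr _ _ 0%N) p2 andbT /link /= mb /=.
  exact: last_link_ge p1 al1.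
- rewrite all_cat al1 /= leqnn /=; apply: sub_all al2 => p; exact: ltnW.
- rewrite /unzip1 /unzip2 !map_cat !sumn_cat /=; apply/eqP.
  rewrite -/unzip1 -/unzip2 in e1 e2 *; lia.
Qed.

Lemma has_last (T : Type) (P : pred T) (s : seq T) : has P s ->
  exists s1 p s2, [/\ s = s1 ++ p :: s2, P p & ~~ has P s2].
Proof.
elim: s => //= p s IH; case: (boolP (has P s)) => [hs _|hs].
  by have [s1 [q [s2 [-> h1 h2]]]] := IH hs; exists (p :: s1), q, s2.
by rewrite orbF => Pp; exists [::], p, s.
Qed.

(* cut an admissible sequence at the last [j_s] equal to [m] *)
Lemma adm_cut m k x : adm m (m + k.+1) x ->
  adm m.+1 (m.+1 + k) x \/
  exists i y z, [/\ (i <= k)%N, adm m (m + (k - i)) y, adm m.+1 (m.+1 + i) z & x = glue m y z].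
Proof.
case: x => a s /and4P[/= p1 ma al1 /eqP e1].
case: (boolP (has (fun p => p.1 == m) s)) => [hh|ns].
  have [s1 [[j b] [s2 [es /= /eqP ej ns2]]]] := @has_last (nat * nat)%type _ _ hh.
  right; subst j s; move: p1 al1 e1 {hh}.
  rewrite cat_path all_cat /unzip1 /unzip2 !map_cat !sumn_cat /= -/unzip1 -/unzip2.
  move=> /and3P[p1 /andP[/= mb _] p2] /and3P[al1 _ al2] e1.
  have al2' : all (fun p => m < p.1)%N s2.
    apply/allP => p ps; have := allP al2 p ps; rewrite /= leq_eqVlt => /orP[/eqP ep|//].
    by case/negP: ns2; apply/hasP; exists p => //=; rewrite ep.
  have h1 := path_link_sum p1; have h2 := path_link_sum p2.
  (* The excess over m.+1 of the weight of the tail; it is a genuine difference because b > m and no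
     later pair lowers the weight. *)
  exists (b + sumn (unzip2 s2) - sumn (unzip1 s2) - m.+1)%N, (a, s1), (b, s2).
  move: mb ma e1 h1 h2; rewrite /unzip1 /unzip2 => mb ma e1 h1 h2.
  split => //; first lia.
    by apply/and4P; split => //=; rewrite /unzip1 /unzip2; apply/eqP; lia.
  apply/and4P; split => //=; first by rewrite (path_link_irr _ _ m).
  rewrite /unzip1 /unzip2; apply/eqP; lia.
left.
have al2 : all (fun p => m < p.1)%N s.
  apply/allP => p ps; have := allP al1 p ps; rewrite /= leq_eqVlt => /orP[/eqP ep|//].
  by case/negP: ns; apply/hasP; exists p => //=; rewrite ep.
have am : (m < a)%N.
  (* With i_0 = m, a first pair would have j_1 <= m, contrary to [al2]; without any pair the weight
     would be m. *)
  rewrite ltn_neqAle ma andbT; apply/eqP => em; subst a.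
  case: s p1 al2 e1 {al1 ns} => [|[j i] s] /=; first lia.
  by move=> /andP[/andP[_ /= h1] _] /andP[h2 _]; lia.
by apply/and4P; split => //=; rewrite addSnnS e1.
Qed.

Lemma adm0 m x : adm m m x = (x == (m, [::])).
Proof.
apply/idP/eqP => [|->]; last by rewrite /adm /= leqnn addn0 eqxx.
case: x => a s /and4P[/= p1 ma _ /eqP e1].
have h := path_link_sum p1; have s0 : size s = 0%N by lia.
by rewrite (size0nil s0) in e1 *; rewrite /= !addn0 in e1; rewrite e1.
Qed.

Lemma adm_lt m n x : (n < m)%N -> adm m n x = false.
Proof.
move=> nm; case: x => a s; apply/negP => /and4P[/= p1 ma _ /eqP e1].
have h := path_link_sum p1; lia.
Qed.

Lemma uniq_flatten (I T : eqType) (s : seq I) (F : I -> seq T) : uniq s ->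
  (forall i, i \in s -> uniq (F i)) ->
  (forall i j x, i \in s -> j \in s -> x \in F i -> x \in F j -> i = j) ->
  uniq (flatten (map F s)).
Proof.
elim: s => //= i s IH /andP[is_ us] hF hd; rewrite cat_uniq hF ?mem_head//=.
rewrite IH//; first last.
- by move=> j k x js ks; apply: hd; rewrite in_cons ?js ?ks orbT.
- by move=> j js; apply: hF; rewrite in_cons js orbT.
rewrite andbT; apply/hasPn => x /flatten_mapP[j js xj]; apply/negP => xi.
move: is_; rewrite (hd i j x) ?mem_head ?in_cons ?js ?orbT//.
Qed.

(** A duplicate-free list turns the sum over a classical set into a finite one. Weights are counted
    by their excess k over m, since no weight below m occurs. *)
Definition enumerates m k (S : seq code) : Prop := uniq S /\ forall x, (x \in S) = adm m (m + k) x.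

(** The two cases of [adm_cut] are disjoint, because only glued sequences contain a j equal to m;
    among glued sequences, the weight of the tail determines i. *)
Lemma enumerates_step m k (X Y : nat -> seq code) :
  (forall i, (i <= k)%N -> enumerates m i (X i)) ->
  (forall i, (i <= k)%N -> enumerates m.+1 i (Y i)) ->
  enumerates m k.+1 (Y k ++ flatten [seq [seq glue m x y | x <- X (k - i)%N, y <- Y i] | i <- iota 0 k.+1]).
Proof.
move=> hX hY.
have Yk := hY k (leqnn k).
have mI i : i \in iota 0 k.+1 -> (i <= k)%N by rewrite mem_iota add0n ltnS.
split.
  rewrite cat_uniq Yk.1 andTb; apply/andP; split.
    apply/hasPn => x /flatten_mapP[i /mI ik /allpairsP[[y z] [_ _ ->]]] /=.
    rewrite Yk.2; apply/negP => /and4P[_ _ /=]; by rewrite all_cat /= ltnn andbF.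
  apply: uniq_flatten; first exact: iota_uniq.
    move=> i /mI ik; have X1 := hX (k - i)%N (leq_subr _ _); have Y1 := hY i ik.
    apply: allpairs_uniq X1.1 Y1.1 _ => -[x y] [x' y'] /=.
    move=> /allpairsP[[u v] [_ /= vY [_ ev]]] /allpairsP[[u' v'] [_ /= vY' [_ ev']]].
    rewrite -ev Y1.2 in vY; rewrite -ev' Y1.2 in vY'.
    by move=> /(glue_inj vY vY')[-> ->].
  move=> i j x /mI ik /mI jk /allpairsP[[u v] [_ /= vY ->]] /allpairsP[[u' v'] [_ /= vY' e]].
  rewrite (hY i ik).2 in vY; rewrite (hY j jk).2 in vY'.
  have [_ ev] := glue_inj vY vY' e; rewrite -ev in vY'.
  by move: vY vY' => /and4P[_ _ _ /eqP e1] /and4P[_ _ _ /eqP e2]; lia.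
move=> x; rewrite mem_cat Yk.2; apply/orP/idP => [[h|]|].
- have := h; rewrite /adm addSnnS => /and4P[-> h1 h2 ->]; rewrite (ltnW h1) andbT /=.
  by apply: sub_all h2 => p; exact: ltnW.
- move=> /flatten_mapP[i /mI ik /allpairsP[[u v] [/= uX vY ->]]].
  rewrite (hX _ (leq_subr i k)).2 in uX; rewrite (hY i ik).2 in vY.
  by apply: (adm_glue uX vY); lia.
move=> /adm_cut[->|[i [y [z [ik hy hz ->]]]]]; [by left|right].
apply/flatten_mapP; exists i; first by rewrite mem_iota add0n ltnS.
apply/allpairsP; exists (y, z); rewrite /= (hX _ (leq_subr i k)).2 (hY i ik).2.
by rewrite hy hz.
Qed.

Lemma enumeration : exists S : nat -> nat -> seq code, forall m k, enumerates m k (S m k).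
Proof.
have H k m : exists S, enumerates m k S.
  elim/ltn_ind: k m => -[_ m|k IH m].
    by exists [:: (m, [::])]; split => // x; rewrite addn0 adm0 inE.
  have ch m' : exists X : nat -> seq code, forall i, (i <= k)%N -> enumerates m' i (X i).
    have H i : exists S, (i <= k)%N -> enumerates m' i S.
      case: (leqP i k) => ik; last by exists [::].
      by have [S hS] := IH i ik m'; exists S.
    by have [X hX] := choice H; exists X.
  have [X hX] := ch m; have [Y hY] := ch m.+1.
  by eexists; exact: (enumerates_step hX hY).
have [S hS] := choice (fun mk : nat * nat => H mk.2 mk.1).
by exists (fun m k => S (m, k)) => m k; exact: (hS (m, k)).
Qed.

End IndexSequences.

(** * The coefficients over an arbitrary commutative ring *)

Section GenericCoefficients.
Local Open Scope classical_set_scope.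
Local Open Scope ring_scope.
Variable A : comNzRingType.
Implicit Types (e f : nat -> A) (m n k : nat).

(** [e] and [f] stand for eta and its conjugate, taken as independent families. The same formulas
    then make sense in a polynomial ring, where the remainder polynomial of the leading form is
    built. *)
Definition gterm e f (ij : seq nat * seq nat) : A :=
  let: (i, j) := ij in
  let r := size j in
  (-1) ^+ r * (- f (nth 0%N i 0)) *
  \prod_(1 <= s < r.+1) (e (nth 0%N j s.-1) * (- f (nth 0%N i s))).

Definition gsum e f m n : A := \sum_(ij \in admissible m n) gterm e f ij.

(** The sign (-1)^r cancels against the r signs of the factors -f(i_s), s >= 1; only the sign of i_0
    survives. *)
Definition wt e f (x : nat * seq (nat * nat)) : A :=
  - f x.1 * \prod_(p <- x.2) (e p.1 * f p.2).

Lemma gterm_decode e f x : gterm e f (decode x) = wt e f x.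
Proof.
case: x => a s; rewrite /gterm /decode /wt /= size_map mulrAC mulrC; congr (_ * _).
rewrite big_add1 /= ; elim: s => [|p s IH].
  by rewrite /= big_geq// expr0 mulr1 big_nil.
rewrite [size _]/= big_nat_recl// big_cons -IH /= exprS; ring.
Qed.

Lemma gsumE e f m k S : enumerates m k S -> gsum e f m (m + k) = \sum_(x <- S) wt e f x.
Proof.
move=> [uS mS]; have uD : uniq (map decode S) by rewrite map_inj_uniq//; exact: decode_inj.
transitivity (\sum_(ij <- map decode S) gterm e f ij); last first.
  by rewrite big_map; apply: eq_bigr => x _; exact: gterm_decode.
rewrite fsbig_seq// /gsum; apply: eq_fsbigl; apply/seteqP; split => ij /=.
  move=> adij; have [x ex] := admissible_code adij; subst ij.
  by rewrite mem_map ?mS; [exact/admissible_decode|exact: decode_inj].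
by move=> /mapP[x]; rewrite mS => /admissible_decode h ->.
Qed.

Lemma gsum_lt e f m n : (n < m)%N -> gsum e f m n = 0.
Proof.
move=> nm; rewrite /gsum (_ : admissible m n = set0) ?fsbig_set0//.
apply/seteqP; split => // ij adij; have [x ex] := admissible_code adij; subst ij.
by move: adij => /admissible_decode; rewrite adm_lt.
Qed.

Lemma gsum_diag e f m : gsum e f m m = - f m.
Proof.
have E : enumerates m 0 [:: (m, [::])].
  by split => // x; rewrite addn0 adm0 inE.
have := gsumE e f E; rewrite addn0 => ->.
by rewrite big_seq1 /wt /= big_nil mulr1.
Qed.

Lemma wt_glue e f m x y : wt e f (glue m x y) = - e m * (wt e f x * wt e f y).
Proof. by rewrite /wt /glue /= big_cat big_cons /=; ring. Qed.

(** The coefficient of z^(k+1) in h_m = z h_(m+1) - f_m - e_m z h_m h_(m+1), the coefficient of z^k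
    in h_m being [gsum e f m (m + k)]. *)
Lemma gsumS e f m k : gsum e f m (m + k.+1) = gsum e f m.+1 (m.+1 + k) -
  e m * \sum_(i < k.+1) gsum e f m (m + (k - i)) * gsum e f m.+1 (m.+1 + i).
Proof.
have [S hS] := enumeration.
rewrite (gsumE e f (enumerates_step (fun i _ => hS m i) (fun i _ => hS m.+1 i))).
rewrite big_cat -(gsumE e f (hS m.+1 k)); congr (_ + _).
rewrite big_flatten big_map -[iota 0 k.+1]/(index_iota 0 k.+1) big_mkord -mulNr mulr_sumr.
apply: eq_bigr => i _; rewrite big_allpairs_dep.
rewrite (gsumE e f (hS m (k - i)%N)) (gsumE e f (hS m.+1 i)).
rewrite mulr_suml mulr_sumr; apply: eq_bigr => x _.
by rewrite !mulr_sumr; apply: eq_bigr => y _; rewrite wt_glue.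
Qed.

Lemma eq_gsum e f e' f' m k :
  (forall s, (m <= s <= m + k)%N -> e s = e' s /\ f s = f' s) ->
  gsum e f m (m + k) = gsum e' f' m (m + k).
Proof.
elim/ltn_ind: k m => -[_ m|k IH m] h.
  by rewrite addn0 !gsum_diag; have [_ ->] := h m ltac:(lia).
rewrite !gsumS; have [-> _] := h m ltac:(lia); congr (_ - _ * _).
  by apply: IH => // s hs; apply: h; lia.
apply: eq_bigr => i _; have ik := ltn_ord i; congr (_ * _).
  by apply: IH => [|s hs]; [lia|apply: h; lia].
by apply: IH => [|s hs]; [lia|apply: h; lia].
Qed.

Lemma eq_gsum_le e f e' f' m n : (m <= n)%N ->
  (forall s, (m <= s <= n)%N -> e s = e' s /\ f s = f' s) ->
  gsum e f m n = gsum e' f' m n.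
Proof. by move=> mn; rewrite -(subnKC mn); exact: eq_gsum. Qed.

Definition zero_at (t : nat) (e : nat -> A) (s : nat) : A := if s == t then 0 else e s.

(** In the recursion the top index occurs only in the term that starts at m.+1 and in the last
    summand, where that same term is multiplied by [gsum e f m m] = -f m. Together they produce one
    more factor 1 + e m * f m; everything else is unchanged when the top variables are set to 0. *)
Lemma gsum_top e f m k :
  gsum e f m (m + k) = - f (m + k)%N * \prod_(m <= s < m + k) (1 + e s * f s) +
  gsum (zero_at (m + k) e) (zero_at (m + k) f) m (m + k).
Proof.
elim: k m => [|k IH] m.
  by rewrite !addn0 !gsum_diag big_geq// mulr1 /zero_at eqxx oppr0 addr0.
set e' := zero_at _ e; set f' := zero_at _ f.
have agree s : (s < m + k.+1)%N -> e s = e' s /\ f s = f' s.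
  by move=> st; rewrite /e' /f' /zero_at ltn_eqF.
have [em fm] := agree m ltac:(lia).
rewrite !gsumS -em big_ord_recr [in RHS]big_ord_recr /= subnn addn0 !gsum_diag -fm.
set S := \sum_(i < k) _; set S' := \sum_(i < k) _.
have -> : S = S'.
  apply: eq_bigr => i _; have ik := ltn_ord i; congr (_ * _); apply: eq_gsum => s hs; apply: agree; lia.
rewrite big_ltn ?addnS ?ltnS ?leq_addr// -addSn IH.
have -> : zero_at (m.+1 + k) e = e' by rewrite /e' addSnnS.
have -> : zero_at (m.+1 + k) f = f' by rewrite /f' addSnnS.
ring.
Qed.

End GenericCoefficients.

Lemma rmorph_gsum (A B : comNzRingType) (phi : {rmorphism A -> B}) (e f : nat -> A) m n :
  phi (gsum e f m n) = gsum (phi \o e) (phi \o f) m n.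
Proof.
case: (leqP m n) => [mn|nm]; last by rewrite !gsum_lt// rmorph0.
have [S hS] := enumeration.
rewrite -(subnKC mn) !(gsumE _ _ (hS m (n - m)%N)) rmorph_sum.
apply: eq_bigr => x _; rewrite /wt rmorphM rmorph_prod rmorphN.
by congr (_ * _)%R; apply: eq_bigr => p _; rewrite rmorphM.
Qed.

(** * The polynomial in the lower variables *)

Section LeadingForm.
Import (canonicals) mpoly.
Local Open Scope ring_scope.
Variable R : realType.
Local Notation C := (Cplx R).

Lemma taylor_coefE n0 (eta : nat -> C) n :
  taylor_coef n0 eta n = gsum eta (fun s => (eta s)^*) n0 n.
Proof. by []. Qed.

(** The polynomial is [gsum] itself, evaluated at indeterminates: evaluation is a ring morphism,
    hence commutes with [gsum], and yields the remainder of [gsum_top] for every eta at once. *)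
Lemma leading_formP n0 n : (n0 <= n)%N -> leading_form R n0 n.
Proof.
move=> n0n; pose N := ((n - n0) + (n - n0))%N.
(* For s >= n [insub] fails, and for s < n0 the truncated difference would wrongly pick the first
   variable; both cases get the value 0. At s = n this agrees with [zero_at]. *)
pose X (g : 'I_(n - n0) -> 'I_N) s : mpoly.mpoly N C :=
  if insub (s - n0)%N is Some i then (if (n0 <= s)%N then mpoly.mpolyX C (mpoly.mnm1 (g i)) else 0) else 0.
exists (gsum (X (@lshift _ _)) (X (@rshift _ _)) n0 n) => eta.
rewrite taylor_coefE rmorph_gsum.
have := gsum_top eta (fun s => (eta s)^*) n0 (n - n0); rewrite subnKC// => ->.
congr (_ * _ + _).
  by apply: eq_bigr => s _; congr (_ + _); rewrite mul_conjE.
apply: eq_gsum_le => // s /andP[h1 h2].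
rewrite /zero_at /X /= h1.
case: insubP => [i _ ei|]; last first.
  rewrite -leqNgt => h; have -> : s = n by lia.
  by rewrite eqxx mpoly.meval0.
have si : nat_of_ord i = (s - n0)%N := ei.
have sn : s != n by have := ltn_ord i; rewrite si neq_ltn; lia.
rewrite (negbTE sn) !mpoly.mevalXU /lower_vars.
have sE : (n0 + i)%N = s by rewrite si subnKC.
have -> : fintype.split (lshift (n - n0) i) = inl i by exact: (unsplitK (inl i)).
have -> : fintype.split (rshift (n - n0) i) = inr i by exact: (unsplitK (inr i)).
by rewrite sE.
Qed.

End LeadingForm.

(** * Finite products of root subgroup factors and their first rows *)

Section PartialProducts.
Local Open Scope ring_scope.
Variable R : realType.
Local Notation C := (Cplx R).
Variable eta : nat -> C.
Local Notation etac := (fun s => (eta s)^*).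
Implicit Types (z : C) (d m n k : nat).

(** The product of the factors m + d - 1, ..., m. It unfolds at the lowest index, the opposite end
    from [k1_partial], because the recursion for h_m removes the factor of index m. *)
Fixpoint rprod d m z : 'M[C]_2 :=
  if d is d'.+1 then rprod d' m.+1 z *m k1_factor eta m z else 1%:M.

Lemma rprodS d m z : rprod d.+1 m z = k1_factor eta (m + d) z *m rprod d m z.
Proof.
elim: d m => [|d IH] m; first by rewrite /= mulmx1 mul1mx addn0.
by rewrite [LHS]/= -/(rprod d.+1 m.+1 z) IH addSnnS -mulmxA.
Qed.

Lemma k1_partialE n z : k1_partial eta n z = rprod n.+1 0 z.
Proof.
elim: n => [|n IH]; first by rewrite /= mul1mx.
by rewrite rprodS add0n -IH.
Qed.

(** The first row of [rprod], with z^m divided out of the second entry; this power absorbs the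
    z^(-m) of the factor of index m, which is why the entries are polynomials. *)
Fixpoint row_polys d m : {poly C} * {poly C} :=
  if d is d'.+1 then
    let p := row_polys d' m.+1 in
    (ofR (bold_a (eta m)) *: (p.1 + eta m *: ('X * p.2)),
     ofR (bold_a (eta m)) *: ('X * p.2 - (eta m)^* *: p.1))
  else (1, 0).

Lemma mul_mx2_0 (A : 'M[C]_2) p q r s i : (A *m mx2 p q r s) i 0 = A i 0 * p + A i 1 * r.
Proof.
rewrite mxE big_ord_recl big_ord_recl big_ord0 addr0 !mxE /=.
by congr (_ * _ + A i _ * _); apply: val_inj.
Qed.

Lemma mul_mx2_1 (A : 'M[C]_2) p q r s i : (A *m mx2 p q r s) i 1 = A i 0 * q + A i 1 * s.
Proof.
rewrite mxE big_ord_recl big_ord_recl big_ord0 addr0 !mxE /=.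
by congr (_ * _ + A i _ * _); apply: val_inj.
Qed.

Lemma rprod_row d m z : z != 0 ->
  rprod d m z 0 0 = (row_polys d m).1.[z] /\ rprod d m z 0 1 = z ^+ m * (row_polys d m).2.[z].
Proof.
move=> z0; elim: d m => [|d IH] m.
  by rewrite /= !mxE horner0 mulr0 -[1 in RHS]/(1%:P) hornerC.
have [h1 h2] := IH m.+1; rewrite /= /k1_factor -scalemxAr.
have sE (c : C) (M : 'M[C]_2) i j : (c *: M) i j = c * M i j by rewrite mxE.
rewrite !sE mul_mx2_0 mul_mx2_1 h1 h2.
rewrite !(hornerZ, hornerD, hornerN, hornerM, hornerX) exprS; split; last by ring.
by field; rewrite expf_neq0.
Qed.

(** h_m truncated at order K. The quadratic recursion survives truncation modulo ['X^K], and the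
    polynomials [r] below are the quotients in such congruences. *)
Definition index_series K m : {poly C} := \poly_(k < K) gsum eta etac m (m + k).

Lemma index_series_rec K m : exists r : {poly C},
  index_series K m * (1 + eta m *: ('X * index_series K m.+1)) = 'X * index_series K m.+1 - ((eta m)^*)%:P + 'X^K * r.
Proof.
set L := index_series K m * _; set M := 'X * index_series K m.+1 - _.
exists (drop_poly K (L - M)).
have h : take_poly K (L - M) = 0; last first.
  have := poly_take_drop K (L - M); rewrite h add0r mulrC => ->; by rewrite addrC subrK.
apply/polyP => n; rewrite coef_take_poly coef0; case: ifP => // nK.
apply/eqP; rewrite coefB subr_eq0; apply/eqP; rewrite /L /M mulrDr mulr1 coefD.
rewrite -scalerAr coefZ mulrCA coefXM coefB coefC coefXM.
rewrite [(index_series K m)`_n]coef_poly nK.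
case: n nK => [|n] nK /=; first by rewrite addn0 gsum_diag mulr0 addr0 sub0r.
rewrite subr0 gsumS [(index_series K m.+1)`_n]coef_poly (ltnW nK) coefM.
set S := \sum_(i < n.+1) _; set T := \sum_(j < n.+1) _.
have -> : S = T.
  rewrite /S (reindex_inj rev_ord_inj) /T; apply: eq_bigr => i _ /=.
  have i1 := ltn_ord i.
  rewrite subSS subKn// ![(index_series _ _)`_ _]coef_poly.
  by rewrite (leq_trans i1 (ltnW nK)) (leq_ltn_trans (leq_subr _ _) (ltnW nK)).
by rewrite addrNK.
Qed.

(** The empty product has quotient 0 and agrees with h_m to order 0 only. Each further factor gains
    one order, because the quotient of the higher factors enters multiplied by ['X]. *)
Lemma row_polys_series d m K : (d <= K)%N -> exists r : {poly C},
  (row_polys d m).2 = index_series K m * (row_polys d m).1 + 'X^d * r.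
Proof.
elim: d m => [|d IH] m dK.
  by exists (- index_series K m); rewrite /= expr0 mulr1 mul1r subrr.
have [r hr] := IH m.+1 (ltnW dK); have [s hs] := index_series_rec K m.
rewrite /=; set A := (row_polys d m.+1).1 in hr *; set B := (row_polys d m.+1).2 in hr *.
set a := ofR (bold_a (eta m)).
have -> : 'X * B - (eta m)^* *: A = index_series K m * (A + eta m *: ('X * B)) +
   'X^(d.+1) * (r - index_series K m * (eta m *: r) - 'X^(K - d.+1) * s * A).
  have XK : 'X^K = 'X^(d.+1) * 'X^(K - d.+1) :> {poly C} by rewrite -exprD subnKC.
  rewrite hr XK in hs *.
  have e : (eta m)^* *: A = ((eta m)^*)%:P * A by rewrite mul_polyC.
  rewrite e; move: hs; rewrite -!mul_polyC exprS => hs.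
  set h := index_series K m in hs *; set h' := index_series K m.+1 in hs *.
  set c := ((eta m)^*)%:P in hs *; set x := (eta m)%:P in hs *.
  set Y := 'X^(K - d.+1) in hs *; set Z := 'X^d in hs *.
  have hh : h = 'X * h' - c + 'X * Z * Y * s - h * (x * ('X * h')) by rewrite -hs; ring.
  have -> : 'X * (h' * A + Z * r) - c * A = ('X * h' - c) * A + 'X * Z * r by ring.
  have -> : 'X * h' - c = h * (1 + x * ('X * h')) - 'X * Z * Y * s by rewrite hs; ring.
  ring.
by exists (a *: (r - index_series K m * (eta m *: r) - 'X^(K - d.+1) * s * A));
  rewrite scalerDr -!scalerAr.
Qed.

Lemma row_polys_coef d m n : (n < d)%N ->
  (row_polys d m).2`_n = \sum_(k < n.+1) gsum eta etac m (m + k) * (row_polys d m).1`_(n - k).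
Proof.
move=> nd; have [r ->] := row_polys_series m (leqnn d).
rewrite coefD coefXnM nd addr0 coefM; apply: eq_bigr => k _.
by rewrite coef_poly (leq_ltn_trans _ nd)// -ltnS.
Qed.

End PartialProducts.

(** * Unitarity on the circle, and the second row of k_2 *)

Section Unitary.
Local Open Scope ring_scope.
Variable R : realType.
Local Notation C := (Cplx R).
Implicit Types (A B : 'M[C]_2) (eta zeta : nat -> C).

Lemma det2E A : \det A = A 0 0 * A 1 1 - A 0 1 * A 1 0.
Proof.
rewrite (expand_det_row _ 0) !big_ord_recl big_ord0 addr0 /cofactor !det_mx11 !mxE /=.
rewrite /bump /= expr0 expr1 mul1r mulN1r mulrN.
by congr (A _ _ * A _ _ - A _ _ * A _ _); apply: val_inj.
Qed.

Lemma mulmx2E A B i j : (A *m B) i j = A i 0 * B 0 j + A i 1 * B 1 j.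
Proof.
rewrite mxE !big_ord_recl big_ord0 addr0.
by congr (A i _ * B _ j + A i _ * B _ j); apply: val_inj.
Qed.

(** SU(2) described entrywise: two relations that are real-linear in the entries and one quadratic
    relation, each of which passes to L^2 limits. *)
Definition su2_form A :=
  [/\ A 1 1 = (A 0 0)^*, A 1 0 = - (A 0 1)^* & \det A = 1].

Lemma su2_form_mul A B : su2_form A -> su2_form B -> su2_form (A *m B).
Proof.
move=> [a1 a2 a3] [b1 b2 b3]; split; last by rewrite det_mulmx a3 b3 mulr1.
  rewrite !mulmx2E a1 a2 b1 b2 rmorphD !rmorphM rmorphN/= conjCK; ring.
rewrite !mulmx2E a1 a2 b1 b2 rmorphD !rmorphM/= ?conjCK; ring.
Qed.

Lemma bold_aE (t : C) : ofR (bold_a t) ^+ 2 * (1 + t * t^*) = 1.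
Proof.
rewrite mul_conjE -(ofR1 R) -ofRD -ofRX -ofRM; congr ofR.
have h : 0 < 1 + abs2 t by rewrite ltr_wpDr// abs2_ge0.
by rewrite /bold_a exprVn sqr_sqrtr ?ltW// mulVf// gt_eqF.
Qed.

Lemma scale_mx2 k p q r s : k *: mx2 p q r s = mx2 (k * p) (k * q) (k * r) (k * s) :> 'M[C]_2.
Proof. by apply/matrixP => i j; rewrite !mxE; do 2 case: ifP. Qed.

Lemma circ_conj (t : R) : (circ t)^* = (circ t)^-1.
Proof. by rewrite -circN circV. Qed.

Lemma k1_factor_su2 eta n t : su2_form (k1_factor eta n (circ t)).
Proof.
rewrite /k1_factor scale_mx2; split; last first.
- rewrite det2E !mxE /= !mulr1 -[RHS](bold_aE (eta n)).
  have z0 := circ_neq0 t; field; by rewrite expf_neq0.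
- rewrite !mxE /= !(rmorphM, rmorphN) /= conj_ofR conjCK rmorphXn/= circ_conj exprVn; ring.
- by rewrite !mxE /= rmorphM /= conj_ofR conjC1.
Qed.

Lemma k1_partial_su2 eta n t : su2_form (k1_partial eta n (circ t)).
Proof.
elim: n => [|n IH] /=; first exact: k1_factor_su2.
by apply: su2_form_mul => //; exact: k1_factor_su2.
Qed.

(* Exchanging the two coordinates turns the factors of [k_2] into those of [k_1]. *)
Lemma k2_partialE zeta n z : z != 0 ->
  k2_partial zeta n z 1 1 = (row_polys zeta n 1).1.[z] /\
  k2_partial zeta n z 1 0 = z * (row_polys zeta n 1).2.[z].
Proof.
move=> z0; have [<- h2] := rprod_row zeta n 1 z0; rewrite -[in z * _](expr1 z) -h2 {h2}.
suff h : [/\ k2_partial zeta n z 0 0 = rprod zeta n 1 z 1 1,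
            k2_partial zeta n z 0 1 = rprod zeta n 1 z 1 0,
            k2_partial zeta n z 1 0 = rprod zeta n 1 z 0 1 &
            k2_partial zeta n z 1 1 = rprod zeta n 1 z 0 0] by case: h.
elim: n => [|n [h1 h2 h3 h4]]; first by split; rewrite /= !mxE.
rewrite rprodS [k2_partial _ _ _]/= add1n !mulmx2E h1 h2 h3 h4 /k1_factor /k2_factor !scale_mx2.
by split; rewrite !mxE /= addrC.
Qed.

End Unitary.

(** * Taylor series of quotients *)

Section Quotients.
Local Open Scope classical_set_scope.
Local Open Scope ring_scope.
Variable R : realType.
Local Notation C := (Cplx R).
Local Notation normc := (@Normc.normc R).
Implicit Types (f a b : C -> C) (z w : C) (r : R).

Lemma normc_scale r w : 0 < r <= 1 -> normc w < 1 -> normc (ofR r * w) < 1.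
Proof.
case/andP=> r0 r1 w1; rewrite normcM normc_ofR gtr0_norm//.
by rewrite (le_lt_trans _ w1)// ler_piMl// normc_ge0.
Qed.

Lemma derivable_scale r w : derivable (fun w => ofR r * w : C) w 1.
Proof.
by apply: (@derivableM _ _ (cst (ofR r)) id); [exact: derivable_cst|exact: derivable_id].
Qed.

Lemma holo_scale f r : holo f -> 0 < r <= 1 -> holo (fun w => f (ofR r * w)).
Proof.
move=> /holoP hf r01; apply/holoP => w w1.
apply: (@derivable_comp R (fun w => ofR r * w) f w); last exact: derivable_scale.
exact/hf/normc_scale.
Qed.

Lemma tc_scale f r n : holo f -> 0 < r <= 1 ->
  tc (fun w => f (ofR r * w)) n = ofR r ^+ n * tc f n.
Proof.
move=> hf r01; have /andP[r0 r1] := r01.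
have h2 : 0 < (2^-1 : R) < 1 by apply/andP; split; lra.
have h3 : 0 < r * 2^-1 < 1 by apply/andP; split; nra.
have e1 := tc_int n (holo_scale hf r01) h2; have e2 := tc_int n hf h3.
have nz : ofR (2 * pi) * ofR 2^-1 ^+ n != 0 :> C.
  by rewrite mulf_neq0 ?ofR_2pi_neq0// expf_neq0// ofR_eq0 gt_eqF; case/andP: h2.
apply: (mulfI nz); rewrite -mulrA -e1.
transitivity (cint 0 (2 * pi) (fun t => f (ofR (r * 2^-1) * circ t) * circ (- (n%:R * t)))).
  by apply: eq_cint => t _; rewrite ofRM mulrA.
by rewrite e2 (ofRM r) exprMn; ring.
Qed.

Lemma eq_tc_disc f g n : (forall z, normc z < 1 -> f z = g z) -> tc f n = tc g n.
Proof.
move=> fg; rewrite /tc; congr (_ * (_ * _)); apply: eq_cint => t _; rewrite fg//.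
rewrite normc_rcirc; lra.
Qed.

(** The denominator is known to be free of zeros only near 0, so b / a is rescaled to a function of
    the unit disc, with coefficients r^n psi_n. A convolution with a sequence whose first term a 0
    is nonzero determines the other factor, by induction on n. *)
Lemma taylor_quotP a b n0 (psi : nat -> C) : holo a -> holo b -> a 0 != 0 ->
  (forall n, tc b n = \sum_(k < n.+1) psi k * tc a (n - k)) ->
  (forall k, (k < n0)%N -> psi k = 0) -> taylor_quot b a n0 psi.
Proof.
move=> ha hb a0 hpsi psi0.
have : {for (0 : C), continuous a} by apply: holo_cts => //; rewrite normc0 ltr01.
move=> /(ccvgP (nbhs_filter _)) /(_ (normc (a 0))); rewrite normc_gt0 => /(_ a0).
move=> /near_normcP [d d0 hd].
have [r [r01 rd]] : exists r : R, 0 < r <= 1 /\ r <= d.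
  have [d1|d1] := leP d 1; first by exists d; rewrite d0 d1 lexx.
  by exists 1; rewrite ltr01 lexx (ltW d1).
have /andP[r0 r1] := r01.
have az z : normc z < r -> a z != 0.
  move=> zr; apply/eqP => az; have := hd z; rewrite subr0 az subr0 ltxx.
  by move=> /(_ (lt_le_trans zr rd)).
exists r => // z; rewrite lt_normc_ofR => zr; split; first exact: az.
pose ar w := a (ofR r * w); pose br w := b (ofR r * w).
have arw w : normc w < 1 -> ar w != 0.
  by move=> w1; apply: az; rewrite normcM normc_ofR gtr0_norm// -ltr_pdivlMl// mulVf ?gt_eqF.
have hab : holo (fun w => br w * (ar w)^-1).
  apply: @holo_mul; first exact: holo_scale.
  apply/holoP => w w1; apply: (@derivableV _ _ ar); first exact: arw.
  by have /holoP := holo_scale ha r01; apply.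
set Q := (fun w => _) in hab.
have qc n : tc Q n = ofR r ^+ n * psi n.
  have eb m : ofR r ^+ m * tc b m = \sum_(k < m.+1) tc Q k * (ofR r ^+ (m - k) * tc a (m - k)).
    rewrite -(tc_scale m hb r01) (@eq_tc_disc _ (fun w => Q w * ar w) m).
      rewrite (@tcM R Q ar m hab (holo_scale ha r01)).
      by apply: eq_bigr => k _; rewrite (tc_scale _ ha r01).
    by move=> w w1; rewrite /Q mulfVK// arw.
  elim/ltn_ind: n => n IH.
  have := eb n; rewrite hpsi mulr_sumr !big_ord_recr /= subnn expr0 mul1r tc0//.
  rewrite (eq_bigr (fun k : 'I_n => tc Q k * (ofR r ^+ (n - k) * tc a (n - k)))).
    by move=> /addrI; rewrite mulrA => /mulIf; move=> /(_ a0) ->.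
  move=> k _; have kn := ltn_ord k; rewrite IH//.
  have -> : ofR r ^+ n = ofR r ^+ k * ofR r ^+ (n - k) :> C by rewrite -exprD subnKC// ltnW.
  by rewrite -!mulrA; congr (_ * _); rewrite mulrCA.
have rn0 : ofR r != 0 :> C by rewrite ofR_eq0 gt_eqF.
have zr1 : normc (z / ofR r) < 1.
  by rewrite normcM normcV normc_ofR gtr0_norm// ltr_pdivrMr// mul1r.
have := taylor_cvg hab zr1.
have -> : Q (z / ofR r) = b z / a z by rewrite /Q /ar /br mulrCA divff// mulr1.
apply: cvg_trans; apply: near_eq_cvg; near=> N.
have nN : (n0 <= N)%N by near: N; exact: nbhs_infty_ge.
rewrite (big_cat_nat (n := n0))//= big1_seq ?add0r; last first.
  by move=> k; rewrite mem_index_iota => /andP[_ kn]; rewrite qc psi0// mulr0 mul0r.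
apply: eq_bigr => k _; rewrite qc expr_div_n mulrC.
by field; rewrite expf_neq0.
Unshelve. all: by end_near. Qed.

Lemma cvg_scale (u : nat -> C) (c l : C) : u n @[n --> \oo] --> l -> (c * u n : C) @[n --> \oo] --> c * l.
Proof.
move=> h; exact: (@cvgM C nat \oo _ (fun=> c) u c l (@cvg_cst C c nat \oo _) h).
Qed.

Lemma cvg_sum_scale m (c : nat -> C) (u : nat -> nat -> C) (l : nat -> C) :
  (forall k, u k n @[n --> \oo] --> l k) ->
  (\sum_(k < m) c k * u k n : C) @[n --> \oo] --> \sum_(k < m) c k * l k.
Proof.
move=> h; elim: m => [|m IH].
  by under eq_cvg do rewrite big_ord0; rewrite big_ord0; exact: cvg_cst.
under eq_cvg do rewrite big_ord_recr /=; rewrite big_ord_recr /=.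
exact: (@cvgD C C nat \oo _ (fun n => \sum_(k < m) c k * u k n) (fun n => c m * u m n) _ _ IH
  (@cvg_scale (u m) (c m) _ (h m))).
Qed.

Lemma coef_cvg (p : nat -> {poly C}) f F n : L2c (fun N t => (p N).[circ t]) F -> Hardy f F ->
  ((p N)`_n : C) @[N --> \oo] --> tc f n.
Proof.
move=> pF hf.
have cn : L2c (fun=> (fun t => circ (- (n%:R * t)) : C)) (fun t => circ (- (n%:R * t))).
  by apply/L2c_cst/cts_L2; exact: circnatN_cts.
have := cint_cvg pF cn; rewrite (Hardy_coef n hf).
have pE N : cint 0 (2 * pi) (fun t => (p N).[circ t] * circ (- (n%:R * t))) = ofR (2 * pi) * (p N)`_n.
  have := cint_poly (p N) 1 n; rewrite ofR1 expr1n mul1r => <-.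
  by apply: eq_cint => t _; rewrite mul1r.
rewrite (funext pE) => h.
have h2 := @cvg_scale (fun N => ofR (2 * pi) * (p N)`_n) (ofR (2 * pi))^-1 _ h.
have nz := ofR_2pi_neq0 R.
have pK N : (ofR (2 * pi))^-1 * (ofR (2 * pi) * (p N)`_n) = (p N)`_n by rewrite (mulKf nz).
by rewrite (funext pK) (mulKf nz) in h2.
Qed.

Lemma convolution_limit (p q : nat -> {poly C}) (psi al be : nat -> C) :
  (forall n, ((p N)`_n : C) @[N --> \oo] --> al n) ->
  (forall n, ((q N)`_n : C) @[N --> \oo] --> be n) ->
  (forall n N, (n <= N)%N -> (q N)`_n = \sum_(k < n.+1) psi k * (p N)`_(n - k)) ->
  forall n, be n = \sum_(k < n.+1) psi k * al (n - k)%N.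
Proof.
move=> hp hq hpq n.
have h : (\sum_(k < n.+1) psi k * (p N)`_(n - k) : C) @[N --> \oo] --> \sum_(k < n.+1) psi k * al (n - k)%N.
  exact: (@cvg_sum_scale n.+1 psi (fun k N => (p N)`_(n - k)) (fun k => al (n - k)%N) (fun k => hp _)).
suff h2 : ((q N)`_n : C) @[N --> \oo] --> \sum_(k < n.+1) psi k * al (n - k)%N.
  by apply: (@cvg_unique (Cplx R) (@norm_hausdorff (Cplx R) (Cplx R)) _ _ _ _ (hq n) h2).
apply: cvg_trans h; apply: near_eq_cvg; near=> N; rewrite hpq//.
by near: N; exact: nbhs_infty_ge.
Unshelve. all: by end_near. Qed.

(** L^2 convergence carries the coefficients of the finite products to those of a and b, and for
    fixed n the convolution relation is exact as soon as the product has more than n factors. *)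
Lemma k1_taylor eta (K : C -> 'M[C]_2) a b : is_k1 eta K ->
  Hardy a (fun t => K (circ t) 0 0) -> Hardy b (fun t => K (circ t) 0 1) -> a 0 != 0 ->
  taylor_quot b a 0 (taylor_coef 0 eta).
Proof.
move=> hK ha hb a0; apply: taylor_quotP => //; [by case: ha|by case: hb|].
apply: (@convolution_limit (fun N => (row_polys eta N.+1 0).1) (fun N => (row_polys eta N.+1 0).2)).
- move=> n; apply: (@coef_cvg (fun N => (row_polys eta N.+1 0).1) a _ n _ ha).
  have := L2_cvgP (hK 0 0); congr (L2c _ _); apply/funext => N; apply/funext => t.
  by rewrite k1_partialE (rprod_row eta _ 0 (circ_neq0 _)).1.
- move=> n; apply: (@coef_cvg (fun N => (row_polys eta N.+1 0).2) b _ n _ hb).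
  have := L2_cvgP (hK 0 1); congr (L2c _ _); apply/funext => N; apply/funext => t.
  by rewrite k1_partialE (rprod_row eta _ 0 (circ_neq0 _)).2 expr0 mul1r.
by move=> n N nN; rewrite row_polys_coef.
Qed.

Lemma k2_taylor zeta (K : C -> 'M[C]_2) c d : is_k2 zeta K ->
  Hardy c (fun t => K (circ t) 1 0) -> Hardy d (fun t => K (circ t) 1 1) -> d 0 != 0 ->
  taylor_quot c d 1 (taylor_coef 1 zeta).
Proof.
move=> hK hc hd d0; apply: taylor_quotP => //; [by case: hd|by case: hc| |]; last first.
  by move=> k k1; rewrite taylor_coefE gsum_lt.
apply: (@convolution_limit (fun N => (row_polys zeta N 1).1) (fun N => 'X * (row_polys zeta N 1).2)).
- move=> n; apply: (@coef_cvg (fun N => (row_polys zeta N 1).1) d _ n _ hd).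
  have := L2_cvgP (hK 1 1); congr (L2c _ _); apply/funext => N; apply/funext => t.
  by rewrite (k2_partialE zeta _ (circ_neq0 _)).1.
- move=> n; apply: (@coef_cvg (fun N => 'X * (row_polys zeta N 1).2) c _ n _ hc).
  have := L2_cvgP (hK 1 0); congr (L2c _ _); apply/funext => N; apply/funext => t.
  by rewrite (k2_partialE zeta _ (circ_neq0 _)).2 hornerM hornerX.
(* The factor ['X] shifts the coefficients by one; this matches the empty sum at weight 0, as all
   indices are at least 1. *)
move=> [|n] N nN; rewrite coefXM /=.
  by rewrite big_ord_recl big_ord0 addr0 taylor_coefE gsum_lt// mul0r.
rewrite row_polys_coef// [RHS]big_ord_recl taylor_coefE gsum_lt// mul0r add0r.
by [].
Qed.
End Quotients.

(** * Taylor coefficients of the exponential of a polynomial *)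

Section ExponentialCoefficients.
Local Open Scope classical_set_scope.
Local Open Scope ring_scope.
Variable R : realType.
Local Notation C := (Cplx R).
Local Notation normc := (@Normc.normc R).
Implicit Types (f g : C -> C) (P : {poly C}) (z w : C) (r q : R).

Lemma derivable_horner P z : derivable (fun z => P.[z] : C) z 1.
Proof.
elim/poly_ind: P => [|P c IH].
  have -> : (fun z => (0 : {poly C}).[z]) = cst 0 by apply/funext => w; rewrite horner0.
  exact: derivable_cst.
have -> : (fun z => (P * 'X + c%:P).[z]) = (fun z => P.[z] * z + c).
  by apply/funext => w; rewrite !hornerE.
apply: (@derivableD _ _ _ (fun z => P.[z] * z) (cst c)); last exact: derivable_cst.
by apply: (@derivableM _ _ (fun z => P.[z]) id); [exact: IH|exact: derivable_id].
Qed.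

Lemma holo_horner P : holo (fun z => P.[z]).
Proof. by move=> z _; exact: derivable_horner. Qed.

Lemma tc_poly P n : tc (fun z => P.[z]) n = P`_n.
Proof.
rewrite /tc cint_poly mulrCA mulKf ?ofR_2pi_neq0// mulrA -exprMn.
by rewrite -ofR_nat -ofRM divff ?ofR1 ?expr1n ?mul1r// pnatr_eq0.
Qed.

Lemma half01 : 0 <= (2^-1 : R) < 1. Proof. by apply/andP; split; lra. Qed.

Lemma tcB f g n : holo f -> holo g -> tc (fun z => f z - g z) n = tc f n - tc g n.
Proof.
move=> hf hg; rewrite /tc -!mulrBr; congr (_ * (_ * _)).
rewrite -cintB; [|exact/cts_integrable/cts_fcirc/half01..].
by apply: eq_cint => t _; rewrite mulrBl.
Qed.

Lemma normc_tc_le f n (M : R) : holo f ->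
  (forall t, 0 <= t <= 2 * pi -> normc (f (ofR 2^-1 * circ t)) <= M) -> normc (tc f n) <= 2 ^+ n * M.
Proof.
move=> hf hM; rewrite /tc !normcM normcX normcV normc_ofR gtr0_norm ?twopi_gt0//.
have -> : normc (2 : C) = 2 by rewrite -ofR_nat normc_ofR normr_nat.
rewrite mulrCA ler_pM2l ?exprn_gt0// ler_pdivrMl ?twopi_gt0//.
have pi0 := twopi_gt0 R.
have := @cint_normc_cst R 0 (2 * pi) (fun t => f (ofR 2^-1 * circ t) * circ (- (n%:R * t))) M (ltW pi0).
rewrite subr0 => h; rewrite [leRHS]mulrC; apply: h; first exact/cts_integrable/cts_fcirc/half01.
by move=> t t01; rewrite normcM normc_circ mulr1 hM.
Qed.

Lemma geometric_cvg m : \sum_(i < m) rn R k ^+ i @[k --> \oo] --> (m%:R : R).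
Proof.
have X1 i : rn R k ^+ i @[k --> \oo] --> (1 : R).
  elim: i => [|i IH]; first exact: cvg_cst.
  have -> : (fun k => rn R k ^+ i.+1) = (fun k => rn R k * rn R k ^+ i).
    by apply/funext => k; rewrite exprS.
  by rewrite -[X in _ --> X](mulr1 1); exact: cvgM (@rn_cvg R) IH.
elim: m => [|m IH].
  by under eq_fun do rewrite big_ord0; exact: cvg_cst.
under eq_fun do rewrite big_ord_recr /=.
by rewrite -natr1; exact: cvgD IH (X1 m).
Qed.

(** It is stated on the circle |z| = 1/2 over which [tc] integrates, so that it bounds coefficients
    after division by 1 - r. *)
Lemma horner_lipschitz P : exists2 B : R, 0 <= B & forall r t, 0 < r < 1 ->
  0 <= t <= 2 * pi -> normc (P.[ofR r * (ofR 2^-1 * circ t)] - P.[ofR 2^-1 * circ t]) <= B * (1 - r).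
Proof.
elim/poly_ind: P => [|P c [B B0 IH]].
  by exists 0 => // r t _ _; rewrite !horner0 subrr normc0 mul0r.
have cP t : {for (ofR 2^-1 * circ t : C), continuous (fun z => P.[z])}.
  exact/derivable_continuous/derivable_horner.
have [M M0 hM] := circle_bounded cP.
exists (B + M); rewrite ?addr_ge0// => r t r01 t01; have /andP[r0 r1] := r01.
have z1 : normc (ofR 2^-1 * circ t) <= 1 by rewrite normc_rcirc; lra.
move: (IH r t r01 t01) (hM t t01) z1; move: (ofR 2^-1 * circ t) => z IHz hMz z1.
rewrite !hornerMXaddC.
have -> : P.[ofR r * z] * (ofR r * z) + c - (P.[z] * z + c) =
  (P.[ofR r * z] - P.[z]) * (ofR r * z) - P.[z] * z * ofR (1 - r).
  by rewrite ofRD ofRN ofR1; ring.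
have z0 := normc_ge0 z.
rewrite (le_trans (normcB _ _))// [leRHS]mulrDl lerD// !normcM !normc_ofR.
  rewrite -[leRHS]mulr1; apply: ler_pM; [exact: normc_ge0|by rewrite mulr_ge0 ?normr_ge0|exact: IHz|].
  by rewrite -[leRHS]mulr1; apply: ler_pM => //; rewrite gtr0_norm// ltW.
rewrite gtr0_norm ?subr_gt0//; apply: ler_wpM2r; first by rewrite subr_ge0 ltW.
by rewrite -[leRHS]mulr1; apply: ler_pM => //; exact: normc_ge0.
Qed.

Definition cexpoly P z : C := cexp P.[z].

Lemma derivable_cexpoly P z : derivable (cexpoly P) z 1.
Proof. by apply: (@derivable_cexp _ (fun z => P.[z])); exact: derivable_horner. Qed.

Lemma holo_cexpoly P : holo (cexpoly P).
Proof. by move=> z _; exact: derivable_cexpoly. Qed.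

(* Compare the coefficients of [f z - f (q z) = f z * (1 - cexp (P (q z) - P z))]
   with [f = cexp o P], divide by [1 - q] and let [q] tend to 1. *)
Lemma cexpoly_rec P n : n%:R * tc (cexpoly P) n =
  \sum_(j < n.+1) tc (cexpoly P) j * ((n - j)%:R * P`_(n - j)).
Proof.
set f := cexpoly P; have hf : holo f := @holo_cexpoly P.
pose w q z := P.[ofR q * z] - P.[z]; pose H q z := 1 - cexp (w q z).
(* [s k m] is (1 - q^m) / (1 - q) and tends to m; [v k m], the coefficient of H divided by 1 - q,
   tends to m times the m-th coefficient of P. *)
pose s k m := (\sum_(i < m) ofR (rn R k) ^+ i : C).
pose v k m := tc (H (rn R k)) m / ofR (1 - rn R k).
have dw q z : derivable (w q) z 1.
  apply: (@derivableB _ _ _ (fun z => P.[ofR q * z]) (fun z => P.[z])); last exact: derivable_horner.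
  apply: (@derivable_comp R (fun z => ofR q * z) (fun z => P.[z])); last exact: derivable_scale.
  exact: derivable_horner.
have hw q : holo (w q) by move=> z _; exact: dw.
have hcw q : holo (fun z => cexp (w q z)) by move=> z _; exact/derivable_cexp/dw.
have hH q : holo (H q).
  by move=> z z1; apply: (@derivableB _ _ _ (cst (1 : C)) (fun z => cexp (w q z))); [exact: derivable_cst|exact: hcw].
have q01 k : 0 < rn R k <= 1 by have /andP[a b] := rn01 R k; rewrite a ltW.
have q1 k : ofR (1 - rn R k) != 0 :> C.
  by rewrite ofR_eq0 subr_eq0 eq_sym lt_eqF//; have /andP[] := rn01 R k.
have sE k m : 1 - ofR (rn R k) ^+ m = ofR (1 - rn R k) * s k m.
  rewrite (ofRD 1 (- rn R k)) (ofRN (rn R k)) ofR1 /s; have := subrX1 (ofR (rn R k) : C) m.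
  by move=> h; rewrite -[LHS]opprB h -mulNr opprB.
have s_cvg m : (s k m : C) @[k --> \oo] --> (m%:R : C).
  have := @cvg_ofR R nat \oo _ _ _ (@geometric_cvg m); rewrite ofR_nat.
  suff -> : (fun k => ofR (\sum_(i < m) rn R k ^+ i)) = s^~ m by move=> h; exact: h.
  apply/funext => k.
  by rewrite /s; elim: m => [|m IH]; rewrite ?big_ord0// !big_ord_recr /= ofRD IH ofRX.
have tcsv k m : s k m * tc f m = \sum_(j < m.+1) tc f j * v k (m - j)%N.
  apply: (mulfI (q1 k)); rewrite mulrA -sE mulrBl mul1r -(tc_scale m hf (q01 k)) -(tcB m hf (holo_scale hf (q01 k))).
  rewrite (@eq_tc_disc _ _ (fun z => f z * H (rn R k) z) m).
    rewrite (tcM m hf (hH (rn R k))) mulr_sumr; apply: eq_bigr => j _.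
    by rewrite /v [RHS]mulrCA; congr (_ * _); rewrite [RHS]mulrC divfK.
  by move=> z z1; rewrite /f /H /cexpoly /w mulrBr mulr1 -cexpD [P.[z] + _]addrC subrK.
have v_cvg m : (v k m : C) @[k --> \oo] --> m%:R * P`_m.
  have [B B0 hB] := horner_lipschitz P.
  have hr q : holo (fun z => cexp (w q z) - 1 - w q z).
    move=> z z1; apply: (@derivableB _ _ _ (fun z => cexp (w q z) - 1) (w q)); last exact: hw.
    by apply: (@derivableB _ _ _ (fun z => cexp (w q z)) (cst (1 : C))); [exact: hcw|exact: derivable_cst].
  have vE k : v k m = P`_m * s k m - tc (fun z => cexp (w (rn R k) z) - 1 - w (rn R k) z) m / ofR (1 - rn R k).
    apply: (mulfI (q1 k)); rewrite /v [LHS]mulrC divfK//.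
    rewrite mulrBr mulrCA -sE [ofR (1 - rn R k) * (_ / _)]mulrC divfK// mulrBr mulr1.
    rewrite [P`_m * _]mulrC -[in X in _ - X - _](tc_poly P m) -(tc_scale m (@holo_horner P) (q01 k)).
    rewrite -[X in X - _ - _](tc_poly P m) -(tcB m (@holo_horner P) (holo_scale (@holo_horner P) (q01 k))).
    rewrite -tcB; [|by move=> z z1; apply: (@derivableB _ _ _ (fun z => P.[z]) (fun z => P.[ofR (rn R k) * z]));
      [exact: derivable_horner|exact: (holo_scale (@holo_horner P) (q01 k))]|exact: hr].
    by apply: eq_tc_disc => z z1; rewrite /H /w; ring.
  pose D k : C := tc (fun z => cexp (w (rn R k) z) - 1 - w (rn R k) z) m / ofR (1 - rn R k).
  (* On |z| = 1/2 the exponent w is of order 1 - q, so exp w - 1 - w is o(1 - q), and so are its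
     coefficients. The B + 1 in e' avoids a division by zero when B = 0. *)
  have D0 : D k @[k --> \oo] --> (0 : C).
    apply/ccvgP => e e0; pose e' := e / (2 ^+ m * (B + 1)).
    have Q0 : 0 < 2 ^+ m * (B + 1) by rewrite mulr_gt0 ?exprn_gt0// ltr_wpDl.
    have e'0 : 0 < e' by rewrite divr_gt0.
    have [d d0 hd] := @cexp_eps0 R e' e'0.
    have r1 : B * (1 - rn R k) @[k --> \oo] --> (0 : R).
      have c1 : (1 - rn R k) @[k --> \oo] --> (1 - 1 : R).
        by apply: cvgB; [exact: cvg_cst|exact: rn_cvg].
      rewrite -[X in _ --> X](mulr0 B) -[X in B * X](subrr 1).
      by apply: cvgM; [exact: cvg_cst|exact: c1].
    have nd : \forall k \near \oo, B * (1 - rn R k) < d.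
      by apply: (cvgr_lt _ r1); rewrite normr0 || exact: d0.
    near=> k; rewrite sub0r normcN /D normcM normcV.
    have /andP[rk0 rk1] := rn01 R k; have rk2 : 0 < 1 - rn R k by rewrite subr_gt0.
    rewrite normc_ofR gtr0_norm// ltr_pdivrMr//.
    have hk : normc (tc (fun z => cexp (w (rn R k) z) - 1 - w (rn R k) z) m) <= 2 ^+ m * (e' * (B * (1 - rn R k))).
      apply: normc_tc_le; first exact: hr.
      move=> t t01; have wB := hB (rn R k) t (rn01 R k) t01.
      have wd : normc (w (rn R k) (ofR 2^-1 * circ t)) < d.
        by apply: le_lt_trans wB _; near: k.
      by apply: le_trans (hd _ wd) _; rewrite ler_wpM2l// ltW.
    apply: le_lt_trans hk _.
    have -> : 2 ^+ m * (e' * (B * (1 - rn R k))) = e * (1 - rn R k) * (B / (B + 1)).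
      rewrite /e'; field; rewrite expf_neq0//= gt_eqF//; lra.
    rewrite -[ltRHS]mulr1 ltr_pM2l ?mulr_gt0// ltr_pdivrMr ?mul1r; lra.
  have := @cvg_scale R (fun k => s k m) P`_m _ (s_cvg m).
  move=> c1; have c2 := cvgB c1 D0; rewrite subr0 mulrC in c2.
  suff -> : v^~ m = (fun k => P`_m * s k m - D k) by exact: c2.
  by apply/funext => k; rewrite vE.
have l1 := @cvg_sum_scale R n.+1 (fun j => tc f j) (fun j k => v k (n - j)%N) _ (fun j => v_cvg (n - j)%N).
have l2 := @cvg_scale R (fun k => s k n) (tc f n) _ (s_cvg n).
rewrite mulrC.
have E : (fun k => tc f n * s k n) = (fun k => \sum_(j < n.+1) tc f j * v k (n - j)%N).
  by apply/funext => k; rewrite mulrC tcsv.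
rewrite E in l2.
exact: (@cvg_unique (Cplx R) (@norm_hausdorff (Cplx R) (Cplx R)) _ _ _ _ l2 l1).
Unshelve. all: by end_near. Qed.
End ExponentialCoefficients.

(** * The Lebedev-Milin inequality and mean squares of exponentials *)

Section LebedevMilin.
Local Open Scope classical_set_scope.
Local Open Scope ring_scope.
Variable R : realType.
Local Notation C := (Cplx R).
Local Notation normc := (@Normc.normc R).
Local Notation mu := (@lebesgue_measure R).
Local Notation circle := (@circle R).
Implicit Types (f g : C -> C) (P : {poly C}) (z w : C) (r q : R) (F : R -> C).

Lemma finite_cauchy_schwarz n (x y : nat -> C) :
  abs2 (\sum_(j < n) x j * y j) <= (\sum_(j < n) abs2 (x j)) * \sum_(j < n) abs2 (y j).
Proof.
elim: n => [|n IH]; first by rewrite !big_ord0 abs2E normc0 expr0n /= mulr0.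
have X0 : 0 <= \sum_(j < n) abs2 (x j) by apply: sumr_ge0 => i _; exact: abs2_ge0.
have Y0 : 0 <= \sum_(j < n) abs2 (y j) by apply: sumr_ge0 => i _; exact: abs2_ge0.
rewrite !big_ord_recr /=; move: IH X0 Y0.
move: (\sum_(j < n) _) => S; move: (\sum_(j < n) _) => X; move: (\sum_(j < n) _) => Y.
rewrite !abs2E => SXY X0 Y0; move: SXY.
have := normcD S (x n * y n); rewrite normcM.
have := normc_ge0 (S + x n * y n); have := normc_ge0 S.
have := normc_ge0 (x n); have := normc_ge0 (y n).
move: (normc (S + _)) (normc S) (normc (x n)) (normc (y n)) => u s a b b0 a0 s0 u0 us sXY.
have h : 2 * (s * (a * b)) <= X * b ^+ 2 + Y * a ^+ 2.
  rewrite -ler_sqr ?nnegrE ?addr_ge0 ?mulr_ge0 ?sqr_ge0//.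
  have -> : (2 * (s * (a * b))) ^+ 2 = s ^+ 2 * (4 * (a * b) ^+ 2) by ring.
  apply: (@le_trans _ _ (X * Y * (4 * (a * b) ^+ 2))).
    by apply: ler_wpM2r => //; rewrite mulr_ge0 ?sqr_ge0.
  rewrite -subr_ge0.
  have -> : (X * b ^+ 2 + Y * a ^+ 2) ^+ 2 - X * Y * (4 * (a * b) ^+ 2) =
    (X * b ^+ 2 - Y * a ^+ 2) ^+ 2 by ring.
  exact: sqr_ge0.
apply: (@le_trans _ _ ((s + a * b) ^+ 2)).
  by rewrite ler_sqr ?nnegrE ?addr_ge0 ?mulr_ge0.
nra.
Qed.

(** The recursion is that of the coefficients c of exp(sum of al_k z^k). Cauchy-Schwarz bounds each
    new |c|^2 by the previous partial sum times A / (m + 1)^2, where A sums j^2 |al_j|^2, and 1 + x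
    <= exp x turns the resulting product into an exponential. *)
Lemma lebedev_milin (c al : nat -> C) : normc (c 0%N) = 1 ->
  (forall n, n%:R * c n = \sum_(j < n.+1) c j * ((n - j)%:R * al (n - j)%N)) ->
  forall n, \sum_(j < n.+1) abs2 (c j) <= expR (2 * \sum_(j < n.+1) j%:R * abs2 (al j)).
Proof.
move=> c0 crec n.
pose T m := \sum_(j < m.+1) abs2 (c j); pose W m : R := 2 * \sum_(j < m.+1) j%:R * abs2 (al j).
pose A m := \sum_(j < m.+1) abs2 (j%:R * al j).
have A0 m : 0 <= A m by apply: sumr_ge0 => j _; exact: abs2_ge0.
have T0 m : 0 <= T m by apply: sumr_ge0 => j _; exact: abs2_ge0.
have AS m : A m.+1 = A m + m.+1%:R ^+ 2 * abs2 (al m.+1).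
  by rewrite /A big_ord_recr /= abs2M; congr (_ + _ * _); rewrite -ofR_nat abs2E normc_ofR normr_nat.
have Tstep m : T m.+1 <= T m * (1 + A m.+1 / m.+1%:R ^+ 2).
  have h : m.+1%:R ^+ 2 * abs2 (c m.+1) <= T m * A m.+1.
    have -> : m.+1%:R ^+ 2 * abs2 (c m.+1) = abs2 (m.+1%:R * c m.+1).
      by rewrite abs2M; congr (_ * _); rewrite -ofR_nat abs2E normc_ofR normr_nat.
    rewrite crec big_ord_recr /= subnn mul0r mulr0 addr0.
    apply: le_trans (finite_cauchy_schwarz _ c (fun j => (m.+1 - j)%:R * al (m.+1 - j)%N)) _.
    apply: ler_wpM2l; first exact: T0.
    rewrite /A [leRHS]big_ord_recl /= mul0r [X in _ <= X + _]abs2E normc0 expr0n /= add0r.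
    rewrite [leRHS](reindex_inj rev_ord_inj) /=; apply: ler_sum => j _.
    by rewrite /bump /= add1n subSS -subSn// -ltnS.
  rewrite {1}/T big_ord_recr /= -/(T m) mulrDr mulr1 lerD2l mulrA ler_pdivlMr ?exprn_gt0//.
  by rewrite mulrC.
(* The correction A m / m makes the terms A / (m + 1)^2 telescope. For m = 0 it is 0, both because A
   0 = 0 and because division by 0 gives 0; the step from 0 to 1 is an equality of exponents, which
   fixes the constant 2 in W. *)
have key m : T m <= expR (W m - A m / m%:R).
  elim: m => [|m IH].
    rewrite /T /W /A !big_ord_recl !big_ord0 !addr0 /= mul0r mulr0 invr0 mulr0 subr0 expR0.
    by rewrite abs2E c0 expr1n.
  apply: le_trans (Tstep m) _.
  apply: (@le_trans _ _ (expR (W m - A m / m%:R) * expR (A m.+1 / m.+1%:R ^+ 2))).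
    apply: ler_pM => //; last exact: expR_ge1Dx.
    by rewrite addr_ge0// divr_ge0// sqr_ge0.
  rewrite -expRD ler_expR {1}/W -/(W m) -subr_ge0.
  have WS : W m.+1 = W m + 2 * (m.+1%:R * abs2 (al m.+1)).
    by rewrite /W big_ord_recr /= mulrDr.
  rewrite WS AS; move: (abs2 (al m.+1)) (abs2_ge0 (al m.+1)) (A0 m) => a a0 Am.
  clear IH WS; case: m Am => [|m] Am.
    have -> : A 0%N = 0 by rewrite /A big_ord_recl big_ord0 addr0 /= mul0r abs2E normc0 expr0n.
    rewrite mul0r add0r expr1n !mul1r; lra.
  have N0 : 0 < m.+1%:R :> R by rewrite ltr0n.
  rewrite -[m.+2%:R]natr1; move: (m.+1%:R : R) (A m.+1) (W m.+1) N0 Am => N B w N0 B0.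
  have -> : w + 2 * ((N + 1) * a) - (B + (N + 1) ^+ 2 * a) / (N + 1) -
     (w - B / N + (B + (N + 1) ^+ 2 * a) / (N + 1) ^+ 2) = N * a + B / (N * (N + 1) ^+ 2).
    field; rewrite !gt_eqF//; lra.
  apply: addr_ge0; first by apply: mulr_ge0 => //; exact: ltW.
  by apply: divr_ge0 => //; apply: mulr_ge0; [exact: ltW|exact: sqr_ge0].
by apply: le_trans (key n) _; rewrite ler_expR gerBl divr_ge0.
Qed.

Lemma cint_conj_mul F : L2 F -> cint 0 (2 * pi) (fun t => F t * (F t)^*) = ofR (N2 F).
Proof.
move=> hF; apply: complex_eq; rewrite /cint /=.
  by apply: eq_Rintegral => t _; rewrite mul_conjE.
rewrite (_ : (fun t => _) = fun=> 0); last by apply/funext => t; rewrite mul_conjE.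
by rewrite Rintegral_cst// mul0r.
Qed.

Lemma L2c_N2 (f : nat -> R -> C) F : L2c f F -> N2 (f n) @[n --> \oo] --> N2 F.
Proof.
move=> h; have [fn hF _] := h; have := cint_cvg h (L2c_conj h).
rewrite (cint_conj_mul hF) (funext (fun n => cint_conj_mul (fn n))).
by case/cvg_ReIm.
Qed.

Lemma N2_poly_circ P r : N2 (fun t => P.[ofR r * circ t]) =
  2 * pi * \sum_(j < size P) abs2 P`_j * r ^+ j ^+ 2.
Proof.
have cP a b : cts_on a b (fun t => P.[ofR r * circ t]).
  by apply: cts_circle => t; exact/derivable_continuous/derivable_horner.
have cPn n : cintegrable 0 (2 * pi) (fun t => P.[ofR r * circ t] * circ (- (n%:R * t))).
  by apply/cts_integrable/cts_onM; [exact: cP|exact: circnatN_cts].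
suff : ofR (N2 (fun t => P.[ofR r * circ t])) = ofR (2 * pi * \sum_(j < size P) abs2 P`_j * r ^+ j ^+ 2).
  by move=> /(congr1 (@complex.Re R)).
rewrite -cint_conj_mul; last exact/cts_L2/cP.
transitivity (cint 0 (2 * pi) (fun t => \sum_(j < size P) (P`_j * ofR r ^+ j)^* *
   (P.[ofR r * circ t] * circ (- (j%:R * t))))).
  apply: eq_cint => t _; rewrite [X in _ * X^*]horner_coef rmorph_sum mulr_sumr.
  apply: eq_bigr => j _; rewrite exprMn circX circN mulrA rmorphM/=.
  ring.
rewrite cint_sum; [|exact/ltW/twopi_gt0|by move=> j; apply: cintegrableZ].
transitivity (\sum_(j < size P) ofR (2 * pi) * ofR (abs2 P`_j * r ^+ j ^+ 2) : C).
  apply: eq_bigr => j _; rewrite cintZ// cint_poly !ofRM mulrCA; congr (_ * _).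
  rewrite -mul_conjE !ofRX rmorphM rmorphXn /= conj_ofR; ring.
rewrite -mulr_sumr [RHS]ofRM; congr (_ * _).
by elim/big_rec2: _ => [|j x y _ ->]; rewrite ?ofR0// [RHS]ofRD.
Qed.

Lemma L2c_unif (p : nat -> R -> C) (q : R -> C) (B : R) :
  (forall n, L2 (p n)) -> cmeas q -> (forall t, circle t -> normc (q t) <= B) ->
  (forall e : R, 0 < e -> \forall n \near \oo, forall t, circle t -> normc (p n t - q t) <= e) ->
  L2c p q.
Proof.
move=> pn cq qB pq.
have L1 : L2 (fun=> 1 : C) by apply/cts_L2; exact: cts_cst.
have p1 n : (fun t => p n t * 1) = p n by apply/funext => t; rewrite mulr1.
have := @L2c_mul R p q B (fun _ _ => 1) (fun=> 1) (fun n => (pn n).1) cq _ qB pq (L2c_cst L1).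
rewrite (_ : (fun t => q t * 1) = q); last by apply/funext => t; rewrite mulr1.
by rewrite (funext p1); apply => n; rewrite p1.
Qed.

(* Parseval: [F] has no Fourier coefficient of negative index. *)
Lemma N2_Hardy_le f F (T : R) : Hardy f F ->
  (forall n, \sum_(j < n.+1) abs2 (tc f j) <= T) -> N2 F <= 2 * pi * T.
Proof.
move=> [hf fF] hT.
have pi0 := twopi_gt0 R.
suff h k : N2 (fun t => f (ofR (rn R k) * circ t)) <= 2 * pi * T.
  by apply: (cvgr_to_le (L2c_N2 fF)); near=> k; exact: h.
have r01 := rn01 R k; have /andP[r0 r1] := r01.
set r := rn R k in r01 r0 r1 *.
have r01' : 0 <= r < 1 by rewrite ltW.
pose p n : {poly C} := \poly_(j < n.+1) tc f j.
have pE n z : (p n).[z] = \sum_(j < n.+1) tc f j * z ^+ j by rewrite horner_poly.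
have [B [q [B0 q01 hB]]] := taylor_unif hf r01.
have [M M0 hM] := circle_bounded (fun t => @holo_cts_circle R f r t hf r01').
have pL2 n : L2 (fun t => (p n).[ofR r * circ t]).
  by apply/cts_L2/cts_circle => t; exact/derivable_continuous/derivable_horner.
have pf : L2c (fun n t => (p n).[ofR r * circ t]) (fun t => f (ofR r * circ t)).
  apply: (@L2c_unif _ _ M) => //; first by have [] := holo_L2 hf r01'.
  move=> e e0.
  have : B * q ^+ n.+1 @[n --> \oo] --> (0 : R).
    have -> : (fun n => B * q ^+ n.+1) = (fun n => (B * q) * q ^+ n).
      by apply/funext => n; rewrite exprS mulrA.
    by apply: cvg_geometric; have /andP[q0 q1] := q01; rewrite ger0_norm.
  move=> /cvgr_lt /(_ e e0) ; apply: filterS => n /ltW ne t /(circle_I t) t01.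
  by rewrite normcBC pE (le_trans _ ne)// hB.
apply: (cvgr_to_le (L2c_N2 pf)); near=> n.
rewrite N2_poly_circ ler_pM2l//.
apply: le_trans (hT n); have sp : (size (p n) <= n.+1)%N by exact: size_poly.
rewrite (big_ord_widen n.+1 (fun j => abs2 (p n)`_j * r ^+ j ^+ 2) sp) big_mkcond /=.
apply: ler_sum => j _; case: ifP => _; last exact: abs2_ge0.
rewrite coef_poly ltn_ord -[leRHS]mulr1 ler_wpM2l ?abs2_ge0//.
by rewrite !exprn_ile1 ?exprn_ge0// ltW.
Unshelve. all: by end_near. Qed.

Lemma Hardy_cexpoly P : Hardy (cexpoly P) (fun t => cexpoly P (circ t)).
Proof.
have h := @Hardy_cts_mul R (cexpoly P) _ _ (@holo_cexpoly R P)
  (fun t => derivable_continuous (@derivable_cexpoly R P (circ t))) (Hardy_cst 1).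
have e1 : (fun z => cexpoly P z * 1) = cexpoly P by apply/funext => z; rewrite mulr1.
have e2 : (fun t => cexpoly P (circ t) * 1) = (fun t => cexpoly P (circ t)) by apply/funext => t; rewrite mulr1.
by rewrite e1 e2 in h.
Qed.

(** The degree of P does not enter the bound, which is therefore uniform along the partial sums of a
    series. *)
Lemma N2_cexpoly P (W : R) : P`_0 = 0 ->
  (forall n, 2 * \sum_(j < n.+1) j%:R * abs2 P`_j <= W) ->
  N2 (fun t => cexpoly P (circ t)) <= 2 * pi * expR W.
Proof.
move=> P0 hW; apply: (N2_Hardy_le (Hardy_cexpoly P)) => n.
apply: le_trans (lebedev_milin (al := fun j => P`_j) _ (cexpoly_rec P) n) _.
  by rewrite tc0; [rewrite /cexpoly horner_coef0 P0 cexp0 normc1|exact: holo_cexpoly].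
by rewrite ler_expR.
Qed.

End LebedevMilin.

(** * Vanishing of a holomorphic function forced by its phase on the circle *)

Section PhaseRigidity.
Local Open Scope classical_set_scope.
Local Open Scope ring_scope.
Variable R : realType.
Local Notation C := (Cplx R).
Local Notation normc := (@Normc.normc R).
Local Notation mu := (@lebesgue_measure R).
Local Notation circle := (@circle R).
Implicit Types (f g : C -> C) (P : {poly C}) (z w : C) (r q : R) (F : R -> C).

Lemma cexp_conj w : (cexp w)^* = cexp w^*.
Proof. by rewrite !cexpE rmorphM /= conj_ofR -circN Re_conj Im_conj. Qed.

Lemma cexp_circ th : cexp (Complex 0 th) = circ th :> C.
Proof. by rewrite cexpE /= expR0 ofR1 mul1r. Qed.

Lemma normc_expr_sub1 w n : normc w = 1 -> normc (w ^+ n - 1) <= n%:R * normc (w - 1).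
Proof.
move=> w1; rewrite subrX1 normcM mulrC ler_wpM2r ?normc_ge0//.
apply: le_trans (normc_sum _ _ _) _.
rewrite (eq_bigr (fun=> 1)); first by rewrite sumr_const card_ord.
by move=> i _; rewrite normcX w1 expr1n.
Qed.

Lemma normc_circ_sub1 th : normc (circ th - 1 : C) <= 2 * `|th|.
Proof.
have [d d0 hd] := @cexp_eps0 R 1 ltr01.
have small h : `|h| < d -> normc (circ h - 1 : C) <= 2 * `|h|.
  move=> hh; have nh : normc (Complex 0 h : C) = `|h|.
    have -> : (Complex 0 h : C) = ofR h * Complex 0 1.
      by apply: complex_eq; rewrite ?ReM ?ImM /=; ring.
    rewrite normcM normc_ofR; have -> : normc (Complex 0 1 : C) = 1; last by rewrite mulr1.
    by rewrite /Normc.normc expr0n /= add0r expr1n sqrtr1.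
  have := hd (Complex 0 h); rewrite nh cexp_circ => /(_ hh); rewrite mul1r => b.
  have -> : (circ h - 1 : C) = (circ h - 1 - Complex 0 h) + Complex 0 h by rewrite subrK.
  by apply: le_trans (normcD _ _) _; rewrite nh; lra.
(* The angle is divided into m parts small enough for the expansion at 0; the bound then propagates
   through |w^m - 1| <= m |w - 1| for |w| = 1. *)
pose m := (Num.bound (`|th| / d)).+1.
have m0 : 0 < m%:R :> R by rewrite ltr0n.
have -> : th = m%:R * (th / m%:R) by rewrite mulrC divfK// gt_eqF.
rewrite -circX; apply: le_trans (normc_expr_sub1 _ (normc_circ _)) _.
rewrite normrM (ger0_norm (ltW m0)) mulrCA ler_pM2l// small//.
rewrite normrM normfV (ger0_norm (ltW m0)) ltr_pdivrMr// -ltr_pdivrMl// mulrC.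
have := archi_boundP (divr_ge0 (normr_ge0 th) (ltW d0)) => h.
by apply: (lt_trans h); rewrite ltr_nat.
Qed.

(** Of the four factors |e^(i th) - 1|, two are bounded by 2 and two by 2 |th|. In this way an L^2
    bound on an angle controls the phase error in L^4. *)
Lemma abs2_circ_sub1_sqr th : abs2 ((circ th - 1) * (circ th - 1) : C) <= 16 * th ^+ 2.
Proof.
rewrite abs2M !abs2E -(real_normK (num_real th)).
have h1 := normc_circ_sub1 th; have h2 : normc (circ th - 1 : C) <= 2.
  by apply: le_trans (normcB _ _) _; rewrite normc_circ normc1.
have := normc_ge0 (circ th - 1 : C); have := normr_ge0 th.
move: (normc _) `|th| h1 h2 => a b ab a2 b0 a0.
have e1 : a ^+ 2 <= 4 * b ^+ 2 by nra.
have e2 : a ^+ 2 <= 4 by nra.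
have e3 : 0 <= a ^+ 2 by exact: sqr_ge0.
nra.
Qed.

Lemma cmeas_circ (th : R -> R) : measurable_fun circle th -> cmeas (fun t => circ (th t) : C).
Proof.
move=> mth; split.
  apply: (@measurableT_comp _ _ _ _ _ _ (@cos R)) => //.
  by apply: continuous_measurable_fun; exact: continuous_cos.
apply: (@measurableT_comp _ _ _ _ _ _ (@sin R)) => //.
by apply: continuous_measurable_fun; exact: continuous_sin.
Qed.

Lemma L2_dom_ae F G : cmeas F -> L2 G -> aec (fun t => normc (F t) <= normc (G t)) -> L2 F.
Proof.
move=> cF [cG iG] FG; split=> //; apply/integrableP; split.
  by apply/measurable_EFinP; exact: cmeas_abs2.
have /integrableP[_] := iG; apply: le_lt_trans.
have mE H : cmeas H -> measurable_fun circle (fun x => `|(EFin \o (fun t => abs2 (H t))) x|%E).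
  move=> cH; apply: (eq_measurable_fun (EFin \o (fun t => abs2 (H t)))).
    by move=> t _ /=; rewrite ger0_norm// abs2_ge0.
  by apply/measurable_EFinP; exact: cmeas_abs2.
apply: ae_ge0_le_integral => //; [exact: measurable_itv|exact: (mE F cF)|exact: (mE G cG)|].
move: FG; rewrite /aec; apply: (@filterS _ _ (ae_filter_ringOfSetsType mu)) => t h ct; rewrite /= lee_fin !ger0_norm ?abs2_ge0// !abs2E.
by rewrite ler_sqr ?nnegrE ?normc_ge0// h.
Qed.

Lemma esum_int_ge (a : int -> R) (h : nat -> int) n (B : R) : injective h -> (forall j, 0 <= a j) ->
  (\esum_(j in [set: int]) (a j)%:E = B%:E)%E -> \sum_(j < n) a (h j) <= B.
Proof.
move=> hinj a0 aB; rewrite -lee_fin -aB; apply: esum_ge.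
exists [set` [seq h j | j <- iota 0 n]].
  by split=> //; exact: finite_seq.
rewrite -fsbig_seq ?map_inj_uniq ?iota_uniq// big_map sumEFin lee_fin.
by rewrite -[X in iota 0 X]subn0 -/(index_iota _ _) big_mkord.
Qed.

Lemma w12_fourier_bound (chi : int -> C) : w12_fourier chi -> exists B : R, forall n,
  \sum_(j < n) j%:R * (abs2 (chi j%:Z) + abs2 (chi (- j%:Z))) <= B.
Proof.
rewrite /w12_fourier; set S := (\esum_(_ in _) _)%E => Sfin.
have a0 (j : int) : 0 <= `|j|%:~R * abs2 (chi j) by rewrite mulr_ge0 ?abs2_ge0// ler0z.
have S0 : (0 <= S)%E by apply: esum_ge0 => j _; rewrite lee_fin.
have SB : S = (fine S)%:E by rewrite fineK// ge0_fin_numE.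
exists (fine S + fine S) => n.
rewrite (eq_bigr (fun j : 'I_n => `|j%:Z|%:~R * abs2 (chi j%:Z) + `|- j%:Z|%:~R * abs2 (chi (- j%:Z)))).
  rewrite big_split /= lerD//.
    by apply: (@esum_int_ge _ Posz n _ _ a0 SB) => i j [].
  by apply: (@esum_int_ge _ (fun j => - j%:Z) n _ _ a0 SB) => i j /oppr_inj [].
by move=> j _; rewrite normrN mulrDr.
Qed.
Lemma le_N2 F G : L2 F -> L2 G -> (forall t, abs2 (F t) <= abs2 (G t)) -> N2 F <= N2 G.
Proof.
move=> hF hG FG; rewrite /N2; apply: le_Rintegral => //; [exact: measurable_itv|exact: hF.2|exact: hG.2].
Qed.

Section FourierPhase.
Variables (chi : int -> C) (chif : C -> C).
Hypothesis chi_decay : w12_fourier chi.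
Hypothesis chi_cvg : L2_cvg (fourier_sum chi) chif.
Hypothesis chi_im : forall t, complex.Re (chif (circ t)) = 0.

(* [Im (fourier_sum chi N) = (c0 + Q N - conj (Q N)) / i] on the circle. *)
Let c0 : C := (chi 0 - (chi 0)^*) / 2.
Let Q N : {poly C} :=
  \poly_(k < N.+1) (if k == 0%N then 0 else (chi k%:Z - (chi (- k%:Z))^*) / 2).
Let th N t : R := complex.Im (fourier_sum chi N (circ t)).
Let rho N t : R := complex.Im (chif (circ t)) - th N t.
Let E N t : C := cexpoly (- Q N) (circ t).
Let G n N t : C := (circ (rho N t) - 1) * circ (- (n%:R * t)) * (E N t)^*.

(** Only the limit [chif] is imaginary on the circle. Each partial sum is replaced by i times its
    imaginary part, which amounts to averaging chi_k with -conj(chi_(-k)); the error is then a real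
    angle [rho], dominated by the full difference in [rho_le]. *)
Lemma fourier_sum_im N t : Complex 0 (th N t) = c0 + (Q N).[circ t] - ((Q N).[circ t])^*.
Proof.
have half z : Complex 0 (complex.Im z) = (z - z^*) / 2 :> C.
  have two : (2 : C) != 0 by rewrite pnatr_eq0.
  apply: (mulIf two); rewrite divfK// -ofR_nat.
  apply: complex_eq; rewrite ?ReM ?ImM ?ReD ?ImD ?ReN ?ImN ?Re_conj ?Im_conj /=; ring.
rewrite half /c0 /fourier_sum /Q horner_poly big_ord_recl /= mul0r add0r.
rewrite big_add1 big_mkord !rmorphD rmorph_sum rmorph_sum /=.
rewrite opprD addrACA mulrDl -addrA; congr (_ + _).
rewrite -!sumrB mulr_suml; apply: eq_bigr => k _.
rewrite /bump /= add1n.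
have e1 : (circ t ^+ k.+1)^* = circ t ^- k.+1 :> C by rewrite rmorphXn /= -circN circV exprVn.
have e2 : (circ t ^- k.+1)^* = circ t ^+ k.+1 :> C by rewrite -e1 conjCK.
have e3 : (2^-1)^* = 2^-1 :> C by rewrite -(ofR_nat R 2) -ofRV conj_ofR.
rewrite rmorphD !rmorphM rmorphB /= e1 e2 e3 conjCK; ring.
Qed.

(** Write the exponent chi as c0 + Q - conj Q + i rho: multiplying by exp(-Q) removes the analytic
    part and leaves c0 - conj Q + i rho. *)
Lemma E_phase N t : E N t * cexp (chif (circ t)) = cexp c0 * ((E N t)^* * circ (rho N t)).
Proof.
rewrite /E /cexpoly cexp_conj -(cexp_circ (rho N t)) -!cexpD; congr cexp.
have -> : chif (circ t) = Complex 0 (complex.Im (chif (circ t))).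
  by apply: complex_eq => //=; rewrite chi_im.
have -> : Complex 0 (rho N t) = Complex 0 (complex.Im (chif (circ t))) - Complex 0 (th N t) :> C.
  by apply: complex_eq; rewrite ?ReD ?ImD ?ReN ?ImN /= ?subr0.
rewrite fourier_sum_im !hornerN rmorphN /=; ring.
Qed.

Lemma E_cts N a b : cts_on a b (E N).
Proof.
move=> t _; apply: (@continuous_comp _ _ _ (@circ R) (cexpoly (- Q N))); first exact: circ_continuous.
exact/derivable_continuous/derivable_cexpoly.
Qed.

(** E^2 is the exponential of -2 Q, whose j-th coefficient is -(chi_j - conj(chi_(-j))). The 4 is
    the 2 of [lebedev_milin] times the 2 of |a + b|^2 <= 2 |a|^2 + 2 |b|^2. *)
Lemma E_sqr_bounded : exists W : R, forall N, N2 (fun t => E N t * E N t) <= W.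
Proof.
have [B hB] := w12_fourier_bound chi_decay.
exists (2 * pi * expR (4 * B)) => N.
have -> : (fun t => E N t * E N t) = (fun t => cexpoly (- (Q N + Q N)) (circ t)).
  by apply/funext => t; rewrite /E /cexpoly -cexpD -hornerD opprD.
apply: N2_cexpoly; first by rewrite coefN coefD coef_poly /= addr0 oppr0.
move=> n; apply: (@le_trans _ _ (4 * \sum_(j < n.+1) j%:R * (abs2 (chi j%:Z) + abs2 (chi (- j%:Z))))); last first.
  by rewrite ler_pM2l.
rewrite !mulr_sumr; apply: ler_sum => j _.
rewrite mulrCA [leRHS]mulrCA; apply: ler_wpM2l => //.
rewrite coefN abs2N coefD coef_poly; case: ifP => _; last first.
  by rewrite addr0 abs2E normc0 expr0n /= mulr0 mulr_ge0// addr_ge0 ?abs2_ge0.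
case: ifP => _.
  by rewrite addr0 abs2E normc0 expr0n /= mulr0 mulr_ge0// addr_ge0 ?abs2_ge0.
have hh (x : C) : x / 2 + x / 2 = x by field.
rewrite hh.
have := abs2D_le (chi j%:Z) (- (chi (- j%:Z))^*); rewrite abs2N abs2_conj => h.
lra.
Qed.

Lemma rho_le N t : rho N t ^+ 2 <= abs2 (fourier_sum chi N (circ t) - chif (circ t)).
Proof.
rewrite /abs2 ImD ImN /rho /th -[X in X <= _]add0r lerD ?sqr_ge0//.
by rewrite -[leLHS]sqrrN opprB.
Qed.

Lemma rho_meas N : measurable_fun circle (rho N).
Proof.
have [h1 h2 _] := L2_cvgP chi_cvg.
have := (cmeasB h2.1 (h1 N).1).2; apply: eq_measurable_fun => t _ /=.
by rewrite ImD ImN.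
Qed.

Lemma G_L2 n N : L2 (G n N).
Proof.
apply: (@L2_bounded_mul _ _ _ 2 _ _ _).1.
- apply: cmeasM; last by apply: cts_cmeas; exact: circnatN_cts.
  by apply: cmeasB; [apply: cmeas_circ; exact: rho_meas|apply: cts_cmeas; exact: cts_cst].
- move=> t _; rewrite normcM normc_circ mulr1; apply: le_trans (normcB _ _) _.
  by rewrite normc_circ normc1.
by apply: L2_conj; apply: cts_L2; exact: E_cts.
Qed.

(** N2 of G is the integral of |E^2| |(e^(i rho) - 1)^2|. Cauchy-Schwarz separates a bounded factor
    from one that is at most 16 times the squared L^2 distance of the partial sum to its limit. *)
Lemma G_cvg n : N2 (G n N) @[N --> \oo] --> 0.
Proof.
have [W hW] := E_sqr_bounded.
have [h1 h2 h3] := L2_cvgP chi_cvg.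
pose D N t := fourier_sum chi N (circ t) - chif (circ t).
pose S N t : C := (circ (rho N t) - 1) * (circ (rho N t) - 1).
have DL N : L2 (D N) by exact: L2B (h1 N) h2.
have DL4 N : L2 (fun t => 4 * D N t) /\ N2 (fun t => 4 * D N t) <= 4 ^+ 2 * N2 (D N).
  apply: (@L2_bounded_mul R (fun=> 4) (D N) 4 _ _ (DL N)); first by apply: cts_cmeas; exact: cts_cst.
  by move=> t _; rewrite -ofR_nat normc_ofR ger0_norm.
have SD N t : abs2 (S N t) <= abs2 (4 * D N t).
  apply: le_trans (abs2_circ_sub1_sqr _) _; rewrite abs2M.
  have -> : abs2 (4 : C) = 16 by rewrite abs2E -ofR_nat normc_ofR ger0_norm//; ring.
  by rewrite ler_pM2l// rho_le.
have cR N : cmeas (fun t => circ (rho N t) - 1 : C).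
  by apply: cmeasB; [apply: cmeas_circ; exact: rho_meas|apply: cts_cmeas; exact: cts_cst].
have SL N : L2 (S N).
  apply: (@L2_dom_ae _ (fun t => 4 * D N t)); [exact: cmeasM|exact: (DL4 N).1|].
  by apply: aec_all => t; rewrite -ler_sqr ?nnegrE ?normc_ge0// -!abs2E.
have EL N : L2 (fun t => E N t * E N t).
  by apply/cts_L2/cts_onM; exact: E_cts.
have GE N : N2 (G n N) = \int[mu]_(t in circle) normc ((E N t * E N t) * S N t).
  apply: eq_Rintegral => t _; rewrite /G /S !abs2M abs2_conj !abs2E !normcM normc_circ; ring.
have GN N : N2 (G n N) ^+ 2 <= (W * 16) * N2 (D N).
  rewrite GE; apply: le_trans (cauchy_schwarz (EL N) (SL N)) _.
  rewrite -mulrA; apply: ler_pM; [exact: N2_ge0|exact: N2_ge0|exact: hW|].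
  apply: le_trans (le_N2 (SL N) (DL4 N).1 (SD N)) _.
  by apply: le_trans (DL4 N).2 _; rewrite ler_wpM2r ?N2_ge0//; lra.
have c1 : (W * 16) * N2 (D N) @[N --> \oo] --> (0 : R).
  rewrite -[X in _ --> X](mulr0 (W * 16)); apply: cvgM; [exact: cvg_cst|exact: h3].
apply/cvgrPdist_lt => e e0; near=> N.
rewrite sub0r normrN ger0_norm ?N2_ge0// -ltr_sqr ?nnegrE ?N2_ge0 ?(ltW e0)//.
apply: le_lt_trans (GN N) _; near: N.
by apply: (cvgr_lt _ c1); rewrite exprn_gt0.
Unshelve. all: by end_near. Qed.

Lemma phase_const_eq0 (om : R -> C) (x c : C) n : L2 om ->
  (forall N, x = c * cint 0 (2 * pi) (fun t => om t * G n N t)) -> x = 0.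
Proof.
move=> hom hx; apply/eqP; rewrite -normc_eq0 -sqrf_eq0 eq_le sqr_ge0 andbT.
have h N : normc x ^+ 2 <= (normc c ^+ 2 * N2 om) * N2 (G n N).
  rewrite (hx N) normcM exprMn -mulrA; apply: ler_wpM2l; first exact: sqr_ge0.
  exact: cint_normc_L2 hom (G_L2 n N).
have c1 : (normc c ^+ 2 * N2 om) * N2 (G n N) @[N --> \oo] --> (0 : R).
  rewrite -[X in _ --> X](mulr0 (normc c ^+ 2 * N2 om)); apply: cvgM; [exact: cvg_cst|exact: G_cvg].
by apply: (cvgr_to_ge c1); near=> N; exact: h.
Unshelve. all: by end_near. Qed.

(* Once the coefficients of lower index vanish, the n-th coefficient of [f1 g1 - f2 g2] has, for
   every N, the form treated in [phase_const_eq0], because [conj (P1 S1 - P2 S2) * conj E] has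
   no Fourier coefficient of index n >= 1. *)
Lemma phase_rigidity f1 F1 g1 H1 f2 F2 g2 H2
    (p1 : C -> C) (P1 : R -> C) (s1 : C -> C) (S1 : R -> C)
    (p2 : C -> C) (P2 : R -> C) (s2 : C -> C) (S2 : R -> C) (k : C) :
  Hardy f1 F1 -> Hardy g1 H1 -> Hardy f2 F2 -> Hardy g2 H2 ->
  Hardy p1 P1 -> Hardy s1 S1 -> Hardy p2 P2 -> Hardy s2 S2 ->
  f1 0 * g1 0 - f2 0 * g2 0 = 0 ->
  aec (fun t => normc (P1 t) <= 1) -> aec (fun t => normc (P2 t) <= 1) ->
  aec (fun t => F1 t * H1 t - F2 t * H2 t =
    k * cexp (chif (circ t)) * (P1 t * S1 t - P2 t * S2 t)^*) ->
  forall z, normc z < 1 -> f1 z * g1 z - f2 z * g2 z = 0.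
Proof.
move=> hf1 hg1 hf2 hg2 hp1 hs1 hp2 hs2 z0 b1 b2 hae.
have hL2 f F : Hardy f F -> L2 F by case=> _ [].
pose om t := P1 t * S1 t - P2 t * S2 t.
(* A product of two L^2 functions is in general only in L^1; the bounds on P1 and P2 put [om] in
   L^2, where it can be paired with G. *)
have bL F H : L2 F -> L2 H -> aec (fun t => normc (F t) <= 1) -> L2 (fun t => F t * H t).
  move=> lP lS b; apply: (L2_dom_ae _ lS); first exact: cmeasM lP.1 lS.1.
  by apply: aec_imp b => t b; rewrite normcM -[leRHS]mul1r ler_wpM2r ?normc_ge0.
have omL : L2 om.
  apply: L2B; first exact: bL (hL2 _ _ hp1) (hL2 _ _ hs1) b1.
  exact: bL (hL2 _ _ hp2) (hL2 _ _ hs2) b2.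
pose phi z := f1 z * g1 z - f2 z * g2 z.
have h1 : holo (fun z => f1 z * g1 z) := holo_mul hf1.1 hg1.1.
have h2 : holo (fun z => f2 z * g2 z) := holo_mul hf2.1 hg2.1.
have hphi : holo phi.
  by move=> z z1; apply: (@derivableB _ _ _ (fun z => f1 z * g1 z) (fun z => f2 z * g2 z)); [exact: h1|exact: h2].
apply: (tc_eq0 hphi); elim/ltn_ind => -[_|m IH]; first by rewrite tc0.
set n := m.+1 in IH *.
have pin0 := ofR_2pi_neq0 R.
apply: (mulfI pin0); rewrite mulr0.
apply: (@phase_const_eq0 (fun t => (om t)^*) _ (k * cexp c0) n (L2_conj omL)) => N.
pose e z := cexpoly (- Q N) z.
have he : holo e := @holo_cexpoly R (- Q N).
have hE f F : Hardy f F -> Hardy (fun z => e z * f z) (fun t => E N t * F t).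
  by apply: (@Hardy_cts_mul R e f F he) => t; exact/derivable_continuous/derivable_cexpoly.
have iM (c : R -> C) F H : cts_on 0 (2 * pi) c -> L2 F -> L2 H -> (forall t, normc (c t) <= 1) ->
    cintegrable 0 (2 * pi) (fun t => F t * H t * c t).
  move=> cq lF lH q1; have [lq _] := L2_bounded_mul (cts_cmeas cq) (fun t _ => q1 t) lH.
  have := L2M_integrable lF lq; congr cintegrable.
  by apply/funext => t; ring.
have circL : L2 (fun t => E N t * circ (n%:R * t)).
  by apply/cts_L2/cts_onM; [exact: E_cts|exact: circnat_cts].
have iO : cintegrable 0 (2 * pi) (fun t => om t * (E N t * circ (n%:R * t))).
  exact: L2M_integrable omL circL.
have iG : cintegrable 0 (2 * pi) (fun t => (om t)^* * G n N t).
  exact: L2M_integrable (L2_conj omL) (G_L2 n N).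
pose A t := F1 t * (E N t * H1 t) * circ (- (n%:R * t)) - F2 t * (E N t * H2 t) * circ (- (n%:R * t)).
have iA f F g H : Hardy f F -> Hardy g H -> cintegrable 0 (2 * pi) (fun t => F t * (E N t * H t) * circ (- (n%:R * t))).
  move=> /hL2 lF /hE /hL2 lH; apply: iM => //; first exact: circnatN_cts.
  by move=> t; rewrite normc_circ.
have cA : cint 0 (2 * pi) A = ofR (2 * pi) * tc phi n.
  rewrite /A cintB; [|exact: iA hf1 hg1|exact: iA hf2 hg2].
  rewrite (Hardy_mul_coef n hf1 (hE _ _ hg1)) (Hardy_mul_coef n hf2 (hE _ _ hg2)) -mulrBr; congr (_ * _).
  rewrite -(tcB n (holo_mul hf1.1 (hE _ _ hg1).1) (holo_mul hf2.1 (hE _ _ hg2).1)).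
  rewrite (@eq_tc_disc _ _ (fun z => phi z * e z)); last by move=> z _; rewrite /phi; ring.
  (* The lower coefficients of phi vanish and e has the value 1 at 0, so multiplying by e does not
     change the n-th coefficient. *)
  rewrite (tcM n hphi he) big_ord_recr /= subnn big1 ?add0r; last first.
    by move=> j _; rewrite IH// mul0r.
  by rewrite (tc0 he) /e /cexpoly horner_coef0 coefN coef_poly /= oppr0 cexp0 mulr1.
have cB : cint 0 (2 * pi) (fun t => (om t * (E N t * circ (n%:R * t)))^*) = 0.
  rewrite (cint_conj iO).
  have -> : (fun t => om t * (E N t * circ (n%:R * t))) = (fun t =>
      P1 t * (E N t * S1 t) * circ (n%:R * t) - P2 t * (E N t * S2 t) * circ (n%:R * t)).
    by apply/funext => t; rewrite /om; ring.
  have iP f F g H : Hardy f F -> Hardy g H ->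
      cintegrable 0 (2 * pi) (fun t => F t * (E N t * H t) * circ (n%:R * t)).
    move=> /hL2 lF /hE /hL2 lH; apply: iM => //; first exact: circnat_cts.
    by move=> t; rewrite normc_circ.
  rewrite cintB; [|exact: iP hp1 hs1|exact: iP hp2 hs2].
  by rewrite (Hardy_mul_coef_neg hp1 (hE _ _ hs1))// (Hardy_mul_coef_neg hp2 (hE _ _ hs2))// subr0 conjC0.
rewrite -cA.
(* The two terms come from e^(i rho) = 1 + (e^(i rho) - 1) in [E_phase]: the first is conjugate to
   an analytic function, the second is small. *)
pose B t := k * cexp c0 * ((om t * (E N t * circ (n%:R * t)))^* + (om t)^* * G n N t).
transitivity (cint 0 (2 * pi) B).
  apply: eq_cint_aec.
  - have cm f F g H : Hardy f F -> Hardy g H -> cmeas (fun t => F t * (E N t * H t) * circ (- (n%:R * t))).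
      move=> /hL2 lF /hE /hL2 lH; apply: cmeasM; first exact: cmeasM lF.1 lH.1.
      by apply: cts_cmeas; exact: circnatN_cts.
    by apply: cmeasB; [exact: cm hf1 hg1|exact: cm hf2 hg2].
  - apply: cmeasM; first by apply: cts_cmeas; exact: cts_cst.
    apply: cmeasD; first exact: cmeas_conj (cmeasM omL.1 circL.1).
    exact: cmeasM (L2_conj omL).1 (G_L2 n N).1.
  
  apply: aec_imp hae => t ht; rewrite /A /B.
  have -> : F1 t * (E N t * H1 t) * circ (- (n%:R * t)) - F2 t * (E N t * H2 t) * circ (- (n%:R * t)) =
    circ (- (n%:R * t)) * E N t * (F1 t * H1 t - F2 t * H2 t) by ring.
  rewrite ht -/(om t).
  have -> : circ (- (n%:R * t)) * E N t * (k * cexp (chif (circ t)) * (om t)^*) =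
    circ (- (n%:R * t)) * k * (om t)^* * (E N t * cexp (chif (circ t))) by ring.
  rewrite E_phase /G !rmorphM /= -circN; ring.
have iC := cintegrable_conj iO.
by rewrite /B (cintZ _ (cintegrableD iC iG)) (cintD iC iG) cB add0r.
Qed.

End FourierPhase.
End PhaseRigidity.

(** * Passing algebraic relations to boundary values *)

Section Boundary.
Local Open Scope classical_set_scope.
Local Open Scope ring_scope.
Variable R : realType.
Local Notation C := (Cplx R).
Local Notation normc := (@Normc.normc R).
Implicit Types (f h : C -> C) (z w : C).

Lemma mero_eqP f1 h1 f2 h2 : holo f1 -> holo h1 -> holo f2 -> holo h2 ->
  h1 0 != 0 -> h2 0 != 0 ->
  (forall z, normc z < 1 -> f1 z * h2 z = f2 z * h1 z) -> mero_eq f1 h1 f2 h2.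
Proof.
move=> hf1 hh1 hf2 hh2 n1 n2 e; have z1 : `|0 : C| < 1 by rewrite normr0 ltr01.
split; [by split => //; exists 0|by split => //; exists 0|].
by move=> z; rewrite lt_normc1 => zl d1 d2; apply/eqP; rewrite eqr_div// e.
Qed.

Lemma L2c_uniq (f : nat -> R -> C) (F G : R -> C) : L2c f F -> L2c f G -> aec (fun t => F t = G t).
Proof.
move=> fF fG; have one : L2c (fun=> (fun=> 1 : C)) (fun=> 1).
  by apply: L2c_cst; apply: cts_L2; exact: cts_cst.
have := aec_quadratic fF one fG one (c := 0) (fun n t => _); move=> h.
apply: aec_imp (h _); last by move=> n t; rewrite subrr.
by move=> t; rewrite !mulr1 => /eqP; rewrite subr_eq0 => /eqP.
Qed.

Lemma det_boundary (u ub : C -> 'M[C]_2) : holo_G u -> boundary_value_mx u ub ->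
  aec (fun t => \det (ub (circ t)) = 1).
Proof.
move=> [hu du] bu; have hb i j := (boundary_Hardy (hu i j) (bu i j)).2.
apply: aec_imp (aec_quadratic (hb 0 0) (hb 1 1) (hb 0 1) (hb 1 0) (c := 1) _).
  by move=> t; rewrite det2E.
move=> n t; rewrite -det2E du// lt_normc1 normc_rcirc; have /andP[a b] := rn01 R n => //.
exact: ltW.
Qed.

Lemma star_Hardy (l : sphere R -> 'M[C]_2) lb i j : holo_ext_G l -> boundary_value_ext_mx l lb ->
  Hardy (star (fun p => l p i j)) (fun t => (lb (circ t) i j)^*).
Proof. by move=> [hl _] bl; apply: boundary_ext_Hardy (bl i j); exact: star_holo. Qed.

Lemma det_boundary_ext (l : sphere R -> 'M[C]_2) lb : holo_ext_G l -> boundary_value_ext_mx l lb ->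
  aec (fun t => \det (lb (circ t)) = 1).
Proof.
move=> hl bl; have hb i j := (star_Hardy i j hl bl).2.
apply: aec_imp (aec_quadratic (hb 0 0) (hb 1 1) (hb 0 1) (hb 1 0) (c := 1) _).
  move=> t; rewrite -!rmorphM -rmorphB -det2E /= => /(congr1 Num.conj).
  by rewrite conjCK conjC1.
move=> n t; rewrite /star -!rmorphM -rmorphB /= -det2E hl.2 ?conjC1//.
rewrite lt_normc1 normc_conj normc_rcirc; have /andP[a b] := rn01 R n => //.
exact: ltW.
Qed.

Lemma boundary_ext_const (f : sphere R -> C) fb c : (forall p, f p = c) ->
  boundary_value_ext f fb -> aec (fun t => fb (circ t) = c).
Proof.
move=> fc bf; have fE : star f = fun=> c^* by apply/funext => z; rewrite /star fc.
have hs : holo (star f) by rewrite fE; exact: holo_cst.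
have [_ h] := boundary_ext_Hardy hs bf.
have h' : L2c (fun=> (fun=> c^*)) (fun t => (fb (circ t))^*) by rewrite fE in h.
by apply: aec_imp (aec_L2c_cst h') => t /(congr1 Num.conj); rewrite !conjCK.
Qed.

Lemma L2c_opp (f : nat -> R -> C) (F : R -> C) : L2c f F -> L2c (fun n t => - f n t) (fun t => - F t).
Proof.
move=> [h1 h2 h3]; split.
- by move=> n; exact: L2N.
- exact: L2N.
suff -> : (fun n => N2 (fun t => - f n t - - F t)) = (fun n => N2 (fun t => f n t - F t)) by [].
by apply/funext => n; apply: eq_Rintegral => t _; rewrite -opprD abs2N.
Qed.

(** The linear relations follow from uniqueness of L^2 limits, up to null sets; the determinant is
    quadratic and passes to the limit in L^1. *)
Lemma limit_su2 (p : nat -> C -> 'M[C]_2) (K : C -> 'M[C]_2) : (forall i j, L2_cvg (fun n z => p n z i j) (fun z => K z i j)) ->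
  (forall n t, su2_form (p n (circ t))) -> aec (fun t => su2_form (K (circ t))).
Proof.
move=> hp hs; have h i j := L2_cvgP (hp i j).
have e1 : aec (fun t => K (circ t) 1 1 = (K (circ t) 0 0)^*).
  apply: (L2c_uniq (h 1 1)); have := L2c_conj (h 0 0).
  by congr L2c; apply/funext => n; apply/funext => t; have [-> _ _] := hs n t.
have e2 : aec (fun t => K (circ t) 0 1 = (- K (circ t) 1 0)^*).
  apply: (L2c_uniq (h 0 1)); have := L2c_conj (L2c_opp (h 1 0)).
  congr L2c; apply/funext => n; apply/funext => t; have [_ -> _] := hs n t.
  by rewrite opprK conjCK.
have e3 := aec_quadratic (h 0 0) (h 1 1) (h 0 1) (h 1 0) (c := 1).
have {}e3 := e3 (fun n t => etrans (esym (det2E _)) (let: And3 _ _ d := hs n t in d)).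
apply: aec_imp (aec_and (aec_and e1 e2) e3) => t [[k1 k2] k3]; split => //; last by rewrite det2E.
by rewrite k2 conjCK opprK.
Qed.

End Boundary.

(** * Algebra of the factorizations at a point of the circle *)

Section Factorizations.
Local Open Scope classical_set_scope.
Local Open Scope ring_scope.
Variable R : realType.
Local Notation C := (Cplx R).
Local Notation normc := (@Normc.normc R).
Implicit Types (l u K : 'M[C]_2) (m : C).

Lemma mul_diag l m a i j : (l *m mx2 m 0 0 a) i j = l i j * (if j == 0 then m else a).
Proof.
rewrite mulmx2E !mxE /=; have [->|j1] := eqVneq j 0; first by rewrite /= mulr0 addr0.
have -> : j = 1 by case: j j1 => [[|[|//]] //= ? _]; apply: val_inj.
by rewrite /= mulr0 add0r.
Qed.

Lemma triangular_entry l m a u i j :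
  (l *m mx2 m 0 0 m^-1 *m mx2 a 0 0 a^-1 *m u) i j =
  m * a * (l i 0 * u 0 j) + (m * a)^-1 * (l i 1 * u 1 j).
Proof. by rewrite mulmx2E !mul_diag /= invfM; ring. Qed.

Lemma adjointE K i j : adjoint K i j = (K j i)^*.
Proof. by rewrite !mxE. Qed.

(** Multiplying by K1 leaves diag(e, e') K2 on one side; its second row is X times the first row of
    u plus Y times the second. Taking the determinant with the second row of u removes Y and leaves
    X times det u = 1. *)
Lemma root_relation K1 K2 l u m a e e' : su2_form K1 -> \det u = 1 -> e * e' = 1 -> m * a != 0 ->
  l *m mx2 m 0 0 m^-1 *m mx2 a 0 0 a^-1 *m u = adjoint K1 *m mx2 e 0 0 e' *m K2 ->
  u 1 0 * K2 1 1 - u 1 1 * K2 1 0 = m * a * e * (K1 0 1 * (l 0 0)^* - K1 0 0 * (l 1 0)^*)^*.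
Proof.
move=> [k11 k10 dK] du ee' ma0 rel.
have nK : K1 0 0 * (K1 0 0)^* + K1 0 1 * (K1 0 1)^* = 1.
  by rewrite -dK det2E k11 k10; ring.
pose X := m * a * ((K1 0 0)^* * l 1 0 - (K1 0 1)^* * l 0 0).
pose Y := (m * a)^-1 * ((K1 0 0)^* * l 1 1 - (K1 0 1)^* * l 0 1).
have row j : e' * K2 1 j = X * u 0 j + Y * u 1 j.
  have r i : m * a * (l i 0 * u 0 j) + (m * a)^-1 * (l i 1 * u 1 j) =
      (K1 0 i)^* * e * K2 0 j + (K1 1 i)^* * e' * K2 1 j.
    by rewrite -triangular_entry rel mulmx2E !mul_diag !adjointE.
  have r0 := r 0; have r1 := r 1.
  rewrite k10 rmorphN /= conjCK in r0; rewrite k11 conjCK in r1.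
  have -> : e' * K2 1 j = (K1 0 0)^* * ((K1 0 1)^* * e * K2 0 j + K1 0 0 * e' * K2 1 j)
     - (K1 0 1)^* * ((K1 0 0)^* * e * K2 0 j + - K1 0 1 * e' * K2 1 j).
    by rewrite -[LHS]mul1r -nK; ring.
  by rewrite -r0 -r1 /X /Y; ring.
have row' j : K2 1 j = e * (X * u 0 j + Y * u 1 j) by rewrite -row mulrA ee' mul1r.
rewrite !row' rmorphB !rmorphM /= !conjCK.
have -> : u 1 0 * (e * (X * u 0 1 + Y * u 1 1)) - u 1 1 * (e * (X * u 0 0 + Y * u 1 0)) =
  - e * X * (u 0 0 * u 1 1 - u 0 1 * u 1 0) by ring.
by rewrite -det2E du /X; ring.
Qed.

(** The same device with the inverse of l: the second row of u is a combination of the rows of gp,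
    and the determinant with the second row of gp keeps only the first coefficient. The left side is
    made of factors holomorphic inside, the right side of constants and factors holomorphic
    outside. *)
Lemma birkhoff_relation l u m a (gm g0 gp : 'M[C]_2) : \det l = 1 -> \det gp = 1 -> m * a != 0 ->
  l *m mx2 m 0 0 m^-1 *m mx2 a 0 0 a^-1 *m u = gm *m g0 *m gp ->
  u 1 0 * gp 1 1 - u 1 1 * gp 1 0 = m * a *
    (l 0 0 * (gm 1 0 * g0 0 0 + gm 1 1 * g0 1 0) - l 1 0 * (gm 0 0 * g0 0 0 + gm 0 1 * g0 1 0)).
Proof.
move=> dl dgp ma0 rel.
pose X := l 0 0 * (gm 1 0 * g0 0 0 + gm 1 1 * g0 1 0) - l 1 0 * (gm 0 0 * g0 0 0 + gm 0 1 * g0 1 0).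
pose Y := l 0 0 * (gm 1 0 * g0 0 1 + gm 1 1 * g0 1 1) - l 1 0 * (gm 0 0 * g0 0 1 + gm 0 1 * g0 1 1).
have row j : u 1 j = m * a * (X * gp 0 j + Y * gp 1 j).
  have r i : m * a * (l i 0 * u 0 j) + (m * a)^-1 * (l i 1 * u 1 j) =
      (gm i 0 * g0 0 0 + gm i 1 * g0 1 0) * gp 0 j + (gm i 0 * g0 0 1 + gm i 1 * g0 1 1) * gp 1 j.
    by rewrite -triangular_entry rel !mulmx2E.
  have h : (m * a)^-1 * u 1 j = X * gp 0 j + Y * gp 1 j.
    have -> : X * gp 0 j + Y * gp 1 j = l 0 0 * ((gm 1 0 * g0 0 0 + gm 1 1 * g0 1 0) * gp 0 j +
       (gm 1 0 * g0 0 1 + gm 1 1 * g0 1 1) * gp 1 j) - l 1 0 * ((gm 0 0 * g0 0 0 + gm 0 1 * g0 1 0) * gp 0 j +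
       (gm 0 0 * g0 0 1 + gm 0 1 * g0 1 1) * gp 1 j) by rewrite /X /Y; ring.
    by rewrite -!r -[LHS]mul1r -dl det2E; ring.
  by rewrite -h mulrA divff// mul1r.
rewrite !row -/X.
have -> : m * a * (X * gp 0 0 + Y * gp 1 0) * gp 1 1 - m * a * (X * gp 0 1 + Y * gp 1 1) * gp 1 0 =
   m * a * X * (gp 0 0 * gp 1 1 - gp 0 1 * gp 1 0) by ring.
by rewrite -det2E dgp mulr1.
Qed.
End Factorizations.

(** * The identities between the quotients *)

Section Main.
Local Open Scope classical_set_scope.
Local Open Scope ring_scope.
Variable R : realType.
Local Notation C := (Cplx R).
Local Notation normc := (@Normc.normc R).
Implicit Types (f : C -> C) (z : C).

Lemma cintegrableB (a b : R) (F G : R -> C) : cintegrable a b F -> cintegrable a b G ->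
  cintegrable a b (fun t => F t - G t).
Proof. by move=> hF hG; exact: cintegrableD hF (cintegrableN hG). Qed.

Lemma cintegrable_mul_circ (F H : R -> C) n : L2 F -> L2 H ->
  cintegrable 0 (2 * pi) (fun t => F t * H t * circ (- (n%:R * t))).
Proof.
move=> lF lH.
have [|lq _] := @L2_bounded_mul R (fun t => circ (- (n%:R * t))) H 1
  (cts_cmeas (@circnatN_cts R n 0 (2 * pi))) _ lH; first by move=> t _; rewrite normc_circ.
have := L2M_integrable lF lq; congr cintegrable.
by apply/funext => t; ring.
Qed.

Lemma Hardy_scale (k : C) f F : Hardy f F -> Hardy (fun z => k * f z) (fun t => k * F t).
Proof.
by apply: (@Hardy_cts_mul R (fun=> k)); [exact: holo_cst|move=> t; exact: cst_continuous].
Qed.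

(** The relevant row of the exterior factor is constant, (1, 0) for k_1 and (0, 1) for k_2, so that
    row of K is the boundary value of a row of the interior factor, up to a constant. *)
Lemma triangular_row (K : C -> 'M[C]_2) l a0 u i (c0 c1 : C) :
  triangular_factorization K l 1 a0 u -> (forall p, l p i 0 = c0) -> (forall p, l p i 1 = c1) ->
  exists ub, (forall i j, Hardy (fun z => u z i j) (fun t => ub (circ t) i j)) /\
    forall j, aec (fun t => K (circ t) i j =
      ofR a0 * (c0 * ub (circ t) 0 j) + (ofR a0)^-1 * (c1 * ub (circ t) 1 j)).
Proof.
move=> [_ _ _ [[hu _] _] [lb [ub [bl bu rel]]]] l0 l1; exists ub; split=> [i' j|j].
  exact: boundary_Hardy (hu i' j) (bu i' j).
have e0 := boundary_ext_const l0 (bl i 0); have e1 := boundary_ext_const l1 (bl i 1).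
apply: aec_imp (aec_and (aec_and e0 e1) rel) => t [[h0 h1] ->].
by rewrite triangular_entry h0 h1 mul1r.
Qed.

Lemma k1_row K y a1 u1 f j : k1_triangular K y a1 u1 -> holo_extension (fun z => K z 0 j) f ->
  forall z, normc z < 1 -> f z = ofR a1 * u1 z 0 j.
Proof.
move=> [_ tri] [hf bf]; have [||ub [hub row]] := triangular_row (i := 0) (c0 := 1) (c1 := 0) tri.
- by move=> p; rewrite mxE.
- by move=> p; rewrite mxE.
apply: (Hardy_eq (boundary_Hardy hf bf) (Hardy_scale (ofR a1) (hub 0 j))).
by apply: aec_imp (row j) => t ->; rewrite mul1r mul0r mulr0 addr0.
Qed.

Lemma k2_row K x a2 u2 f j : k2_triangular K x a2 u2 -> holo_extension (fun z => K z 1 j) f ->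
  forall z, normc z < 1 -> f z = (ofR a2)^-1 * u2 z 1 j.
Proof.
move=> [_ _ tri] [hf bf]; have [||ub [hub row]] := triangular_row (i := 1) (c0 := 0) (c1 := 1) tri.
- by move=> p; rewrite mxE.
- by move=> p; rewrite mxE.
apply: (Hardy_eq (boundary_Hardy hf bf) (Hardy_scale (ofR a2)^-1 (hub 1 j))).
by apply: aec_imp (row j) => t ->; rewrite mul1r mul0r mulr0 add0r.
Qed.

Lemma su2_form_row_le (K : 'M[C]_2) : su2_form K -> normc (K 0 0) <= 1 /\ normc (K 0 1) <= 1.
Proof.
move=> [k11 k10 dK].
have : abs2 (K 0 0) + abs2 (K 0 1) = 1.
  have : ofR (abs2 (K 0 0) + abs2 (K 0 1)) = ofR 1 :> C.
    rewrite ofRD -!mul_conjE ofR1 -dK det2E k11 k10; ring.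
  by move=> /(congr1 (@complex.Re R)).
have := normc_ge0 (K 0 0); have := normc_ge0 (K 0 1); rewrite !abs2E.
move: (normc (K 0 0)) (normc (K 0 1)) => p q; nra.
Qed.

Lemma cexpN z : cexp z * cexp (- z) = 1.
Proof. by rewrite -cexpD subrr cexp0. Qed.

Lemma unit_neq0 (m0 : C) (a0 : R) : `|m0| = 1 -> 0 < a0 -> m0 * ofR a0 != 0.
Proof.
move=> m1 a0p; have m00 : m0 != 0 by rewrite -normr_gt0 m1 ltr01.
by rewrite mulf_neq0// ofR_eq0 gt_eqF.
Qed.

(** By [birkhoff_relation] the boundary value extends to both discs, so all coefficients of positive
    index vanish. The constant one vanishes because u and gp are upper triangular at 0. *)
Lemma birkhoff_row (g : C -> 'M[C]_2) l m0 a0 u gm g0 gp :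
  triangular_factorization g l m0 a0 u -> riemann_hilbert_factorization g gm g0 gp ->
  forall z, normc z < 1 -> u z 1 0 * gp z 1 1 - u z 1 1 * gp z 1 0 = 0.
Proof.
move=> [[hl _] m1 a0p [hu u0] [lb [ub [bl bu rel]]]] [[hgm _] _ [hgp gp0] [gmb [gpb [bgm bgp rel']]]].
have ma0 := unit_neq0 m1 a0p.
have uH i j := boundary_Hardy (hu.1 i j) (bu i j).
have gH i j := boundary_Hardy (hgp.1 i j) (bgp i j).
have lH i j := star_Hardy i j hl bl; have gmH i j := star_Hardy i j hgm bgm.
have hL2 f F : Hardy f F -> L2 F by case=> _ [].
pose h z := u z 1 0 * gp z 1 1 - u z 1 1 * gp z 1 0.
have h1 : holo (fun z => u z 1 0 * gp z 1 1) := holo_mul (uH 1 0).1 (gH 1 1).1.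
have h2 : holo (fun z => u z 1 1 * gp z 1 0) := holo_mul (uH 1 1).1 (gH 1 0).1.
have hh : holo h.
  by move=> z z1; apply: (@derivableB _ _ _ (fun z => u z 1 0 * gp z 1 1) (fun z => u z 1 1 * gp z 1 0));
    [exact: h1|exact: h2].
apply: (tc_eq0 hh) => n; case: n => [|n].
  by rewrite tc0// /h u0 gp0 !mxE /= mul0r mulr0 subrr.
have pin0 := ofR_2pi_neq0 R.
apply: (mulfI pin0); rewrite mulr0.
rewrite /h (tcB n.+1 h1 h2) mulrBr -(Hardy_mul_coef n.+1 (uH 1 0) (gH 1 1)) -(Hardy_mul_coef n.+1 (uH 1 1) (gH 1 0)).
have cI (F H : R -> C) (lF : L2 F) (lK : L2 H) := cintegrable_mul_circ n.+1 lF lK.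
have lL i j : L2 (fun t => lb (circ t) i j).
  by have := L2_conj (hL2 _ _ (lH i j)); congr L2; apply/funext => t; rewrite conjCK.
have gmL i j : L2 (fun t => gmb (circ t) i j).
  by have := L2_conj (hL2 _ _ (gmH i j)); congr L2; apply/funext => t; rewrite conjCK.
pose w i j k t : C := lb (circ t) i 0 * gmb (circ t) j k * circ (- (n.+1%:R * t)).
have wI i j k : cintegrable 0 (2 * pi) (w i j k) by exact: cI (lL i 0) (gmL j k).
have w0 i j k : cint 0 (2 * pi) (w i j k) = 0.
  apply: (can_inj (@conjCK C)); rewrite conjC0 -cint_conj//.
  rewrite -(Hardy_mul_coef_neg (lH i 0) (gmH j k) (ltn0Sn n)).
  by apply: eq_cint => t _; rewrite /w !rmorphM /= circN conjCK.
have dl := det_boundary_ext hl bl; have dgp := det_boundary hgp bgp.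
have i1 := cI _ _ (hL2 _ _ (uH 1 0)) (hL2 _ _ (gH 1 1)).
have i2 := cI _ _ (hL2 _ _ (uH 1 1)) (hL2 _ _ (gH 1 0)).
rewrite -(cintB i1 i2).
pose T t : C := m0 * ofR a0 * (g0 0 0 * w 0 1 0 t + g0 1 0 * w 0 1 1 t
   - (g0 0 0 * w 1 0 0 t + g0 1 0 * w 1 0 1 t)).
have wZ c i j k := cintegrableZ c (wI i j k).
have wD c i j k c' i' j' k' := cintegrableD (wZ c i j k) (wZ c' i' j' k').
transitivity (cint 0 (2 * pi) T).
  have cm (F H : R -> C) : L2 F -> L2 H -> cmeas (fun t => F t * H t * circ (- (n.+1%:R * t))).
    move=> lF lH'; apply: cmeasM (cmeasM lF.1 lH'.1) _.
    by apply: cts_cmeas; exact: circnatN_cts.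
  have wm i j k : cmeas (w i j k) by exact: cm (lL i 0) (gmL j k).
  have cc (c : C) : cmeas (fun=> c : C) by apply: cts_cmeas; exact: cts_cst.
  apply: eq_cint_aec.
  - by apply: cmeasB; [exact: cm (hL2 _ _ (uH 1 0)) (hL2 _ _ (gH 1 1))|exact: cm (hL2 _ _ (uH 1 1)) (hL2 _ _ (gH 1 0))].
  - have mz (c : C) i j k : cmeas (fun t => c * w i j k t) by exact: cmeasM (cc c) (wm i j k).
    exact: cmeasM (cc (m0 * ofR a0)) (cmeasB (cmeasD (mz (g0 0 0) 0 1 0) (mz (g0 1 0) 0 1 1))
      (cmeasD (mz (g0 0 0) 1 0 0) (mz (g0 1 0) 1 0 1))).
  apply: aec_imp (aec_and (aec_and dl dgp) (aec_and rel rel')) => t [[d1 d2] [r1 r2]].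
  have := birkhoff_relation d1 d2 ma0 (etrans (esym r1) r2) => e.
  rewrite -mulrBl e /T /w; ring.
rewrite /T (cintZ _ (cintegrableB (wD _ _ _ _ _ _ _ _) (wD _ _ _ _ _ _ _ _))).
rewrite (cintB (wD _ _ _ _ _ _ _ _) (wD _ _ _ _ _ _ _ _)) !(cintD (wZ _ _ _ _) (wZ _ _ _ _)).
by rewrite !(cintZ _ (wI _ _ _)) !w0 !mulr0 addr0 subrr mulr0.
Qed.

(** The first identity is [phase_rigidity]. It makes the left side of the root relation vanish
    almost everywhere on the circle; since m_0 a_0 e^chi is never 0, so does the other factor, whose
    two products are boundary values of holomorphic functions and hence agree in the disc. *)
Lemma root_row (g : C -> 'M[C]_2) l m0 a0 u eta chi zeta K1 K2 a b c d :
  triangular_factorization g l m0 a0 u -> root_subgroup_factorization g eta chi zeta K1 K2 ->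
  holo_extension (fun z => K1 z 0 0) a -> holo_extension (fun z => K1 z 0 1) b ->
  holo_extension (fun z => K2 z 1 0) c -> holo_extension (fun z => K2 z 1 1) d -> c 0 = 0 ->
  forall z, normc z < 1 ->
    u z 1 0 * d z - u z 1 1 * c z = 0 /\
    b z * star (fun p => l p 0 0) z = a z * star (fun p => l p 1 0) z.
Proof.
move=> [[hl _] m1 a0p [hu u0] [lb [ub [bl bu rel]]]].
move=> [[_ k1] chiw [_ k2] [chif [chic chii rel']]] [ha ba] [hb bb] [hc bc] [hd bd] c0.
have ma0 := unit_neq0 m1 a0p.
have uH i j := boundary_Hardy (hu.1 i j) (bu i j).
have lH i j := star_Hardy i j hl bl.
have aH := boundary_Hardy ha ba; have bH := boundary_Hardy hb bb.
have cH := boundary_Hardy hc bc; have dH := boundary_Hardy hd bd.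
have s1 := limit_su2 k1 (k1_partial_su2 eta).
have hae : aec (fun t => ub (circ t) 1 0 * K2 (circ t) 1 1 - ub (circ t) 1 1 * K2 (circ t) 1 0 =
    m0 * ofR a0 * cexp (chif (circ t)) *
    (K1 (circ t) 0 1 * (lb (circ t) 0 0)^* - K1 (circ t) 0 0 * (lb (circ t) 1 0)^*)^*).
  apply: aec_imp (aec_and (aec_and s1 (det_boundary hu bu)) (aec_and rel rel')) => t [[h1 h2] [r1 r2]].
  exact: (root_relation h1 h2 (cexpN (chif (circ t))) ma0 (etrans (esym r1) r2)).
have b1 : aec (fun t => normc (K1 (circ t) 0 1) <= 1) by apply: aec_imp s1 => t /su2_form_row_le[].
have b0 : aec (fun t => normc (K1 (circ t) 0 0) <= 1) by apply: aec_imp s1 => t /su2_form_row_le[].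
have phi0 : forall z, normc z < 1 -> u z 1 0 * d z - u z 1 1 * c z = 0.
  apply: (phase_rigidity chiw chic chii (uH 1 0) dH (uH 1 1) cH bH (lH 0 0) aH (lH 1 0) _ b1 b0 hae).
  by rewrite c0 mulr0 u0 !mxE /= mul0r subr0.
move=> z zl; split; first exact: phi0.
have Phi0 : aec (fun t => ub (circ t) 1 0 * K2 (circ t) 1 1 - ub (circ t) 1 1 * K2 (circ t) 1 0 = 0).
  apply: (aec_quadratic (uH 1 0).2 dH.2 (uH 1 1).2 cH.2) => n t; apply: phi0.
  by rewrite normc_rcirc; have /andP[r0 r1] := rn01 R n => //; exact: ltW.
have om0 : aec (fun t => K1 (circ t) 0 1 * (lb (circ t) 0 0)^* = K1 (circ t) 0 0 * (lb (circ t) 1 0)^*).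
  apply: aec_imp (aec_and hae Phi0) => t [-> /eqP].
  by rewrite mulf_eq0 (negbTE (mulf_neq0 ma0 (cexp_neq0 _))) /= conjC_eq0 subr_eq0 => /eqP.
have hL2 f F : Hardy f F -> L2 F by case=> _ [].
apply: (eq_tc (holo_mul hb (lH 0 0).1) (holo_mul ha (lH 1 0).1)) zl => n.
apply: (mulfI (ofR_2pi_neq0 R)).
rewrite -(Hardy_mul_coef n bH (lH 0 0)) -(Hardy_mul_coef n aH (lH 1 0)).
have cm (F H : R -> C) : L2 F -> L2 H -> cmeas (fun t => F t * H t * circ (- (n%:R * t))).
  move=> lF lK; apply: cmeasM (cmeasM lF.1 lK.1) _.
  by apply: cts_cmeas; exact: circnatN_cts.
apply: eq_cint_aec; first exact: cm (hL2 _ _ bH) (hL2 _ _ (lH 0 0)).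
  exact: cm (hL2 _ _ aH) (hL2 _ _ (lH 1 0)).
by apply: aec_imp om0 => t ->.
Qed.
End Main.

Local Open Scope ring_scope.

Theorem theorem2p1 (R : realType)
  (g : Cplx R -> 'M[Cplx R]_2)
  (l : sphere R -> 'M[Cplx R]_2) (m0 : Cplx R) (a0 : R)
  (u : Cplx R -> 'M[Cplx R]_2)
  (gm : sphere R -> 'M[Cplx R]_2) (g0 : 'M[Cplx R]_2)
  (gp : Cplx R -> 'M[Cplx R]_2)
  (eta : nat -> Cplx R) (chi : int -> Cplx R) (zeta : nat -> Cplx R)
  (K1 K2 : Cplx R -> 'M[Cplx R]_2)
  (y : Cplx R -> Cplx R) (a1 : R) (u1 : Cplx R -> 'M[Cplx R]_2)
  (x : Cplx R -> Cplx R) (a2 : R) (u2 : Cplx R -> 'M[Cplx R]_2)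
  (a b c d : Cplx R -> Cplx R)
  (g_SU2 : forall t : R, is_SU2 (g (circ t)))
  (g_W12 : forall i j, in_W12 (fun z => g z i j))
  (g_tri : triangular_factorization g l m0 a0 u)
  (g_RH : riemann_hilbert_factorization g gm g0 gp)
  (g_root : root_subgroup_factorization g eta chi zeta K1 K2)
  (K1_tri : k1_triangular K1 y a1 u1)
  (K2_tri : k2_triangular K2 x a2 u2)
  (a_ext : holo_extension (fun z => K1 z 0 0) a)
  (b_ext : holo_extension (fun z => K1 z 0 1) b)
  (c_ext : holo_extension (fun z => K2 z 1 0) c)
  (d_ext : holo_extension (fun z => K2 z 1 1) d) :
  let alpha1 := fun z => u1 z 0 0 in
  let beta1 := fun z => u1 z 0 1 in
  let gamma2 := fun z => u2 z 1 0 in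
  let delta2 := fun z => u2 z 1 1 in
  [/\ mero_eq b a beta1 alpha1,
      mero_eq beta1 alpha1
        (star (fun p => l p 1 0)) (star (fun p => l p 0 0)),
      taylor_quot b a 0 (taylor_coef 0 eta) &
      forall n : nat, leading_form R 0 n]
  /\
  [/\ mero_eq c d gamma2 delta2,
      mero_eq gamma2 delta2 (fun z => u z 1 0) (fun z => u z 1 1),
      mero_eq (fun z => u z 1 0) (fun z => u z 1 1)
        (fun z => gp z 1 0) (fun z => gp z 1 1),
      taylor_quot c d 1 (taylor_coef 1 zeta) &
      forall n : nat, (1 <= n)%N -> leading_form R 1 n].
Proof.
move=> /=; pose al z := u1 z 0 0; pose be z := u1 z 0 1.
have [hy T1] := K1_tri; have [hx x0 T2] := K2_tri.
have [_ _ a1p [hu1 u10] _] := T1; have [_ _ a2p [hu2 u20] _] := T2.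
have [[hl l0] _ _ [hu u0] _] := g_tri.
have [[_ _] _ [hgp gp0] _] := g_RH.
have [[_ k1] _ [_ k2] _] := g_root.
have aE := k1_row K1_tri a_ext; have bE := k1_row K1_tri b_ext.
have cE := k2_row K2_tri c_ext; have dE := k2_row K2_tri d_ext.
have z0 : Normc.normc (0 : Cplx R) < 1 by rewrite normc0 ltr01.
have n1 : ofR a1 != 0 by rewrite ofR_eq0 gt_eqF.
have n2 : (ofR a2)^-1 != 0 by rewrite invr_eq0 ofR_eq0 gt_eqF.
(* The normalisations at 0 give a 0 = a1 and d 0 = 1 / a2, and the other denominators have the value
   1 there. So no denominator vanishes identically, and c 0 = 0. *)
have A0 : a 0 != 0 by rewrite aE// u10 !mxE /= mulr1.
have D0 : d 0 != 0 by rewrite dE// u20 !mxE /= mulr1.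
have C0 : c 0 = 0 by rewrite cE// u20 !mxE /= mulr0.
have U0 : u1 0 0 0 != 0 by rewrite u10 !mxE oner_eq0.
have V0 : u2 0 1 1 != 0 by rewrite u20 !mxE oner_eq0.
have W0 : u 0 1 1 != 0 by rewrite u0 !mxE oner_eq0.
have G0 : gp 0 1 1 != 0 by rewrite gp0 !mxE oner_eq0.
have S0 : star (fun p => l p 0 0) 0 != 0.
  by rewrite /star conjC0 /sphere_inv eqxx l0 !mxE /= conjC1 oner_eq0.
have hs i j := @star_holo R (fun p => l p i j) (hl.1 i j).
have root := root_row g_tri g_root a_ext b_ext c_ext d_ext C0.
split; split.
- apply: (mero_eqP b_ext.1 a_ext.1 (hu1.1 0 1) (hu1.1 0 0) A0 U0).
  by move=> z zl; rewrite aE// bE//; ring.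
- apply: (mero_eqP (hu1.1 0 1) (hu1.1 0 0) (hs 1 0) (hs 0 0) U0 S0).
  move=> z zl; have [_] := root z zl; rewrite aE// bE// -!mulrA => /(mulfI n1) ->.
  by rewrite mulrC.
- exact: (k1_taylor k1 (boundary_Hardy a_ext.1 a_ext.2) (boundary_Hardy b_ext.1 b_ext.2) A0).
- by move=> n; exact: leading_formP.
- apply: (mero_eqP c_ext.1 d_ext.1 (hu2.1 1 0) (hu2.1 1 1) D0 V0).
  by move=> z zl; rewrite cE// dE//; ring.
- apply: (mero_eqP (hu2.1 1 0) (hu2.1 1 1) (hu.1 1 0) (hu.1 1 1) V0 W0).
  move=> z zl; have [h _] := root z zl; move: h; rewrite cE// dE// => h.
  apply: (mulfI n2); apply/eqP; rewrite eq_sym -subr_eq0 -h; apply/eqP; ring.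
- apply: (mero_eqP (hu.1 1 0) (hu.1 1 1) (hgp.1 1 0) (hgp.1 1 1) W0 G0).
  by move=> z zl; apply/eqP; rewrite -subr_eq0 [X in _ - X]mulrC (birkhoff_row g_tri g_RH zl).
- exact: (k2_taylor k2 (boundary_Hardy c_ext.1 c_ext.2) (boundary_Hardy d_ext.1 d_ext.2) D0).
- by move=> n n1'; exact: leading_formP.
Qed.
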